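(* Consider the following list of subspaces of $M_3(\mathbb C)$ (defined in the context), where $\theta$ ranges over $[0,\pi/2]$: $$\mathrm{VT}^3_0,\ \mathrm{VT}^3_2,\ \mathrm{VT}^3_3(\theta),\ \mathrm{VT}^3_4,\ \mathrm{VT}^3_5(\theta),\ \mathrm{VT}^3_6,\ \mathrm{VT}^3_8. \qquad ( * )$$ These form a complete classification of vertex-transitive quantum graphs in $M_3(\mathbb C)$ up to isomorphism. Explicitly: (1) each of the subspaces in the list $( * )$ is a vertex-transitive quantum graph; (2) no two of them are isomorphic; in particular, for $\theta_1\neq\theta_2$ in $[0,\pi/2]$, $\mathrm{VT}^3_3(\theta_1)\not\cong \mathrm{VT}^3_3(\theta_2)$ and $\mathrm{VT}^3_5(\theta_1)\not\cong\mathrm{VT}^3_5(\theta_2)$; (3) every vertex-transitive quantum graph $R\le M_3(\mathbb C)$ is isomorphic to a quantum graph in the list $( * )$.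
   Context: $R\le M_n(\mathbb C)$ means that $R$ is a complex linear subspace of $M_n(\mathbb C)$; $a^\dagger$ is the Hermitian adjoint; $\mathrm{tr}$ is the normalized trace, $\mathrm{tr}(1_n)=1$. A subspace $R\le M_n(\mathbb C)$ is a quantum graph if $\mathrm{tr}(a)=0$ and $a^\dagger\in R$ for all $a\in R$. Quantum graphs $R,S\le M_n(\mathbb C)$ are isomorphic, $R\cong S$, if there is a unitary $u\in M_n(\mathbb C)$ with $uRu^\dagger=S$. Let $\mathrm{Stab}(R)=\{u\in U(n)\mid uRu^\dagger=R\}$. $R$ is vertex-transitive if $\mathrm{Stab}(R)$ spans $M_n(\mathbb C)$ as a complex vector space. Let $e_{ij}$ be the matrix units of $M_3(\mathbb C)$, $\hat r_{ij}(\theta)=e^{-i\theta}e_{ij}+e^{i\theta}e_{ji}$, $\hat x_{ij}=\hat r_{ij}(0)=e_{ij}+e_{ji}$, $\hat y_{ij}=\hat r_{ij}(\pi/2)$. Let $\omega=-\frac12+i\frac{\sqrt3}{2}$, $\hat u=e_{21}+e_{32}+e_{13}$, $\hat v=\mathrm{diag}(1,\omega,\omega^2)$. Define - $\mathrm{VT}^3_0=\{0\}$; - $\mathrm{VT}^3_2=\mathbb C\,\mathrm{diag}(-1,-1,2)+\mathbb C\,\mathrm{diag}(-1,1,0)$ (the traceless diagonal matrices); - $\mathrm{VT}^3_3(\theta)=\mathbb C\hat x_{23}+\mathbb C\hat x_{31}+\mathbb C\hat r_{12}(\theta)$; - $\mathrm{VT}^3_4=\mathbb C\hat u+\mathbb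 C\hat u^2+\mathbb C\hat v+\mathbb C\hat v^2$; - $\mathrm{VT}^3_5(\theta)=\mathrm{VT}^3_2+\mathbb C\hat x_{23}+\mathbb C\hat x_{31}+\mathbb C\hat r_{12}(\theta)$; - $\mathrm{VT}^3_6=\mathbb C\hat x_{23}+\mathbb C\hat x_{31}+\mathbb C\hat x_{12}+\mathbb C\hat y_{23}+\mathbb C\hat y_{31}+\mathbb C\hat y_{12}$; - $\mathrm{VT}^3_8=\mathrm{VT}^3_2+\mathrm{VT}^3_6$. *)

(* Defs.v *)
From HB Require Import structures.
From mathcomp Require Import all_boot all_order all_algebra.
From mathcomp Require Import complex.
From mathcomp Require Import reals trigo.
Set Implicit Arguments.
Unset Strict Implicit.
Unset Printing Implicit Defensive.
Import Order.TTheory GRing.Theory Num.Theory.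
Local Open Scope ring_scope.
Local Open Scope sesquilinear_scope.

Section QuantumGraphs.
Variables (C : numClosedFieldType) (n : nat).
Implicit Types (u a : 'M[C]_n) (S T : {vspace 'M[C]_n}).

Definition ntr a : C := n%:R^-1 * \tr a.

Definition is_quantum_graph S : Prop :=
  forall a, a \in S -> ntr a = 0 /\ a ^t* \in S.

Definition mxconj u a : 'M[C]_n := u *m a *m u ^t*.

(* linfun, used below, agrees with mxconj u only because the latter is linear. *)
Fact mxconj_is_linear u : linear (mxconj u).
Proof.
by move=> k a b; rewrite /mxconj mulmxDr mulmxDl -scalemxAr -scalemxAl.
Qed.
HB.instance Definition _ u :=
  GRing.isLinear.Build C 'M[C]_n 'M[C]_n *:%R (mxconj u) (mxconj_is_linear u).

Definition conjv u S : {vspace 'M[C]_n} := (linfun (mxconj u) @: S)%VS.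

Definition qg_iso S T : Prop := exists2 u, u \is unitarymx & conjv u S = T.

Definition Stab S : {pred 'M[C]_n} :=
  [pred u | (u \is unitarymx) && (conjv u S == S)].

(* span takes a finite sequence and Stab S is infinite, so the span of Stab S
   is the union of the spans of the finite sequences of its elements. *)
Definition vertex_transitive S : Prop :=
  forall a, exists2 X : seq 'M[C]_n, {subset X <= Stab S} & a \in <<X>>%VS.

End QuantumGraphs.

Section VT3.
Variable R : realType.
Implicit Types (i j : 'I_3) (theta : R).
Local Notation C := R[i].

Definition expi theta : C := Complex (cos theta) (sin theta).

Definition i1 : 'I_3 := @Ordinal 3 0 isT.
Definition i2 : 'I_3 := @Ordinal 3 1 isT.
Definition i3 : 'I_3 := @Ordinal 3 2 isT.

Definition munit i j : 'M[C]_3 := delta_mx i j.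
Definition rhat i j theta : 'M[C]_3 :=
  expi (- theta) *: munit i j + expi theta *: munit j i.
Definition xhat i j : 'M[C]_3 := rhat i j 0.
Definition yhat i j : 'M[C]_3 := rhat i j (pi / 2).

Definition diag3 (a b c : C) : 'M[C]_3 := diag_mx (\row_k [:: a; b; c]`_k).

Definition omega : C := Complex (- (1 / 2)) (Num.sqrt 3 / 2).
Definition uhat : 'M[C]_3 := munit i2 i1 + munit i3 i2 + munit i1 i3.
Definition vhat : 'M[C]_3 := diag3 1 omega (omega ^+ 2).

Definition VT0 : {vspace 'M[C]_3} := 0%VS.
Definition VT2 : {vspace 'M[C]_3} :=
  (<[(diag3 (-1) (-1) 2)%R]> + <[(diag3 (-1) 1 0)%R]>)%VS.
Definition VT3 theta : {vspace 'M[C]_3} :=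
  (<[xhat i2 i3]> + <[xhat i3 i1]> + <[rhat i1 i2 theta]>)%VS.
Definition VT4 : {vspace 'M[C]_3} :=
  (<[uhat]> + <[uhat ^+ 2]> + <[vhat]> + <[vhat ^+ 2]>)%VS.
Definition VT5 theta : {vspace 'M[C]_3} :=
  (VT2 + <[xhat i2 i3]> + <[xhat i3 i1]> + <[rhat i1 i2 theta]>)%VS.
Definition VT6 : {vspace 'M[C]_3} :=
  (<[xhat i2 i3]> + <[xhat i3 i1]> + <[xhat i1 i2]>
   + <[yhat i2 i3]> + <[yhat i3 i1]> + <[yhat i1 i2]>)%VS.
Definition VT8 : {vspace 'M[C]_3} := (VT2 + VT6)%VS.

End VT3.

Inductive VTlabel (R : Type) : Type :=
  | L0 | L2 | L3 of R | L4 | L5 of R | L6 | L8.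
Arguments L0 {R}.
Arguments L2 {R}.
Arguments L4 {R}.
Arguments L6 {R}.
Arguments L8 {R}.

Definition in_list (R : realType) (l : VTlabel R) : Prop :=
  match l with
  | L3 theta | L5 theta => 0 <= theta <= pi / 2
  | _ => True
  end.

Definition VT (R : realType) (l : VTlabel R) : {vspace 'M[R[i]]_3} :=
  match l with
  | L0 => VT0 R
  | L2 => VT2 R
  | L3 theta => VT3 theta
  | L4 => VT4 R
  | L5 theta => VT5 theta
  | L6 => VT6 R
  | L8 => VT8 R
  end.

(* Main.v *)
Require Import Defs.
From HB Require Import structures.
From mathcomp Require Import all_boot all_order all_algebra.
From mathcomp Require Import complex.
From mathcomp Require Import reals trigo.
From mathcomp Require Import boolp ring lra zify.
Set Implicit Arguments.
Unset Strict Implicit.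
Unset Printing Implicit Defensive.
Import Order.TTheory GRing.Theory Num.Theory.
Local Open Scope ring_scope.
Local Open Scope sesquilinear_scope.

(* Since Stab(S) spans M_3(C), a matrix commuting with it is scalar. Hence a traceless X spanning a
   Stab(S)-invariant self-adjoint line satisfies X^2 = c, and Cayley-Hamilton gives X = 0; so no invariant
   subspace of S has dimension 1, and, taking commutators, those of dimension 2 are commutative, i.e. conjugate
   to the traceless diagonal matrices. Orthogonal complements in the traceless matrices reduce everything to
   dim S <= 4.
   dim S = 3: the cubic form f(A) = tr(A^3) on the hermitian part of S is harmonic, and its quadratic
   contraction T_ikl T_jkl is a multiple of the metric. Working from a zero of f, these equations force
   f = c xyz in some orthonormal basis; there 1 - 2 A_i^2 are three rank-one projections with sum 1, and in
   the corresponding basis of C^3 the A_i are the off-diagonal generators of VT_3(theta) up to phases.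
   dim S = 4: the alternating form tr([X,Y]Z) vanishes, since its radical would be an invariant line; so [S,S]
   lies in the 4-dimensional complement of S, and Lambda^2 S -> [S,S] has a kernel of dimension at least 2, which
   contains a decomposable vector: S contains a commutative plane W. At most two such planes exist
   (otherwise an invariant line appears), so W is invariant under a subgroup of index at most 2, still
   irreducible. Then W and its complement in S are commutative self-adjoint planes, and S is conjugate to VT_4.
   The parameter theta is recovered from sum_ijk T_ijk^2 = 3 cos^2 theta. *)

(** * The Hilbert-Schmidt form *)

(** Of the spanning hypothesis only Schur's condition is kept: a matrix fixed under conjugation by G
    is scalar. It is stated for a predicate G rather than for Stab(S), because dimension 4 needs it
    again for a subgroup of index 2. Fixed matrices come from contractions. If A_i is an orthonormal
    basis of an invariant space, the tensor sum_i A_i (x) A_i^* does not depend on the basis, and G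
    only changes the basis; so whatever is built from it is invariant. Thus sum_i A_i^2 is scalar,
    which together with tracelessness is the harmonicity of f. The size 3 enters in the exclusion of
    invariant lines: a traceless square root of a nonzero scalar exists only in even size. That
    exclusion also needs self-adjointness, which is not automatic for eigenspaces or for commutative
    planes and has to be recovered each time. The parameter in dimension 5 is read off from the
    complement, where every off-diagonal phase is multiplied by i. *)

Section HilbertSchmidt.
Variables (C : numClosedFieldType) (n : nat).
Local Notation M := 'M[C]_n.
Implicit Types (X Y Z u a : M) (S T : {vspace M}).

Lemma adjD X Y : (X + Y)^t* = X^t* + Y^t*.
Proof. by rewrite linearD map_mxD. Qed.
Lemma adjB X Y : (X - Y)^t* = X^t* - Y^t*.
Proof. by rewrite linearB map_mxB. Qed.
Lemma adjZ k X : (k *: X)^t* = k^* *: X^t*.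
Proof. by rewrite linearZ map_mxZ. Qed.
Lemma adjM X Y : (X *m Y)^t* = Y^t* *m X^t*.
Proof. by rewrite trmx_mul map_mxM. Qed.
Lemma adj0 : (0 : M)^t* = 0.
Proof. by rewrite trmx0 map_mx0. Qed.
Lemma adj_scalar c : (c%:M : M)^t* = c^*%:M.
Proof. by rewrite tr_scalar_mx map_scalar_mx. Qed.
Lemma adj_sum I (r : seq I) (P : pred I) (F : I -> M) :
  (\sum_(i <- r | P i) F i)^t* = \sum_(i <- r | P i) (F i)^t*.
Proof. by exact: (big_morph (fun X : M => X^t*) adjD adj0). Qed.
Lemma tr_adj X : \tr (X^t*) = (\tr X)^*.
Proof. by rewrite trace_map_mx mxtrace_tr. Qed.
Lemma adjK X : X^t*^t* = X. Proof. exact: trmxCK. Qed.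
Lemma adjE X i j : X^t* i j = (X j i)^*.
Proof. by rewrite !mxE. Qed.

(** Conjugate-linear on the left, linear on the right. The codomain is C as a module over itself, so
    that [hs X] is a linear form with a kernel. *)
Definition hs X Y : C^o := \tr (X^t* *m Y).

Fact hs_is_linear X : linear (hs X).
Proof.
by move=> k Y Z; rewrite /hs mulmxDr -scalemxAr mxtraceD mxtraceZ.
Qed.
HB.instance Definition _ X := GRing.isLinear.Build C M C^o *:%R (hs X) (hs_is_linear X).

Lemma hsC X Y : hs Y X = (hs X Y)^*.
Proof. by rewrite /hs -tr_adj adjM adjK. Qed.
Lemma hsDl X Y Z : hs (X + Y) Z = hs X Z + hs Y Z.
Proof. by rewrite /hs adjD mulmxDl mxtraceD. Qed.
Lemma hsZl k X Y : hs (k *: X) Y = k^* * hs X Y.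
Proof. by rewrite /hs adjZ -scalemxAl mxtraceZ. Qed.
Lemma hsZr k X Y : hs X (k *: Y) = k * hs X Y.
Proof. exact: linearZ. Qed.
Lemma hs_suml I (r : seq I) (P : pred I) (F : I -> M) Z :
  hs (\sum_(i <- r | P i) F i) Z = \sum_(i <- r | P i) hs (F i) Z.
Proof.
rewrite (big_morph (hs^~ Z) (fun X Y => hsDl X Y Z) (_ : _ = 0)) //.
by rewrite /hs adj0 mul0mx mxtrace0.
Qed.

Lemma hsE X Y : hs X Y = \sum_i \sum_j (X i j)^* * Y i j.
Proof.
rewrite /hs /mxtrace exchange_big; apply: eq_bigr => j _ /=.
by rewrite mxE; apply: eq_bigr => i _; rewrite adjE.
Qed.
Lemma hs_ge0 X : 0 <= hs X X.
Proof.
rewrite hsE sumr_ge0 // => i _; rewrite sumr_ge0 // => j _.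
by rewrite mulrC -normCK exprn_ge0.
Qed.
Lemma hs_eq0 X : hs X X = 0 -> X = 0.
Proof.
rewrite hsE => /eqP; rewrite psumr_eq0 => [|i _]; last first.
  by rewrite sumr_ge0 // => j _; rewrite mulrC -normCK exprn_ge0.
move=> /allP h; apply/matrixP => i j; rewrite mxE.
have /implyP := h i (mem_index_enum i) => /(_ isT).
rewrite psumr_eq0 => [|k _]; last by rewrite mulrC -normCK exprn_ge0.
move=> /allP /(_ j (mem_index_enum j)) /implyP /(_ isT).
by rewrite mulrC -normCK expf_eq0 normr_eq0 => /eqP.
Qed.

(** The complement is relative to T because it is taken both in the traceless matrices and inside
    invariant spaces. Finitely many kernels suffice, one for each vector of a basis of S. *)
Definition orthv T S : {vspace M} :=
  (T :&: \bigcap_(i < \dim S) lker (linfun (hs (vbasis S)`_i)))%VS.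

Lemma orthvP T S Y :
  reflect (Y \in T /\ forall X, X \in S -> hs X Y = 0) (Y \in orthv T S).
Proof.
rewrite /orthv memv_cap; apply: (iffP andP) => -[hT h]; split=> //.
  move=> X /coord_vbasis ->; rewrite hs_suml big1 // => i _.
  rewrite hsZl; move: h; rewrite memvE => /subv_bigcapP /(_ i isT).
  by rewrite -memvE memv_ker lfunE => /eqP ->; rewrite mulr0.
rewrite memvE; apply/subv_bigcapP => i _.
by rewrite -memvE memv_ker lfunE /= h // vbasis_mem // mem_nth ?size_tuple.
Qed.

Definition sdj S := forall X, X \in S -> X^t* \in S.
Definition trless S := forall X, X \in S -> \tr X = 0.

Lemma quantum_graphE S :
  (0 < n)%N -> is_quantum_graph S <-> trless S /\ sdj S.
Proof.
move=> n0; rewrite /is_quantum_graph /ntr; split => [h|[h1 h2] X XS].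
  split=> X XS; have [/eqP + ?] := h X XS => //.
  by rewrite mulf_eq0 invr_eq0 pnatr_eq0 -leqn0 leqNgt n0 => /eqP.
by rewrite h1 // mulr0 h2.
Qed.

Lemma sdj_orthv T S : sdj T -> sdj S -> sdj (orthv T S).
Proof.
move=> sT sS Y /orthvP[YT YS]; apply/orthvP; split=> [|X XS]; first exact: sT.
apply/eqP; rewrite -conjC_eq0 -hsC /hs adjK mxtrace_mulC.
by have := YS _ (sS X XS); rewrite /hs adjK => ->.
Qed.

Definition onb d S (A : 'I_d -> M) :=
  [/\ forall i, A i \in S, forall i j, hs (A i) (A j) = (i == j)%:R
    & forall X, X \in S -> X = \sum_i hs (A i) X *: A i].

Lemma onb_basis d S (A : 'I_d -> M) : onb S A -> basis_of S [tuple A i | i < d].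
Proof.
case=> AS Ao Ag; rewrite basisEfree; apply/and3P; split.
- apply/freeP => k; under eq_bigr do rewrite -tnth_nth tnth_mktuple.
  move=> k0 i; have := congr1 (hs (A i)) k0; rewrite linear0 linear_sum.
  rewrite (bigD1 i) //= hsZr Ao eqxx mulr1 big1 ?addr0 // => j ji.
  by rewrite hsZr Ao eq_sym (negbTE ji) mulr0.
- by apply/span_subvP => _ /tnthP[i ->]; rewrite tnth_mktuple.
- rewrite size_tuple -[d in (_ <= d)%N]card_ord.
  have: (S <= <<[tuple A i | i < d]>>)%VS.
    apply/subvP => X /Ag ->; apply: memv_suml => i _; apply: memvZ.
    by apply: memv_span; apply/tnthP; exists i; rewrite tnth_mktuple.
  by move/dimvS/leq_trans; apply; rewrite (leq_trans (dim_span _)) // size_tuple card_ord.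
Qed.

Lemma onb_dim d S (A : 'I_d -> M) : onb S A -> \dim S = d.
Proof. by move/onb_basis/size_basis. Qed.

Lemma dim_orthv_line S X : X \in S -> X != 0 -> \dim (orthv S <[X]>) = (\dim S).-1.
Proof.
move=> XS X0; have hX : hs X X != 0 by apply: contra X0 => /eqP/hs_eq0 ->.
have e : (<[X]> + orthv S <[X]>)%VS = S.
  apply/eqP; rewrite eqEsubv subv_add -memvE XS capvSl /=.
  apply/subvP => Y YS; rewrite -(subrK ((hs X Y / hs X X) *: X) Y) addrC.
  apply: memv_add; first by rewrite memvZ ?memv_line.
  apply/orthvP; split; first by rewrite memvB ?memvZ.
  move=> _ /vlineP[k ->]; rewrite hsZl linearB /= hsZr divfK // subrr mulr0 //.
have d : (<[X]> :&: orthv S <[X]>)%VS = 0%VS.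
  apply/eqP; rewrite -subv0; apply/subvP => _ /memv_capP[/vlineP[k ->] /orthvP[_ /(_ X)]].
  rewrite memv_line hsZr => /(_ isT) /eqP; rewrite mulf_eq0 (negbTE hX) orbF.
  by move/eqP->; rewrite scale0r mem0v.
by rewrite -[in RHS]e dimv_disjoint_sum // dim_vline X0.
Qed.

(** Gram-Schmidt, with P a property of vectors and Q one of subspaces that passes to complements.
    Trivial P and Q give orthonormal bases; hermitian P with self-adjoint Q gives hermitian ones.
    Normalizing uses a positive factor only, which keeps a matrix hermitian. *)
Lemma onb_exists_gen (P : M -> Prop) (Q : {vspace M} -> Prop) :
  (forall k X, 0 < k -> P X -> P (k *: X)) ->
  (forall S, Q S -> S != 0%VS -> exists X, [/\ X \in S, X != 0 & P X]) ->
  (forall S X, Q S -> X \in S -> P X -> Q (orthv S <[X]>)) ->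
  forall S, Q S -> exists2 A : 'I_(\dim S) -> M, onb S A & forall i, P (A i).
Proof.
move=> hZ hX hQ S; move dS : (\dim S) => d; elim: d S dS => [|d IH] S dS QS.
  have S0 : S = 0%VS by apply/eqP; rewrite -dimv_eq0 dS.
  exists (fun=> 0) => [|[]//]; split; try by case.
  by move=> X; rewrite S0 memv0 big_ord0 => /eqP.
have S0 : S != 0%VS by rewrite -dimv_eq0 dS.
have [X0 [XS X0n PX0]] := hX S QS S0.
have hp : 0 < hs X0 X0.
  by rewrite lt_def hs_ge0 andbT; apply: contra X0n => /eqP/hs_eq0 ->.
pose k := (sqrtC (hs X0 X0))^-1.
have k0 : 0 < k by rewrite invr_gt0 sqrtC_gt0.
pose X := k *: X0.
have XX : hs X X = 1.
  rewrite hsZl hsZr (CrealP (gtr0_real k0)) mulrA -expr2 exprVn sqrtCK.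
  by rewrite mulVf // gt_eqF.
have XinS : X \in S by rewrite memvZ.
have PX : P X by exact: hZ.
have Xn : X != 0 by rewrite scaler_eq0 negb_or X0n gt_eqF.
have [|A [AS Ao Ag] PA] := IH _ _ (hQ S X QS XinS PX).
  by rewrite dim_orthv_line // dS.
have XA i : hs X (A i) = 0.
  by have /orthvP[_ -> //] := AS i; rewrite memv_line.
exists (fun i => if unlift ord0 i is Some j then A j else X); last first.
  by move=> i; case: unliftP.
split.
- by move=> i; case: unliftP => // j _; have /orthvP[] := AS j.
- move=> i j; case: unliftP => [i'|] ->; case: unliftP => [j'|] -> //.
  by rewrite hsC XA conjC0 eq_sym (negbTE (neq_lift _ _)).
move=> Y YS; rewrite big_ord_recl unlift_none.
have /Ag e : Y - hs X Y *: X \in orthv S <[X]>.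
  apply/orthvP; split; first by rewrite memvB ?memvZ.
  by move=> _ /vlineP[c ->]; rewrite hsZl linearB /= hsZr XX mulr1 subrr mulr0.
rewrite -[LHS](subrK (hs X Y *: X)) addrC; congr (_ + _).
rewrite [LHS]e; apply: eq_bigr => i _; rewrite liftK linearB /= hsZr.
by rewrite [hs _ X]hsC XA conjC0 mulr0 subr0.
Qed.

Lemma onb_exists S : exists A : 'I_(\dim S) -> M, onb S A.
Proof.
have [|S' _ S0|//|A hA _] := @onb_exists_gen (fun=> True) (fun=> True) _ _ _ S I.
- by [].
- exists (vpick S'); rewrite memv_pick; split=> //.
  by rewrite vpick0.
- by exists A.
Qed.

Definition hermbasis d S (A : 'I_d -> M) := onb S A /\ forall i, (A i)^t* = A i.

(** A nonzero self-adjoint space contains a nonzero hermitian matrix: X + X^* when this is not 0,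
    and otherwise iX, as X is then antihermitian. *)
Lemma hermbasis_exists S : sdj S -> exists A : 'I_(\dim S) -> M, hermbasis S A.
Proof.
move=> sS; have [|S' sS' S0||A hA hA'] :=
  @onb_exists_gen (fun X => X^t* = X) sdj _ _ _ S sS; last by exists A.
- by move=> k X k0 hX; rewrite adjZ hX (CrealP (gtr0_real k0)).
- pose X := vpick S'; have XS : X \in S' by exact: memv_pick.
  have X0 : X != 0 by rewrite vpick0.
  have [e|ne] := eqVneq (X + X^t*) 0.
    exists ('i *: X); split; first by rewrite memvZ.
      by rewrite scaler_eq0 negb_or X0 neq0Ci.
    by move/eqP: e; rewrite addrC addr_eq0 => /eqP e; rewrite adjZ e conjCi scalerN scaleNr opprK.
  exists (X + X^t*); split=> //; first by rewrite memvD // sS'.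
  by rewrite adjD adjK addrC.
- move=> S' X sS' XS hX; apply: sdj_orthv => // _ /vlineP[c ->].
  by rewrite adjZ hX memvZ ?memv_line.
Qed.

Lemma addv_orthv T S : (S <= T)%VS -> (S + orthv T S)%VS = T.
Proof.
move=> ST; have [A [AS Ao Ag]] := onb_exists S.
apply/eqP; rewrite eqEsubv subv_add ST capvSl /=; apply/subvP => Y YT.
pose Y1 := \sum_i hs (A i) Y *: A i.
have Y1S : Y1 \in S by apply: memv_suml => i _; apply: memvZ.
rewrite -(subrK Y1 Y) addrC; apply: memv_add => //.
apply/orthvP; split; first by rewrite memvB // (subvP ST).
move=> X /Ag ->; rewrite hs_suml big1 // => i _.
rewrite hsZl linearB /= [hs _ Y1]linear_sum (bigD1 i) //= hsZr Ao eqxx mulr1 big1.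
  by rewrite addr0 subrr mulr0.
by move=> j ji; rewrite hsZr Ao eq_sym (negbTE ji) mulr0.
Qed.

Lemma dim_orthv T S : (S <= T)%VS -> \dim (orthv T S) = (\dim T - \dim S)%N.
Proof.
move=> ST; have d : (S :&: orthv T S)%VS = 0%VS.
  apply/eqP; rewrite -subv0; apply/subvP => Y /memv_capP[YS /orthvP[_ /(_ Y YS)]].
  by move/hs_eq0->; rewrite mem0v.
by rewrite -[in RHS](addv_orthv ST) dimv_disjoint_sum // addKn.
Qed.

Lemma orthvK T S : (S <= T)%VS -> orthv T (orthv T S) = S.
Proof.
move=> ST; apply/esym/eqP; rewrite eqEdim; apply/andP; split.
  apply/subvP => X XS; apply/orthvP; split; first exact: (subvP ST).
  by move=> Y /orthvP[_ /(_ X XS)]; rewrite [hs Y X]hsC => ->; rewrite conjC0.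
by rewrite !dim_orthv ?capvSl // subKn // dimvS.
Qed.

End HilbertSchmidt.

(** * Unitary conjugation, invariant subspaces and Schur's condition *)

Section Conjugation.
Variables (C : numClosedFieldType) (n : nat).
Local Notation M := 'M[C]_n.
Implicit Types (X Y Z u v a : M) (S T : {vspace M}).

Lemma unitary_mulV u : u \is unitarymx -> u *m u^t* = 1%:M.
Proof. by move/unitarymxP. Qed.
Lemma unitary_mulVr u : u \is unitarymx -> u^t* *m u = 1%:M.
Proof. by move/unitary_mulV/mulmx1C. Qed.
Lemma unitary_adj u : u \is unitarymx -> u^t* \is unitarymx.
Proof. by rewrite trmxC_unitary. Qed.

Lemma unitary1 : (1%:M : M) \is unitarymx.
Proof. by apply/unitarymxP; rewrite adj_scalar conjC1 mulmx1. Qed.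

Lemma mxconj_adj u X : (mxconj u X)^t* = mxconj u (X^t* ).
Proof. by rewrite /mxconj !adjM adjK mulmxA. Qed.
Lemma mxconj_comp u v X : mxconj u (mxconj v X) = mxconj (u *m v) X.
Proof. by rewrite /mxconj adjM !mulmxA. Qed.
Lemma mxconjM u X Y : u \is unitarymx ->
  mxconj u (X *m Y) = mxconj u X *m mxconj u Y.
Proof.
move=> hu; rewrite /mxconj !mulmxA; congr (_ *m _ *m _).
by rewrite -[_ *m u^t* *m u]mulmxA unitary_mulVr // mulmx1.
Qed.
Lemma mxconj_scalar u c : u \is unitarymx -> mxconj u c%:M = c%:M.
Proof.
by move=> hu; rewrite /mxconj scalar_mxC -mulmxA unitary_mulV // mulmx1.
Qed.
Lemma mxconj1 X : mxconj 1%:M X = X.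
Proof. by rewrite /mxconj adj_scalar conjC1 mul1mx mulmx1. Qed.
Lemma mxconjK u X : u \is unitarymx -> mxconj (u^t* ) (mxconj u X) = X.
Proof. by move=> hu; rewrite mxconj_comp unitary_mulVr // mxconj1. Qed.
Lemma mxconjVK u X : u \is unitarymx -> mxconj u (mxconj (u^t* ) X) = X.
Proof. by move=> hu; rewrite mxconj_comp unitary_mulV // mxconj1. Qed.
Lemma mxconj_tr u X : u \is unitarymx -> \tr (mxconj u X) = \tr X.
Proof. by move=> hu; rewrite mxtrace_mulC mulmxA unitary_mulVr // mul1mx. Qed.
Lemma hs_mxconj u X Y : u \is unitarymx -> hs (mxconj u X) (mxconj u Y) = hs X Y.
Proof. by move=> hu; rewrite /hs mxconj_adj -mxconjM // mxconj_tr. Qed.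

Lemma mem_conjv u S X : X \in S -> mxconj u X \in conjv u S.
Proof. by move=> XS; rewrite -[mxconj u X]lfunE; apply: memv_img. Qed.
Lemma conjvP u S X : u \is unitarymx -> (X \in conjv u S) = (mxconj (u^t* ) X \in S).
Proof.
move=> hu; apply/memv_imgP/idP => [[Y YS ->]|XS].
  by rewrite lfunE /= mxconjK.
by exists (mxconj (u^t* ) X) => //; rewrite lfunE /= mxconjVK.
Qed.
Lemma conjv_comp u v S : conjv u (conjv v S) = conjv (u *m v) S.
Proof.
rewrite /conjv -limg_comp; congr (_ @: _)%VS.
by apply/lfunP => X; rewrite comp_lfunE !lfunE /= mxconj_comp.
Qed.
Lemma conjv1 S : conjv 1%:M S = S.
Proof.
rewrite /conjv -[RHS]lim1g; congr (_ @: _)%VS.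
by apply/lfunP => X; rewrite !lfunE /= mxconj1.
Qed.
Lemma conjvK u S : u \is unitarymx -> conjv (u^t* ) (conjv u S) = S.
Proof. by move=> hu; rewrite conjv_comp unitary_mulVr // conjv1. Qed.
Lemma conjvS u S T : (S <= T)%VS -> (conjv u S <= conjv u T)%VS.
Proof. exact: limgS. Qed.
Lemma dim_conjv u S : u \is unitarymx -> \dim (conjv u S) = \dim S.
Proof.
move=> hu; apply/eqP; rewrite eqn_leq limg_dim_eq.
  by rewrite leqnn.
apply/eqP; rewrite -subv0; apply/subvP => X /memv_capP[_].
rewrite memv_ker lfunE /= => /eqP /(congr1 (mxconj (u^t* ))).
by rewrite mxconjK // linear0 => ->; rewrite mem0v.
Qed.
Lemma conjv_orthv u S T : u \is unitarymx ->
  conjv u (orthv T S) = orthv (conjv u T) (conjv u S).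
Proof.
move=> hu; apply/vspaceP => X; rewrite conjvP //.
apply/orthvP/orthvP => -[]; rewrite ?conjvP // => h1 h2; split=> // Y.
  by rewrite conjvP // => /h2; rewrite -(hs_mxconj _ _ hu) !mxconjVK.
by move=> YS; rewrite -(hs_mxconj _ _ hu) !mxconjVK // h2 // mem_conjv.
Qed.
Lemma sdj_conjv u S : u \is unitarymx -> sdj S -> sdj (conjv u S).
Proof. by move=> hu hS X; rewrite !conjvP // -mxconj_adj => /hS. Qed.
Lemma trless_conjv u S : u \is unitarymx -> trless S -> trless (conjv u S).
Proof.
by move=> hu hS X; rewrite conjvP // => /hS; rewrite mxconj_tr // unitary_adj.
Qed.

Lemma conjv_eq u S T : u \is unitarymx -> \dim S = \dim T ->
  (forall X, X \in S -> mxconj u X \in T) -> conjv u S = T.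
Proof.
move=> hu hd h; apply/eqP; rewrite eqEdim dim_conjv // hd leqnn andbT.
by apply/subvP => X; rewrite conjvP // => /h; rewrite mxconjVK.
Qed.

Lemma qg_iso_trans S T V : qg_iso S T -> qg_iso T V -> qg_iso S V.
Proof.
case=> u hu <- [v hv <-]; exists (v *m u); first exact: mul_unitarymx.
by rewrite conjv_comp.
Qed.
Lemma qg_iso_refl S : qg_iso S S.
Proof. by exists 1%:M; rewrite ?conjv1 // unitary1. Qed.

Lemma onb_mxconj d u S (A : 'I_d -> M) : u \is unitarymx ->
  onb S A -> onb (conjv u S) (fun i => mxconj u (A i)).
Proof.
move=> hu [AS Ao Ag]; split=> [i|i j|X].
- exact: mem_conjv.
- by rewrite hs_mxconj.
rewrite conjvP // => /Ag /(congr1 (mxconj u)); rewrite mxconjVK // linear_sum => e.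
rewrite [LHS]e; apply: eq_bigr => i _.
by rewrite linearZ /= -[in RHS](mxconjVK X hu) hs_mxconj.
Qed.

Lemma hermbasis_mxconj d u S (A : 'I_d -> M) : u \is unitarymx ->
  hermbasis S A -> hermbasis (conjv u S) (fun i => mxconj u (A i)).
Proof.
by move=> hu [hA hh]; split=> [|i]; [apply: onb_mxconj | rewrite mxconj_adj hh].
Qed.

Lemma lin_sum (U V : lmodType C) (f : U -> V) I (r : seq I) (k : I -> C) (x : I -> U) :
  linear f -> f (\sum_(i <- r) k i *: x i) = \sum_(i <- r) k i *: f (x i).
Proof.
move=> hf; have f0 : f 0 = 0.
  by have := hf (-1) 0 0; rewrite scaler0 addr0 scaleN1r addNr.
elim: r => [|i r IH]; first by rewrite !big_nil.
by rewrite !big_cons hf IH.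
Qed.

(** Two orthonormal bases differ by a unitary matrix U, and U^* U = 1 collapses the double sum. With
    a basis and its conjugate by an element of G, this shows that a contraction is invariant. *)
Lemma casimir (V : lmodType C) (b : M -> M -> V) d S (A B : 'I_d -> M) :
  (forall Y, linear (b^~ Y)) -> (forall X, linear (b X)) -> onb S A -> onb S B ->
  \sum_i b (A i) ((A i)^t* ) = \sum_i b (B i) ((B i)^t* ).
Proof.
move=> bl br [AS Ao Ag] [BS Bo Bg].
pose U : 'M[C]_d := \matrix_(i, j) hs (A j) (B i).
have UU : U^t* *m U = 1%:M.
  apply: mulmx1C; apply/matrixP => i j; rewrite !mxE eq_sym -Bo.
  rewrite [in RHS](Ag _ (BS i)) linear_sum /=; apply: eq_bigr => k _.
  by rewrite hsZr !mxE -hsC.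
have e i : B i = \sum_j U i j *: A j.
  by rewrite {1}(Ag _ (BS i)); apply: eq_bigr => j _; rewrite mxE.
have e' i : (B i)^t* = \sum_j (U i j)^* *: (A j)^t*.
  by rewrite {1}e adj_sum; apply: eq_bigr => j _; rewrite adjZ.
under [RHS]eq_bigr => i _.
  rewrite e' lin_sum //.
  under eq_bigr => j _ do rewrite e (lin_sum _ _ _ (bl _)) scaler_sumr.
  over.
rewrite /= exchange_big /=; apply: eq_bigr => j _; rewrite exchange_big /=.
rewrite (bigD1 j) //= [X in _ + X]big1 => [|k kj].
  rewrite addr0; under eq_bigr do rewrite scalerA.
  rewrite -scaler_suml; have := congr1 (fun m : 'M_d => m j j) UU.
  rewrite !mxE eqxx => h.
  by rewrite (eq_bigr (fun i => U^t* j i * U i j)) ?h ?scale1r // => i _; rewrite !mxE.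
under eq_bigr do rewrite scalerA.
rewrite -scaler_suml; have := congr1 (fun m : 'M_d => m j k) UU.
rewrite !mxE eq_sym (negbTE kj) => h.
by rewrite (eq_bigr (fun i => U^t* j i * U i k)) ?h ?scale0r // => i _; rewrite !mxE.
Qed.

(** Schur's condition instead of the spanning one: it is what the arguments use, and it can be
    carried over to a subgroup of index 2. Closure under adjoints is closure under inverses. *)
Definition irred (G : M -> Prop) :=
  [/\ forall u, G u -> u \is unitarymx, forall u, G u -> G (u^t* )
    & forall X, (forall u, G u -> mxconj u X = X) -> exists c, X = c%:M].

Definition ginv (G : M -> Prop) S := forall u X, G u -> X \in S -> mxconj u X \in S.

Lemma ginv_conjv (G : M -> Prop) S u : irred G -> ginv G S -> G u -> conjv u S = S.
Proof.
by move=> [Gu _ _] GS hu; apply: conjv_eq => [||X]; [apply: Gu| | apply: GS].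
Qed.

Lemma ginv_orthv (G : M -> Prop) S T : irred G ->
  ginv G T -> ginv G S -> ginv G (orthv T S).
Proof.
move=> iG GT GS u X hu XS; have [Gu _ _] := iG.
have := conjv_orthv S T (Gu u hu).
rewrite (ginv_conjv iG GT hu) (ginv_conjv iG GS hu) => <-.
exact: mem_conjv.
Qed.

(** X commutes with the stabilizer, hence with its span, the whole matrix algebra; commuting with
    the matrix units makes it scalar. *)
Lemma vertex_transitive_irred S : vertex_transitive S -> irred (fun u => u \in Stab S).
Proof.
move=> hS; split=> [u /andP[] //|u|X hX].
  rewrite !inE => /andP[hu /eqP e]; rewrite unitary_adj //=.
  by rewrite -{1}e conjvK.
have comm Y : Y *m X = X *m Y.
  have [r hr Yr] := hS Y; rewrite (@coord_span _ _ _ (in_tuple r) Y Yr) mulmx_suml mulmx_sumr.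
  apply: eq_bigr => i _; rewrite -scalemxAl -scalemxAr; congr (_ *: _).
  set u := (_`_i); have uS : u \in Stab S by apply: hr; apply: mem_nth.
  rewrite -{2}(hX u uS) /mxconj -!mulmxA unitary_mulVr ?mulmx1 //.
  by case/andP: uS.
have [n0|n0] := posnP n.
  by exists 0; apply/matrixP => i; have := ltn_ord i; rewrite {2}n0 ltn0.
have ce i j k l : (delta_mx i j *m X) k l = (X *m delta_mx i j) k l.
  by rewrite comm.
have e1 i j k l : (k == i)%:R * X j l = X k i * (l == j)%:R :> C.
  move: (ce i j k l); rewrite !mxE (bigD1 j) //= big1 => [|m mj]; last first.
    by rewrite mxE (negbTE mj) andbF mul0r.
  rewrite addr0 mxE eqxx andbT => ->; rewrite (bigD1 i) //= big1 => [|m mi].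
    by rewrite addr0 mxE eqxx.
  by rewrite mxE (negbTE mi) mulr0.
pose z : 'I_n := Ordinal n0.
exists (X z z); apply/matrixP => i j; rewrite mxE.
have [<-|ij] := eqVneq i j.
  by have := e1 z i z i; rewrite !eqxx mul1r mulr1 => ->.
by have := e1 j i j j; rewrite eqxx [j == i]eq_sym (negbTE ij) mul1r mulr0 => ->.
Qed.

Lemma Stab_ginv S : ginv (fun u => u \in Stab S) S.
Proof. by move=> u X /andP[_ /eqP {2}<-] XS; apply: mem_conjv. Qed.

End Conjugation.

(** * Irreducible stabilizers in dimension 3 *)

Lemma sum3 (V : nmodType) (F : 'I_3 -> V) : \sum_i F i = F i1 + F i2 + F i3.
Proof.
rewrite !big_ord_recl big_ord0 addr0 addrA.
by congr (F _ + F _ + F _); apply: val_inj.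
Qed.

Lemma forall3 (P : 'I_3 -> Prop) : P i1 -> P i2 -> P i3 -> forall i, P i.
Proof.
move=> p1 p2 p3 [[|[|[|//]]] hi].
- by rewrite (_ : Ordinal hi = i1) //; apply: val_inj.
- by rewrite (_ : Ordinal hi = i2) //; apply: val_inj.
- by rewrite (_ : Ordinal hi = i3) //; apply: val_inj.
Qed.

Lemma mx3P (T : Type) (X Y : 'M[T]_3) :
  X i1 i1 = Y i1 i1 -> X i1 i2 = Y i1 i2 -> X i1 i3 = Y i1 i3 ->
  X i2 i1 = Y i2 i1 -> X i2 i2 = Y i2 i2 -> X i2 i3 = Y i2 i3 ->
  X i3 i1 = Y i3 i1 -> X i3 i2 = Y i3 i2 -> X i3 i3 = Y i3 i3 -> X = Y.
Proof. by move=> *; apply/matrixP; do 2!apply: forall3. Qed.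

Section Irreducible3.
Variable C : numClosedFieldType.
Local Notation M := 'M[C]_3.
Implicit Types (X Y Z u : M) (S T W : {vspace M}) (G : M -> Prop).

(** For trace 0, Newton's identities turn the coefficients of the characteristic polynomial into
    tr(X^2)/2 and tr(X^3)/3. *)
Lemma cayley_hamilton3 X : \tr X = 0 ->
  X *m X *m X = (\tr (X *m X) / 2) *: X + (\tr (X *m X *m X) / 3)%:M.
Proof.
move=> hX; have {}hX : X i3 i3 = - X i1 i1 - X i2 i2.
  by move: hX; rewrite /mxtrace sum3 => /eqP; rewrite addrC addr_eq0 opprD => /eqP.
by apply: mx3P; rewrite /mxtrace !mxE !sum3 !mxE !sum3 !mxE !sum3 /= hX ?mulr1n ?mulr0n;
  field.
Qed.

(** G multiplies X by phases, so it fixes the product of X and its adjoint, which is therefore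
    scalar. The adjoint being a multiple of X, also X^2 = s. Then tr X^2 = 3s and tr X^3 = 0, so
    Cayley-Hamilton reads sX = (3/2) sX; this kills s, and then X. *)
Lemma invariant_line_eq0 G X : irred G -> \tr X = 0 ->
  (forall u, G u -> exists c, mxconj u X = c *: X) ->
  (exists c, X^t* = c *: X) -> X = 0.
Proof.
move=> [Gu _ Gs] tX hG [d hd]; apply/eqP; case: (eqVneq X 0) => // X0.
have hX : hs X X != 0 by apply: contra X0 => /eqP/hs_eq0 ->.
have [c hc] : exists c, X *m X^t* = c%:M.
  apply: Gs => u Gu1; have hu := Gu u Gu1; have [k hk] := hG u Gu1.
  have kk : k * k^* = 1.
    apply: (mulIf hX); rewrite mul1r -{2}(hs_mxconj _ _ hu) hk hsZl hsZr mulrA.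
    by congr (_ * _); rewrite mulrC.
  by rewrite mxconjM // -mxconj_adj hk adjZ -scalemxAl -scalemxAr scalerA kk scale1r.
have d0 : d != 0.
  by apply: contra X0 => /eqP d0; rewrite -[X]adjK hd d0 scale0r adj0.
have XX : X *m X = (d^-1 * c)%:M.
  by rewrite -scale_scalar_mx -hc hd -scalemxAr scalerA mulVf // scale1r.
move: (d^-1 * c) XX => s XX.
have := cayley_hamilton3 tX.
rewrite XX mxtrace_scalar mul_scalar_mx mxtraceZ tX mulr0 mul0r raddf0 addr0.
move/eqP; rewrite -subr_eq0 -scalerBl scaler_eq0 (negbTE X0) orbF => s0.
have {s0}/eqP s0 : s == 0.
  by move: s0; rewrite (_ : s - _ = - (s / 2)) ?oppr_eq0 ?mulf_eq0 ?invr_eq0 ?pnatr_eq0 ?orbF // -mulr_natr; field.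
move: XX; rewrite s0 raddf0 => XX; case/negP: hX.
rewrite /hs hd -scalemxAl XX scaler0 mxtrace0 eqxx //.
Qed.

Lemma no_invariant_line G S : irred G -> ginv G S -> sdj S -> trless S -> \dim S != 1%N.
Proof.
move=> iG GS sS tS; apply/eqP => d1.
have [X XS X0] : exists2 X, X \in S & X != 0.
  by exists (vpick S); rewrite ?memv_pick // vpick0 -dimv_eq0 d1.
have line Y : Y \in S -> exists c, Y = c *: X.
  have <- : <[X]>%VS = S by apply/eqP; rewrite eqEdim -memvE XS d1 dim_vline X0.
  by move/vlineP.
case/eqP: X0; apply: (invariant_line_eq0 iG); first exact: tS.
- by move=> u hu; apply: line; apply: GS.
- by apply: line; apply: sS.
Qed.

Definition comm (X Y : M) : M := X *m Y - Y *m X.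

Lemma comm_eq0 X Y : comm X Y = 0 <-> X *m Y = Y *m X.
Proof. by rewrite /comm; split=> [/eqP|->]; rewrite ?subrr // subr_eq0 => /eqP. Qed.
Lemma commDl X Y Z : comm (X + Y) Z = comm X Z + comm Y Z.
Proof. by rewrite /comm mulmxDl mulmxDr opprD addrACA. Qed.
Lemma commZl k X Y : comm (k *: X) Y = k *: comm X Y.
Proof. by rewrite /comm -scalemxAl -scalemxAr scalerBr. Qed.
Lemma commC X Y : comm X Y = - comm Y X.
Proof. by rewrite /comm opprB. Qed.
Lemma commDr X Y Z : comm X (Y + Z) = comm X Y + comm X Z.
Proof. by rewrite commC commDl opprD -!(commC X). Qed.
Lemma commZr k X Y : comm X (k *: Y) = k *: comm X Y.
Proof. by rewrite commC commZl -scalerN -commC. Qed.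
Lemma commxx X : comm X X = 0.
Proof. by rewrite /comm subrr. Qed.
Lemma comm_tr X Y : \tr (comm X Y) = 0.
Proof. by rewrite linearB /= [\tr (Y *m X)]mxtrace_mulC subrr. Qed.
Lemma comm_adj X Y : (comm X Y)^t* = comm (Y^t* ) (X^t* ).
Proof. by rewrite /comm adjB !adjM. Qed.
Lemma mxconj_comm u X Y : u \is unitarymx ->
  mxconj u (comm X Y) = comm (mxconj u X) (mxconj u Y).
Proof. by move=> hu; rewrite /comm linearB /= !mxconjM. Qed.

Lemma sum2 (V : nmodType) (F : 'I_2 -> V) : \sum_i F i = F ord0 + F ord_max.
Proof. by rewrite big_ord_recl big_ord1; congr (_ + F _); apply: val_inj. Qed.

Definition abelian S := forall X Y, X \in S -> Y \in S -> X *m Y = Y *m X.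

(** All commutators of a plane are multiples of the one of two basis vectors. That one is traceless,
    and its line is invariant and self-adjoint, so it vanishes. *)
Lemma dim2_abelian G S : irred G -> ginv G S -> sdj S -> \dim S = 2%N -> abelian S.
Proof.
move=> iG GS sS d2; have [Gu _ _] := iG.
have := onb_exists S; rewrite d2 => -[A [AS _ Ag]].
pose N := comm (A ord0) (A ord_max).
have hN X Y : X \in S -> Y \in S -> exists c, comm X Y = c *: N.
  move=> /Ag-> /Ag->; rewrite !sum2.
  move: (hs (A ord0) _) (hs (A ord_max) _) (hs (A ord0) _) (hs (A ord_max) _) => a b c d.
  exists (c * b - d * a); rewrite commDl !commDr !commZl !commZr !commxx !scaler0.
  by rewrite addr0 add0r (commC (A ord_max)) !scalerN !scalerA scalerBl.
have N0 : N = 0.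
  apply: (invariant_line_eq0 iG); first exact: comm_tr.
    move=> u hu; have -> : mxconj u N = comm (mxconj u (A ord0)) (mxconj u (A ord_max)).
      by apply: mxconj_comm; apply: Gu.
    by apply: hN; apply: GS; rewrite ?AS.
  by rewrite comm_adj; apply: hN; apply: sS; rewrite AS.
move=> X Y XS YS; apply/comm_eq0; have [c ->] := hN X Y XS YS.
by rewrite N0 scaler0.
Qed.

End Irreducible3.

(** * Entrywise description of the listed spaces *)

Section Concrete.
Variables (C : numClosedFieldType) (omega : C).
Hypothesis omega_root : 1 + omega + omega ^+ 2 = 0.
Local Notation M := 'M[C]_3.
Implicit Types (X Y Z u : M) (S T W : {vspace M}) (z w : C).

Definition unimod z := z * z^* = 1.

Lemma unimodC z : unimod z -> z^* * z = 1.
Proof. by rewrite mulrC. Qed.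
Lemma unimodM z w : unimod z -> unimod w -> unimod (z * w).
Proof. by move=> hz hw; rewrite /unimod rmorphM mulrACA hz hw mulr1. Qed.
Lemma unimod_conj z : unimod z -> unimod z^*.
Proof. by rewrite /unimod conjCK mulrC. Qed.
Lemma unimod1 : unimod 1. Proof. by rewrite /unimod conjC1 mulr1. Qed.
Lemma unimodi : unimod 'i.
Proof. by rewrite /unimod conjCi mulrN -expr2 sqrCi opprK. Qed.
Lemma unimodN z : unimod z -> unimod (- z).
Proof. by rewrite /unimod rmorphN mulrNN. Qed.
Lemma unimod_neq0 z : unimod z -> z != 0.
Proof. by move=> h; apply: contraPneq h => ->; rewrite /unimod mul0r => /esym/eqP; rewrite oner_eq0. Qed.

(** For z = e^{-i theta} this is the generator r_ij(theta); [offv] thus covers VT_3 and both halves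
    of VT_6. *)
Definition offm (i j : 'I_3) z : M := z *: delta_mx i j + z^* *: delta_mx j i.
Definition offv z1 z2 z3 : {vspace M} :=
  (<[offm i2 i3 z1]> + <[offm i3 i1 z2]> + <[offm i1 i2 z3]>)%VS.

Definition dg (a b c : C) : M := diag_mx (\row_k [:: a; b; c]`_k).
Definition uh : M := delta_mx i2 i1 + delta_mx i3 i2 + delta_mx i1 i3.
Definition vh : M := dg 1 omega (omega ^+ 2).
Definition vt2 : {vspace M} := (<[dg (-1) (-1) 2]> + <[dg (-1) 1 0]>)%VS.
Definition vt4 : {vspace M} := (<[uh]> + <[uh ^+ 2]> + <[vh]> + <[vh ^+ 2]>)%VS.
Definition vt6 : {vspace M} := (offv 1 1 1 + offv (- 'i) (- 'i) (- 'i))%VS.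
Definition vt8 : {vspace M} := (vt2 + vt6)%VS.

Lemma add_lineP (U : {vspace M}) X Y :
  reflect (exists2 Z, Z \in U & exists k, Y = Z + k *: X) (Y \in U + <[X]>)%VS.
Proof.
apply: (iffP memv_addP) => [[Z ZU [_ /vlineP[k ->] ->]]|[Z ZU [k ->]]].
  by exists Z => //; exists k.
by exists Z => //; exists (k *: X); rewrite ?memvZ ?memv_line.
Qed.

Definition diag0 X := [/\ X i1 i1 = 0, X i2 i2 = 0 & X i3 i3 = 0].
(** A multiple a of [offm i j z] has the entries a z and a z^*; eliminating a leaves one linear
    equation for each pair of positions. *)
Definition offrel z1 z2 z3 X :=
  [/\ X i3 i2 * z1 = X i2 i3 * z1^*, X i1 i3 * z2 = X i3 i1 * z2^*
    & X i2 i1 * z3 = X i1 i2 * z3^*].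
Definition offdiag0 X :=
  [/\ X i1 i2 = 0, X i2 i3 = 0 & X i3 i1 = 0] /\
  [/\ X i2 i1 = 0, X i3 i2 = 0 & X i1 i3 = 0].

Lemma trE X : \tr X = X i1 i1 + X i2 i2 + X i3 i3.
Proof. by rewrite /mxtrace sum3. Qed.

Lemma offvP z1 z2 z3 X : unimod z1 -> unimod z2 -> unimod z3 ->
  X \in offv z1 z2 z3 <-> diag0 X /\ offrel z1 z2 z3 X.
Proof.
move=> h1 h2 h3; split.
  case/add_lineP => _ /add_lineP[_ /vlineP[a ->] [b ->]] [c ->].
  rewrite /diag0 /offrel !mxE /= ?(mulr0, mulr1, addr0, add0r).
  by split; split; ring.
case=> -[d1 d2 d3] [e1 e2 e3].
have s z a b : unimod z -> a * z = b * z^* -> a = b * z^* * z^*.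
  by move=> hz <-; rewrite -mulrA hz mulr1.
apply/add_lineP; exists ((X i2 i3 * z1^*) *: offm i2 i3 z1 + (X i3 i1 * z2^*) *: offm i3 i1 z2).
  by rewrite memv_add ?memvZ ?memv_line.
exists (X i1 i2 * z3^*).
apply: mx3P; rewrite !mxE /= ?(mulr0, mulr1, addr0, add0r) //.
- by rewrite -mulrA unimodC // mulr1.
- exact: s.
- exact: s.
- by rewrite -mulrA unimodC // mulr1.
- by rewrite -mulrA unimodC // mulr1.
- exact: s.
Qed.

Lemma VT2P X : X \in vt2 <-> \tr X = 0 /\ offdiag0 X.
Proof.
rewrite trE; split.
  case/add_lineP => _ /vlineP[a ->] [b ->].
  by rewrite /offdiag0 !mxE /= ?(mulr0, mulr0n, mulr1n, mulr1, addr0, add0r); split; [ring|].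
case=> t [[e1 e2 e3] [e4 e5 e6]].
have {}t : X i1 i1 = - X i2 i2 - X i3 i3.
  by move/eqP: t; rewrite -addrA addr_eq0 opprD => /eqP.
apply/add_lineP; exists ((X i3 i3 / 2) *: dg (-1) (-1) 2).
  by rewrite memvZ ?memv_line.
exists (X i2 i2 + X i3 i3 / 2).
apply: mx3P; rewrite !mxE /= ?(mulr0, mulr0n, mulr1n, mulr1, addr0, add0r) //.
- by rewrite t; field.
- by field.
- by field.
Qed.

Lemma VT2_offvP z1 z2 z3 X : unimod z1 -> unimod z2 -> unimod z3 ->
  X \in (vt2 + offv z1 z2 z3)%VS <-> \tr X = 0 /\ offrel z1 z2 z3 X.
Proof.
move=> h1 h2 h3; split.
  case/memv_addP => Y /VT2P[tY [[e1 e2 e3] [e4 e5 e6]]] [Z] /offvP[] //.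
  move=> [d1 d2 d3] [f1 f2 f3] ->; split.
    by rewrite trE !mxE d1 d2 d3 !addr0 -trE.
  by split; rewrite !mxE ?(e1, e2, e3, e4, e5, e6) !add0r.
case=> t [f1 f2 f3].
pose D := dg (X i1 i1) (X i2 i2) (X i3 i3).
rewrite -(subrK D X) addrC; apply: memv_add.
  apply/VT2P; rewrite trE /offdiag0 !mxE /= ?(mulr0n, mulr1n); split=> //.
  by rewrite -trE.
apply/offvP => //; rewrite /diag0 /offrel !mxE /= ?(mulr0n, mulr1n) !subr0 !subrr.
by split.
Qed.

Lemma VT6P X : X \in vt6 <-> diag0 X.
Proof.
have ci : (- 'i)^* = 'i :> C by rewrite rmorphN /= conjCi opprK.
have u1 := unimod1; have ui := unimodN unimodi.
split.
  case/memv_addP => Y /offvP[] // [d1 d2 d3] _ [Z] /offvP[] // [e1 e2 e3] _ ->.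
  by rewrite /diag0 !mxE d1 d2 d3 e1 e2 e3 addr0.
case=> [d1 d2 d3].
(* The symmetric part of X is a combination of the real generators, the antisymmetric part one of
   the generators with phase -i. *)
pose Y := 2^-1 *: (X + X^T).
rewrite -(subrK Y X) addrC; apply: memv_add; apply/offvP => //.
  rewrite /diag0 /offrel !mxE d1 d2 d3 addr0 mulr0 conjC1; split; split=> //; ring.
rewrite /diag0 /offrel !mxE d1 d2 d3 addr0 mulr0 subr0 ci.
by split; split=> //; field.
Qed.

Lemma VT8P X : X \in vt8 <-> \tr X = 0.
Proof.
split.
  case/memv_addP => Y /VT2P[tY _] [Z] /VT6P[e1 e2 e3] ->.
  by rewrite mxtraceD tY trE e1 e2 e3 !addr0.
move=> t; pose D := dg (X i1 i1) (X i2 i2) (X i3 i3).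
rewrite -(subrK D X) addrC; apply: memv_add.
  apply/VT2P; rewrite trE /offdiag0 !mxE /= ?(mulr0n, mulr1n); split=> //.
  by rewrite -trE.
by apply/VT6P; rewrite /diag0 !mxE /= ?mulr1n !subrr.
Qed.

Lemma omega2 : omega ^+ 2 = - 1 - omega.
Proof. by apply/eqP; rewrite -subr_eq0 -omega_root; apply/eqP; ring. Qed.
Lemma omega3 : omega ^+ 3 = 1.
Proof. by rewrite exprS omega2 mulrBr mulrN1 -expr2 omega2; ring. Qed.
Lemma uhatE i j : uh i j = ((i, j) \in [:: (i2, i1); (i3, i2); (i1, i3)])%:R.
Proof. by rewrite !mxE; move: i j; do 2!apply: forall3; rewrite /= ?addr0 ?add0r. Qed.
Lemma uhat2E i j : (uh ^+ 2) i j = ((i, j) \in [:: (i1, i2); (i2, i3); (i3, i1)])%:R.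
Proof.
rewrite expr2 mxE sum3 !uhatE; move: i j.
by do 2!apply: forall3; rewrite /= ?(mulr0, mulr1, addr0, add0r).
Qed.
Lemma vhat2E : vh ^+ 2 = dg 1 (omega ^+ 2) (omega).
Proof.
rewrite expr2; apply: mx3P; rewrite !mxE !sum3 !mxE /= ?(mulr0n, mulr1n, mulr0, mul0r, mulr1, addr0, add0r) //.
by rewrite -expr2 -exprM (exprD _ 3 1) omega3 mul1r.
Qed.

(** The powers of u are the two cyclic patterns off the diagonal, while v and v^2 span the traceless
    diagonal matrices. *)
Lemma VT4P X : X \in vt4 <-> \tr X = 0 /\
  [/\ X i2 i1 = X i1 i3, X i3 i2 = X i1 i3, X i1 i2 = X i3 i1 & X i2 i3 = X i3 i1].
Proof.
have w2 := omega2; rewrite trE; split.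
  case/add_lineP => _ /add_lineP[_ /add_lineP[_ /vlineP[a ->] [b ->]] [c ->]] [d ->].
  rewrite vhat2E !(mxE, uhatE, uhat2E) /= ?(mulr0n, mulr1n, mulr0, mulr1, addr0, add0r).
  by split=> //; ring: w2.
case=> t [e1 e2 e3 e4].
have {}t : X i1 i1 = - X i2 i2 - X i3 i3.
  by move/eqP: t; rewrite -addrA addr_eq0 opprD => /eqP.
(* The coefficients of v and v^2 are the discrete Fourier coefficients of the diagonal of X. *)
apply/add_lineP; exists (X i1 i3 *: uh + X i3 i1 *: uh ^+ 2 +
   ((X i1 i1 + omega ^+ 2 * X i2 i2 + omega * X i3 i3) / 3) *: vh).
  by rewrite !memv_add ?memvZ ?memv_line.
exists ((X i1 i1 + omega * X i2 i2 + omega ^+ 2 * X i3 i3) / 3).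
apply: mx3P; rewrite vhat2E !(mxE, uhatE, uhat2E) /= ?(mulr0n, mulr1n, mulr0, mulr1, addr0, add0r) //.
- by rewrite t; field: w2.
- by rewrite t; field: w2.
- by rewrite t; field: w2.
Qed.

End Concrete.

(** * Dimensions, complements and symmetries of the listed spaces *)

Section Gauge.
Variables (C : numClosedFieldType) (omega : C).
Hypothesis omega_root : 1 + omega + omega ^+ 2 = 0.
Local Notation M := 'M[C]_3.
Implicit Types (X Y Z u : M) (S T W : {vspace M}) (z w : C).
Local Notation vt2 := (vt2 C).
Local Notation vt6 := (vt6 C).
Local Notation vt8 := (vt8 C).
Local Notation vt4 := (vt4 omega).

Definition simpe := (mulr0n, mulr1n, mulr0, mul0r, mulr1, mul1r, addr0, add0r, conjC0, conjC1, subr0, sub0r).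

Lemma dim_add_line S X : X \notin S -> \dim (S + <[X]>) = (\dim S).+1.
Proof.
move=> XS; have X0 : X != 0 by apply: contraNneq XS => ->; rewrite mem0v.
rewrite dimv_disjoint_sum ?dim_vline ?X0 ?addn1 //; apply/eqP; rewrite -subv0.
apply/subvP => Y /memv_capP[YS /vlineP[k e]]; rewrite {}e in YS *.
have [->|k0] := eqVneq k 0; first by rewrite scale0r mem0v.
by case/negP: XS; rewrite -[X](scalerK k0) memvZ.
Qed.

Lemma dim_vt2 : \dim vt2 = 2%N.
Proof.
rewrite dim_add_line ?dim_vline.
  case: eqP => // /matrixP/(_ i1 i1); rewrite !mxE /= mulr1n => /eqP.
  by rewrite oppr_eq0 oner_eq0.
apply/negP => /vlineP[k /matrixP e].
have := e i3 i3; have := e i2 i2; rewrite !mxE /= !mulr1n => e2 /esym/eqP.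
rewrite mulf_eq0 pnatr_eq0 orbF => /eqP k0; move: e2.
by rewrite k0 mul0r => /eqP; rewrite oner_eq0.
Qed.

Lemma dim_vt8 : \dim vt8 = 8%N.
Proof.
have -> : vt8 = orthv fullv <[1%:M]>.
  apply/vspaceP => X; apply/idP/idP.
    move/VT8P => t; apply/orthvP; split; first exact: memvf.
    by move=> _ /vlineP[k ->]; rewrite hsZl /hs adj_scalar conjC1 mul1mx t mulr0.
  move=> /orthvP[_ /(_ _ (memv_line _))]; rewrite /hs adj_scalar conjC1 mul1mx => t.
  exact/VT8P.
rewrite dim_orthv ?subvf // dimvf /dim /= dim_vline.
case: eqP => // /matrixP/(_ i1 i1); rewrite !mxE /= => /eqP.
by rewrite oner_eq0.
Qed.

Lemma hs3 X Y : hs X Y = 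
  (X i1 i1)^* * Y i1 i1 + (X i1 i2)^* * Y i1 i2 + (X i1 i3)^* * Y i1 i3 +
  ((X i2 i1)^* * Y i2 i1 + (X i2 i2)^* * Y i2 i2 + (X i2 i3)^* * Y i2 i3) +
  ((X i3 i1)^* * Y i3 i1 + (X i3 i2)^* * Y i3 i2 + (X i3 i3)^* * Y i3 i3).
Proof. by rewrite hsE !sum3. Qed.

Lemma orthv_vt8_vt2 : orthv vt8 vt2 = vt6.
Proof.
apply/vspaceP => X; apply/idP/idP.
  move=> /orthvP[/VT8P + h]; rewrite trE => t; apply/VT6P.
  have := h (dg 1 (-1) 0); have := h (dg 0 1 (-1)); rewrite !hs3 !mxE /= !simpe.
  have c1 : (-1)^* = -1 :> C by rewrite rmorphN /= conjC1.
  rewrite !c1 !mulN1r.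
  have m a b c : a + b + c = 0 -> dg a b c \in vt2.
    by move=> e; apply/VT2P; rewrite trE /offdiag0 !mxE /= !simpe.
  move=> /(_ (m _ _ _ _)) e1 /(_ (m _ _ _ _)) e2.
  have {e1}/eqP : X i2 i2 - X i3 i3 = 0 by apply: e1; ring.
  rewrite subr_eq0 => /eqP e23.
  have {e2}/eqP : X i1 i1 - X i2 i2 = 0 by apply: e2; ring.
  rewrite subr_eq0 => /eqP e12.
  move: t; rewrite e12 -e23 -mulr2n -mulrSr => /eqP; rewrite mulrn_eq0 /= => /eqP z.
  by split; rewrite ?e12 -?e23.
move=> /VT6P[d1 d2 d3]; apply/orthvP; split.
  by apply/VT8P; rewrite trE d1 d2 d3 !addr0.
move=> Y /VT2P[_ [[e1 e2 e3] [e4 e5 e6]]].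
by rewrite hs3 ?(d1, d2, d3, e1, e2, e3, e4, e5, e6) !simpe.
Qed.

Lemma vt2_sub : (vt2 <= vt8)%VS. Proof. exact: addvSl. Qed.
Lemma vt6_sub : (vt6 <= vt8)%VS. Proof. exact: addvSr. Qed.

Lemma dim_vt6 : \dim vt6 = 6%N.
Proof. by rewrite -orthv_vt8_vt2 dim_orthv ?vt2_sub // dim_vt8 dim_vt2. Qed.

Lemma offv_sub z1 z2 z3 : unimod z1 -> unimod z2 -> unimod z3 ->
  (offv z1 z2 z3 <= vt8)%VS.
Proof.
move=> h1 h2 h3; apply/subvP => X /offvP[] // [d1 d2 d3] _.
by apply/VT8P; rewrite trE d1 d2 d3 !addr0.
Qed.

Lemma mem_offm z1 z2 z3 :
  [/\ offm i2 i3 z1 \in offv z1 z2 z3, offm i3 i1 z2 \in offv z1 z2 z3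
    & offm i1 i2 z3 \in offv z1 z2 z3].
Proof.
split.
- by rewrite -[offm _ _ _]addr0 -[offm _ _ _]addr0 !memv_add ?mem0v ?memv_line.
- by rewrite -[offm _ _ _]addr0 -[offm _ _ _]add0r !memv_add ?mem0v ?memv_line.
- by rewrite -[offm _ _ _]add0r !memv_add ?mem0v ?memv_line.
Qed.

(** On each pair of mirrored entries the complement of the line with phase z is the line with phase
    ['i * z], and the diagonal contributes its traceless part. This is how complements exchange
    dimensions 3 and 5. *)
Lemma orthv_vt8_offv z1 z2 z3 : unimod z1 -> unimod z2 -> unimod z3 ->
  orthv vt8 (offv z1 z2 z3) = (vt2 + offv ('i * z1) ('i * z2) ('i * z3))%VS.
Proof.
move=> h1 h2 h3; have ui := unimodi C.
have iz z a b : (a * ('i * z) == b * ('i * z)^*) = (z^* * b + z * a == 0).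
  rewrite rmorphM /= conjCi -subr_eq0.
  rewrite (_ : _ - _ = 'i * (z^* * b + z * a)); last by ring.
  by rewrite mulf_eq0 (negbTE (neq0Ci _)).
apply/vspaceP => X; apply/idP/idP.
  move=> /orthvP[/VT8P t h]; apply/VT2_offvP; try exact: unimodM.
  have [m1 m2 m3] := mem_offm z1 z2 z3.
  split=> //; split; apply/eqP; rewrite iz.
  - by move: (h _ m1); rewrite hs3 !mxE /= !simpe conjCK => /eqP.
  - by move: (h _ m2); rewrite hs3 !mxE /= !simpe conjCK addrC => /eqP.
  - by move: (h _ m3); rewrite hs3 !mxE /= !simpe conjCK => /eqP.
move=> /VT2_offvP[]; try exact: unimodM.
move=> t [/eqP + /eqP + /eqP]; rewrite !iz => /eqP f1 /eqP f2 /eqP f3.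
apply/orthvP; split; first exact/VT8P.
move=> _ /add_lineP[_ /add_lineP[_ /vlineP[a ->] [b ->]] [c ->]].
rewrite hs3 !mxE /= !simpe !rmorphM /= !conjCK.
rewrite (_ : _ + _ = a^* * (z1^* * X i2 i3 + z1 * X i3 i2) + b^* * (z2^* * X i3 i1 + z2 * X i1 i3)
  + c^* * (z3^* * X i1 i2 + z3 * X i2 i1)); last by ring.
by rewrite f1 f2 f3 !mulr0 !addr0.
Qed.

Lemma offvN z1 z2 z3 e1 e2 e3 : unimod z1 -> unimod z2 -> unimod z3 ->
  e1 ^+ 2 = 1 -> e2 ^+ 2 = 1 -> e3 ^+ 2 = 1 ->
  offv (e1 * z1) (e2 * z2) (e3 * z3) = offv z1 z2 z3.
Proof.
move=> h1 h2 h3.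
have l i j e z : e ^+ 2 = 1 -> <[offm i j (e * z)]>%VS = <[offm i j z]>%VS.
  move=> /eqP; rewrite sqrf_eq1 => /orP[] /eqP ->; first by rewrite mul1r.
  rewrite (_ : offm i j _ = -1 *: offm i j z) ?scaleN1r.
    by apply/vspaceP => X; rewrite !(memvN, memvE) -!memvE; apply/vlineP/vlineP => -[k ->];
      exists (-k); rewrite ?scalerN ?scaleNr ?opprK.
  by rewrite /offm !mulN1r rmorphN /= !scaleNr opprD.
by move=> ? ? ?; rewrite /offv !l.
Qed.

Definition offb z1 z2 z3 (i : 'I_3) : M :=
  (sqrtC 2)^-1 *: nth 0 [:: offm i2 i3 z1; offm i3 i1 z2; offm i1 i2 z3] i.

Lemma offb_hermbasis z1 z2 z3 : unimod z1 -> unimod z2 -> unimod z3 ->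
  hermbasis (offv z1 z2 z3) (offb z1 z2 z3).
Proof.
move=> h1 h2 h3; pose k : C := (sqrtC 2)^-1.
have kr : k^* = k by apply/CrealP; rewrite realV ger0_real // sqrtC_ge0.
have kk : k * k = 2^-1 by rewrite -invfM -expr2 sqrtCK.
have adjoff i j z : (offm i j z)^t* = offm i j z.
  by rewrite /offm adjD !adjZ !trmx_delta !map_delta_mx conjCK addrC.
have [m1 m2 m3] := mem_offm z1 z2 z3.
split; last by apply: forall3; rewrite /offb adjZ -/k kr /= adjoff.
split.
- by apply: forall3; rewrite memvZ.
- do 2!apply: forall3; rewrite /offb -/k hsZl hsZr kr mulrA kk hs3 !mxE /= !simpe ?conjCK //.
  + by rewrite unimodC // h1; field.
  + by rewrite unimodC // h2; field.
  + by rewrite unimodC // h3; field.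
move=> X /offvP[] // [d1 d2 d3] [e1 e2 e3]; rewrite sum3 /offb -/k !hsZl !scalerA kr.
rewrite !(mulrC _ k) !mulrA kk.
have s z a b : unimod z -> a * z = b * z^* -> 2^-1 * (z^* * b + z * a) = b * z^*.
  by move=> _; rewrite (mulrC z) => ->; field.
rewrite !hs3 !mxE /= !simpe ?conjCK.
have s' z a b : unimod z -> a * z = b * z^* -> a = b * z^* * z^*.
  by move=> hz <-; rewrite -mulrA hz mulr1.
rewrite (addrC (z2 * _)).
rewrite !s //.
apply: mx3P; rewrite !mxE /= !simpe //.
- by rewrite -mulrA unimodC // mulr1.
- exact: s'.
- exact: s'.
- by rewrite -mulrA unimodC // mulr1.
- by rewrite -mulrA unimodC // mulr1.
- exact: s'.
Qed.

Lemma dim_offv z1 z2 z3 : unimod z1 -> unimod z2 -> unimod z3 -> \dim (offv z1 z2 z3) = 3%N.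
Proof. by move=> h1 h2 h3; have [/onb_dim] := offb_hermbasis h1 h2 h3. Qed.

(** Two complements multiply each phase by -1, which leaves the lines unchanged by [offvN]. *)
Lemma orthv_vt8_vt2_offv z1 z2 z3 : unimod z1 -> unimod z2 -> unimod z3 ->
  orthv vt8 (vt2 + offv z1 z2 z3) = offv ('i * z1) ('i * z2) ('i * z3).
Proof.
move=> h1 h2 h3; have ui := unimodi C.
have m x y z : unimod x -> unimod y -> unimod z ->
    offv ('i * ('i * x)) ('i * ('i * y)) ('i * ('i * z)) = offv x y z.
  by move=> *; rewrite !mulrA -expr2 sqrCi offvN // sqrrN expr1n.
rewrite -[in LHS](m z1 z2 z3) // -orthv_vt8_offv; try exact: unimodM.
by rewrite orthvK // offv_sub //; exact: unimodM.
Qed.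

Lemma vt2_offv_sub z1 z2 z3 : unimod z1 -> unimod z2 -> unimod z3 ->
  (vt2 + offv z1 z2 z3 <= vt8)%VS.
Proof. by move=> h1 h2 h3; rewrite subv_add vt2_sub offv_sub. Qed.

Lemma dim_vt2_offv z1 z2 z3 : unimod z1 -> unimod z2 -> unimod z3 ->
  \dim (vt2 + offv z1 z2 z3) = 5%N.
Proof.
move=> h1 h2 h3; have ui := unimodi C.
have := dim_orthv (vt2_offv_sub h1 h2 h3).
have := subKn (dimvS (vt2_offv_sub h1 h2 h3)).
rewrite orthv_vt8_vt2_offv // dim_offv ?dim_vt8; try exact: unimodM.
by move=> e1 e2; rewrite -e1 -e2.
Qed.

Lemma vt4E : vt4 = (vt2 + <[uh C]> + <[uh C ^+ 2]>)%VS.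
Proof.
apply/vspaceP => X; apply/idP/idP.
  move/(VT4P omega_root) => [t [e1 e2 e3 e4]].
  apply/add_lineP; exists (dg (X i1 i1) (X i2 i2) (X i3 i3) + X i1 i3 *: uh C).
    rewrite memv_add ?memvZ ?memv_line //.
    by apply/VT2P; rewrite trE /offdiag0 !mxE /= !simpe -trE t.
  exists (X i3 i1); apply: mx3P; rewrite !(mxE, uhatE, uhat2E) /= !simpe //.
case/add_lineP => _ /add_lineP[Y /VT2P[t [[e1 e2 e3] [e4 e5 e6]]] [b ->]] [c ->].
apply/(VT4P omega_root); rewrite trE !(mxE, uhatE, uhat2E) /= !simpe -trE t.
by rewrite e1 e2 e3 e4 e5 e6 !simpe.
Qed.

Lemma dim_vt4 : \dim vt4 = 4%N.
Proof.
rewrite vt4E.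
rewrite dim_add_line; [rewrite dim_add_line ?dim_vt2 // |].
  by apply/negP => /VT2P[_ [_ []]]; rewrite !uhatE /= => /eqP; rewrite oner_eq0.
apply/negP => /add_lineP[Y /VT2P[_ [[e1 e2 e3] _]] [k /matrixP/(_ i1 i2)]].
rewrite uhat2E !(mxE, uhatE) e1 /= !simpe => /eqP; by rewrite oner_eq0.
Qed.

Lemma sdj_offv z1 z2 z3 : unimod z1 -> unimod z2 -> unimod z3 -> sdj (offv z1 z2 z3).
Proof.
move=> h1 h2 h3 X /offvP[] // [d1 d2 d3] [e1 e2 e3]; apply/offvP => //.
rewrite /diag0 /offrel !adjE d1 d2 d3 !conjC0; split=> //.
by split; apply: (can_inj (@conjCK C)); rewrite !rmorphM /= !conjCK.
Qed.

Lemma sdj_vt2 : sdj vt2.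
Proof.
move=> X /VT2P[t [[e1 e2 e3] [e4 e5 e6]]]; apply/VT2P.
by rewrite tr_adj t /offdiag0 !adjE e1 e2 e3 e4 e5 e6 !conjC0.
Qed.

Lemma sdj_vt8 : sdj vt8.
Proof. by move=> X /VT8P t; apply/VT8P; rewrite tr_adj t conjC0. Qed.

Lemma sdj_vt6 : sdj vt6.
Proof. rewrite -orthv_vt8_vt2; apply: sdj_orthv; [exact: sdj_vt8|exact: sdj_vt2]. Qed.

Lemma sdj_addv S T : sdj S -> sdj T -> sdj (S + T).
Proof.
move=> sS sT X /memv_addP[Y YS [Z ZT ->]]; rewrite adjD memv_add //.
  exact: sS.
exact: sT.
Qed.

Lemma sdj_vt4 : sdj vt4.
Proof.
move=> X /(VT4P omega_root) [t [e1 e2 e3 e4]]; apply/(VT4P omega_root).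
by rewrite tr_adj t conjC0 !adjE e1 e2 e3 e4.
Qed.

Lemma trless_sub S : (S <= vt8)%VS <-> trless S.
Proof.
split=> [/subvP h X /h /VT8P //|h].
by apply/subvP => X /h /VT8P.
Qed.

Lemma conjv_addv u S T : conjv u (S + T) = (conjv u S + conjv u T)%VS.
Proof. exact: limgD. Qed.

Lemma conjv_vt8 u : u \is unitarymx -> conjv u vt8 = vt8.
Proof.
by move=> hu; apply: conjv_eq => // X /VT8P t; apply/VT8P; rewrite mxconj_tr.
Qed.

Lemma qg_iso_compl S T : qg_iso S T -> qg_iso (orthv vt8 S) (orthv vt8 T).
Proof. by case=> u hu <-; exists u => //; rewrite conjv_orthv // conjv_vt8. Qed.

Lemma dg_unitary (a b c : C) : unimod a -> unimod b -> unimod c -> dg a b c \is unitarymx.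
Proof.
move=> ha hb hc; apply/unitarymxP.
by apply: mx3P; rewrite !mxE sum3 !mxE /= !simpe.
Qed.

Lemma mxconj_dgE (a b c : C) X i j : mxconj (dg a b c) X i j =
  nth 0 [:: a; b; c] i * X i j * (nth 0 [:: a; b; c] j)^*.
Proof.
rewrite !mxE !sum3 !mxE !sum3 !mxE; move: i j.
by do 2!apply: forall3; rewrite /= !simpe.
Qed.

Definition swap : M := delta_mx i1 i2 + delta_mx i2 i1 + delta_mx i3 i3.

Lemma swap_unitary : swap \is unitarymx.
Proof.
by apply/unitarymxP; apply: mx3P; rewrite !mxE sum3 !mxE /= !simpe.
Qed.

Lemma mxconj_swapE X i j : mxconj swap X i j = X (nth i1 [:: i2; i1; i3] i) (nth i1 [:: i2; i1; i3] j).
Proof.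
rewrite !mxE !sum3 !mxE !sum3 !mxE; move: i j.
by do 2!apply: forall3; rewrite /= !simpe.
Qed.

Lemma uh_unitary : uh C \is unitarymx.
Proof.
by apply/unitarymxP; apply: mx3P; rewrite !mxE sum3 !mxE /= !simpe.
Qed.

Lemma mxconj_uhE X i j : mxconj (uh C) X i j = X (nth i1 [:: i3; i1; i2] i) (nth i1 [:: i3; i1; i2] j).
Proof.
rewrite !mxE !sum3 !mxE !sum3 !mxE; move: i j.
by do 2!apply: forall3; rewrite /= !simpe.
Qed.

Lemma conjv_dg_vt2 (a b c : C) : unimod a -> unimod b -> unimod c -> conjv (dg a b c) vt2 = vt2.
Proof.
move=> ha hb hc; apply: conjv_eq => [||X]; [exact: dg_unitary|by []|].
move=> /VT2P[t [[e1 e2 e3] [e4 e5 e6]]]; apply/VT2P.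
by rewrite mxconj_tr ?dg_unitary // /offdiag0 !mxconj_dgE e1 e2 e3 e4 e5 e6 !simpe.
Qed.

(** The factors applied to the phases have product 1, so diagonal unitaries preserve z1 z2 z3;
    everything else about the phases can be normalized away. *)
Lemma conjv_dg_offv a b c z1 z2 z3 : unimod a -> unimod b -> unimod c ->
  unimod z1 -> unimod z2 -> unimod z3 ->
  conjv (dg a b c) (offv z1 z2 z3) = offv (b * z1 * c^*) (c * z2 * a^*) (a * z3 * b^*).
Proof.
move=> ha hb hc h1 h2 h3.
have u x y z : unimod x -> unimod y -> unimod z -> unimod (x * y * z^*).
  by move=> *; apply: unimodM; [apply: unimodM|apply: unimod_conj].
apply: conjv_eq => [||X]; first exact: dg_unitary.
  by rewrite !dim_offv //; apply: u.
move=> /offvP[] // [d1 d2 d3] [e1 e2 e3]; apply/offvP; try exact: u.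
rewrite /diag0 /offrel !mxconj_dgE d1 d2 d3 /= !simpe; split=> //.
have s x y z p q : unimod x -> unimod y -> q * z = p * z^* ->
  y * q * x^* * (x * z * y^*) = x * p * y^* * (x * z * y^*)^*.
  move=> hx hy e; rewrite !rmorphM /= conjCK.
  transitivity ((y * y^*) * (x * x^*) * (q * z)); first by ring.
  by rewrite e; ring.
by split; apply: s.
Qed.

Lemma conjv_swap_vt2 : conjv swap vt2 = vt2.
Proof.
apply: conjv_eq => [||X]; [exact: swap_unitary|by []|].
move=> /VT2P[t [[e1 e2 e3] [e4 e5 e6]]]; apply/VT2P.
by rewrite mxconj_tr ?swap_unitary // /offdiag0 !mxconj_swapE /= e1 e2 e3 e4 e5 e6.
Qed.

(** Exchanging two basis vectors reverses the cyclic order 1, 2, 3, so the product of the phases is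
    conjugated. *)
Lemma conjv_swap_offv w : unimod w -> conjv swap (offv 1 1 w) = offv 1 1 w^*.
Proof.
move=> hw; have u1 := unimod1 C; have hw' := unimod_conj hw.
apply: conjv_eq => [||X]; first exact: swap_unitary.
  by rewrite !dim_offv.
move=> /offvP[] // [d1 d2 d3] [e1 e2 e3]; apply/offvP => //.
rewrite /diag0 /offrel !mxconj_swapE d1 d2 d3 /= conjCK; split=> //.
by move: e1 e2; rewrite conjC1 => e1 e2; split.
Qed.

Lemma conjv_uh_offv z1 z2 z3 : unimod z1 -> unimod z2 -> unimod z3 ->
  conjv (uh C) (offv z1 z2 z3) = offv z3 z1 z2.
Proof.
move=> h1 h2 h3.
apply: conjv_eq => [||X]; first exact: uh_unitary.
  by rewrite !dim_offv.
move=> /offvP[] // [d1 d2 d3] [e1 e2 e3]; apply/offvP => //.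
by rewrite /diag0 /offrel !mxconj_uhE d1 d2 d3 /=.
Qed.

Lemma conjv_uh_vt2 : conjv (uh C) vt2 = vt2.
Proof.
apply: conjv_eq => [||X]; [exact: uh_unitary|by []|].
move=> /VT2P[t [[e1 e2 e3] [e4 e5 e6]]]; apply/VT2P.
by rewrite mxconj_tr ?uh_unitary // /offdiag0 !mxconj_uhE /= e1 e2 e3 e4 e5 e6.
Qed.

End Gauge.

(** * Abelian planes *)

Section Planes.
Variable C : numClosedFieldType.
Local Notation M := 'M[C]_3.
Implicit Types (X Y Z u : M) (S T W : {vspace M}) (z w : C) (G : M -> Prop).
Local Notation vt2 := (vt2 C).

Lemma abelian_cotrigonalization W : abelian W ->
  exists2 P, P \is unitarymx & forall X, X \in W -> 
  [/\ mxconj P X i1 i2 = 0, mxconj P X i1 i3 = 0 & mxconj P X i2 i3 = 0].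
Proof.
move=> aW; have [|P hP /allP tP] := @cotrigonalization C 3 (vbasis W).
  by move=> X Y XW YW; apply: aW; apply: vbasis_mem.
exists P => // X XW.
have trig (i j : 'I_3) : (i < j)%N -> mxconj P X i j = 0.
  move=> ij; rewrite (coord_vbasis XW) linear_sum summxE big1 // => k _.
  rewrite linearZ mxE; have /tP : (vbasis W)`_k \in vbasis W.
    by apply: mem_nth; rewrite size_tuple.
  by rewrite /= /similar_to conjymx // => /is_trig_mxP /(_ i j ij); rewrite /mxconj => ->; rewrite mulr0.
by split; apply: trig.
Qed.

(** Commuting matrices are triangularized together by a unitary, and a triangular family closed
    under adjoints is diagonal. *)
Lemma abelian_sub_vt2 S : sdj S -> trless S -> abelian S ->
  exists2 P, P \is unitarymx & (conjv P S <= vt2)%VS.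
Proof.
move=> sS tS /abelian_cotrigonalization[P hP h]; exists P => //.
apply/subvP => X; rewrite conjvP // => XS.
have [e1 e2 e3] := h _ XS; have [f1 f2 f3] := h _ (sS _ XS).
move: e1 e2 e3 f1 f2 f3; rewrite -mxconj_adj !adjE mxconjVK // => e1 e2 e3.
move=> /(canRL (@conjCK C)) f1 /(canRL (@conjCK C)) f2 /(canRL (@conjCK C)) f3.
apply/VT2P; rewrite /offdiag0 e1 e2 e3 f1 f2 f3 !conjC0; split=> //.
by have := tS _ XS; rewrite mxconj_tr // unitary_adj.
Qed.

Lemma abelian_dim S : sdj S -> trless S -> abelian S -> (\dim S <= 2)%N.
Proof.
move=> sS tS aS; have [P hP /dimvS] := abelian_sub_vt2 sS tS aS.
by rewrite dim_conjv // dim_vt2.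
Qed.

Lemma abelian_iso_vt2 S : sdj S -> trless S -> abelian S -> \dim S = 2%N -> qg_iso S vt2.
Proof.
move=> sS tS aS d2; have [P hP sP] := abelian_sub_vt2 sS tS aS.
by exists P => //; apply/eqP; rewrite eqEdim sP dim_conjv // d2 dim_vt2.
Qed.

Lemma addr_norm_eq0 (a b : C) : a * a^* + b * b^* = 0 -> a = 0 /\ b = 0.
Proof.
move/eqP; rewrite -!normCK paddr_eq0 ?exprn_ge0 // !expf_eq0 /= !normr_eq0.
by move=> /andP[/eqP-> /eqP->].
Qed.

(* In a unitary basis triangularizing W, comparing the diagonals of
   sum_i X_i X_i^* = c and sum_i X_i^* X_i = c kills the off-diagonal entries. *)
Lemma plane_normal G W : irred G -> ginv G W -> \dim W = 2%N -> abelian W ->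
  trless W -> exists2 P, P \is unitarymx & conjv P W = vt2.
Proof.
move=> iG GW d2 aW tW; have [Gu _ Gs] := iG.
have := onb_exists W; rewrite d2 => -[A hA]; have [AW _ Ag] := hA.
have onbu u : G u -> onb W (fun i => mxconj u (A i)).
  by move=> hu; have := onb_mxconj (Gu u hu) hA; rewrite (ginv_conjv iG GW hu).
have [c hc] : exists c, \sum_i A i *m (A i)^t* = c%:M.
  apply: Gs => u hu; rewrite linear_sum /=.
  rewrite (@casimir _ _ _ (fun X Y => X *m Y) _ W A (fun i => mxconj u (A i))) //.
  - by apply: eq_bigr => i _; rewrite mxconjM ?Gu // mxconj_adj.
  - by move=> Y k X Z; rewrite mulmxDl scalemxAl.
  - by move=> Y k X Z; rewrite mulmxDr scalemxAr.
  - exact: onbu.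
have [d hd] : exists c, \sum_i (A i)^t* *m A i = c%:M.
  apply: Gs => u hu; rewrite linear_sum /=.
  rewrite (@casimir _ _ _ (fun X Y => Y *m X) _ W A (fun i => mxconj u (A i))) //.
  - by apply: eq_bigr => i _; rewrite mxconjM ?Gu // mxconj_adj.
  - by move=> Y k X Z; rewrite mulmxDr scalemxAr.
  - by move=> Y k X Z; rewrite mulmxDl scalemxAl.
  - exact: onbu.
have cd : c = d.
  have : \tr (c%:M : M) = \tr (d%:M : M).
    rewrite -hc -hd !linear_sum; apply: eq_bigr => i _; exact: mxtrace_mulC.
  by rewrite !mxtrace_scalar => /eqP; rewrite eqrMn2r // => /eqP.
have [P hP tP] := abelian_cotrigonalization aW.
pose B i := mxconj P (A i).
have {}hc : \sum_i B i *m (B i)^t* = c%:M.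
  rewrite -(mxconj_scalar c hP) -hc linear_sum /=; apply: eq_bigr => i _.
  by rewrite /B mxconjM // mxconj_adj.
have {}hd : \sum_i (B i)^t* *m B i = c%:M.
  rewrite cd -(mxconj_scalar d hP) -hd linear_sum /=; apply: eq_bigr => i _.
  by rewrite /B mxconjM // mxconj_adj.
have [X eX] : {X | X = B ord0} by exists (B ord0).
have [Y eY] : {Y | Y = B ord_max} by exists (B ord_max).
have [x12 x13 x23] : [/\ X i1 i2 = 0, X i1 i3 = 0 & X i2 i3 = 0].
  by rewrite eX; exact: tP _ (AW ord0).
have [y12 y13 y23] : [/\ Y i1 i2 = 0, Y i1 i3 = 0 & Y i2 i3 = 0].
  by rewrite eY; exact: tP _ (AW ord_max).
rewrite sum2 -eX -eY in hc; rewrite sum2 -eX -eY in hd.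
(* For a lower triangular B, the first diagonal entry of B^* B exceeds that of B B^* by the squared
   moduli below the diagonal in column 1. Once that column is cleared, the same comparison works for
   column 2. *)
have cmp i := congr1 (fun N : M => N i i) (etrans hc (esym hd)).
have := cmp i1; have := cmp i2; rewrite !(mxE, sum3, adjE).
rewrite x12 x13 x23 y12 y13 y23 !simpe => e2 e1.
have {e1} : (X i2 i1 * (X i2 i1)^* + X i3 i1 * (X i3 i1)^*) +
            (Y i2 i1 * (Y i2 i1)^* + Y i3 i1 * (Y i3 i1)^*) = 0.
  by apply/eqP; rewrite -(subrr (X i1 i1 * (X i1 i1)^* + Y i1 i1 * (Y i1 i1)^*)) {1}e1;
     apply/eqP; ring.
have nn (a : C) : 0 <= a * a^* by rewrite -normCK exprn_ge0.
move/eqP; rewrite paddr_eq0 ?addr_ge0 // => /andP[/eqP/addr_norm_eq0[x21 x31] /eqP/addr_norm_eq0[y21 y31]].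
have {e2} : X i3 i2 * (X i3 i2)^* + Y i3 i2 * (Y i3 i2)^* = 0.
  move: e2; rewrite x21 y21 !simpe => e2.
  by apply/eqP; rewrite -(subrr (X i2 i2 * (X i2 i2)^* + Y i2 i2 * (Y i2 i2)^*)) {1}e2;
     apply/eqP; ring.
move/addr_norm_eq0 => [x32 y32].
exists P => //; apply: conjv_eq => // [|Z ZW]; first by rewrite d2 dim_vt2.
apply/VT2P; rewrite mxconj_tr // (tW _ ZW); split=> //.
rewrite (Ag _ ZW) sum2 linearD !linearZ /= -/(B ord0) -/(B ord_max) -eX -eY /offdiag0 !mxE.
by rewrite x12 x13 x23 x21 x31 x32 y12 y13 y23 y21 y31 y32 !simpe.
Qed.

End Planes.

(** * Orthogonal pairs of commutative planes, and VT_4 *)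

Section TwoPlanes.
Variables (C : numClosedFieldType) (omega : C).
Hypothesis omega_root : 1 + omega + omega ^+ 2 = 0.
Hypothesis omega_conj : omega^* = omega ^+ 2.
Local Notation M := 'M[C]_3.
Implicit Types (X Y Z u : M) (S T W : {vspace M}) (z w : C) (G : M -> Prop).
Local Notation vt2 := (vt2 C).
Local Notation vt8 := (vt8 C).
Local Notation vt4 := (vt4 omega).

Definition cyc (a d e : C) : M := a *: delta_mx i1 i2 + d *: delta_mx i2 i3 + e *: delta_mx i3 i1.

(* X^2 having zero diagonal forces X_ij X_ji = 0, so the unitary X is a weighted 3-cycle. *)
Lemma hollow_unitary X : X \is unitarymx -> diag0 X -> diag0 (X *m X) ->
  (exists a d e, [/\ unimod a, unimod d, unimod e & X = cyc a d e]) \/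
  (exists a d e, [/\ unimod a, unimod d, unimod e & X^t* = cyc a d e]).
Proof.
move=> hX [d1 d2 d3]; rewrite /diag0 !mxE !sum3 d1 d2 d3 !simpe => -[p1 p2 p3].
have XX := unitary_mulV hX; have XX' := unitary_mulVr hX.
have r i := congr1 (fun N : M => N i i) XX; have s i := congr1 (fun N : M => N i i) XX'.
have := s i3; have := s i2; have := s i1; have := r i3; have := r i2; have := r i1.
move=> {r s}; rewrite !(mxE, sum3, adjE) d1 d2 d3 !simpe /= => r1 r2 r3 s1 s2 s3.
have half (a : C) : 2 * a = 0 -> a = 0.
  by move/eqP; rewrite mulf_eq0 pnatr_eq0 => /eqP.
have ac : X i1 i2 * X i2 i1 = 0.
  apply: half; rewrite -[RHS](subrr 0) -{1}(addr0 0) -{1}p1 -{1}p2 -p3; ring.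
have be : X i1 i3 * X i3 i1 = 0 by move: p1; rewrite ac add0r.
have df : X i2 i3 * X i3 i2 = 0 by move: p3; rewrite mulrC be add0r mulrC.
have z (a b : C) : a * b = 0 -> a != 0 -> b = 0.
  by move=> /eqP; rewrite mulf_eq0 => /orP[]/eqP-> //; rewrite eqxx.
have [a0|a0] := eqVneq (X i1 i2) 0.
  right; rewrite a0 !simpe in r1 s2.
  have b0 : X i1 i3 != 0 := unimod_neq0 r1.
  have f0 : X i3 i2 != 0 by apply: (@unimod_neq0 _ (X i3 i2)); rewrite /unimod mulrC.
  have e0 := z _ _ be b0; have d0 : X i2 i3 = 0.
    by apply: z f0; rewrite mulrC.
  rewrite e0 d0 !simpe in r2 r3 s1 s3.
  exists (X i2 i1)^*, (X i3 i2)^*, (X i1 i3)^*.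
  split; try exact: unimod_conj.
  by apply: mx3P; rewrite !(mxE, adjE) /= ?d1 ?d2 ?d3 ?a0 ?e0 ?d0 !simpe.
left; have c0 := z _ _ ac a0; rewrite c0 !simpe in r2 s1.
have d0 : X i2 i3 != 0 := unimod_neq0 r2.
have e0 : X i3 i1 != 0 by apply: (@unimod_neq0 _ (X i3 i1)); rewrite /unimod mulrC.
have f0 := z _ _ df d0; have b0 : X i1 i3 = 0 by apply: z e0; rewrite mulrC.
rewrite f0 b0 !simpe in r1 r3 s2 s3.
exists (X i1 i2), (X i2 i3), (X i3 i1); split=> //.
by apply: mx3P; rewrite !(mxE, adjE) /= ?d1 ?d2 ?d3 ?c0 ?f0 ?b0 !simpe.
Qed.

Lemma cyc_cube a d e : cyc a d e *m cyc a d e *m cyc a d e = (a * d * e)%:M.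
Proof.
by apply: mx3P; rewrite !(mxE, sum3) /= !simpe //; ring.
Qed.

Lemma vh_vt2 : vh omega \in vt2 /\ vh omega *m vh omega \in vt2.
Proof.
split; apply/VT2P; rewrite trE /offdiag0.
  by rewrite !mxE /= !simpe omega_root.
rewrite [_ *m _](_ : _ = vh omega ^+ 2) // vhat2E // !mxE /= !simpe addrAC.
by rewrite omega_root.
Qed.

Lemma unimod_omega : unimod omega.
Proof. by rewrite /unimod omega_conj -exprS omega3. Qed.

Lemma vh_unitary : vh omega \is unitarymx.
Proof.
apply: dg_unitary; [exact: unimod1|exact: unimod_omega|].
by rewrite expr2; apply: unimodM; exact: unimod_omega.
Qed.

Lemma vh_cube : vh omega *m vh omega *m vh omega = 1%:M.
Proof.
have w3 := omega3 omega_root.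
rewrite [_ *m _ *m _](_ : _ = vh omega ^+ 2 *m vh omega) // vhat2E //.
apply: mx3P; rewrite !(mxE, sum3) /= !simpe //; by rewrite -exprSr.
Qed.

(** T is conjugate to the diagonal plane, so it contains a conjugate X of v. X is unitary, and X and
    X^2 lie in T, so both have zero diagonal; then X or its adjoint is a weighted 3-cycle, whose
    weights have product 1 since X^3 = 1. A diagonal unitary turns it into u^2. *)
Lemma two_planes_std T : sdj T -> trless T -> abelian T -> \dim T = 2%N ->
  (forall X Y, X \in vt2 -> Y \in T -> hs X Y = 0) -> qg_iso (vt2 + T) vt4.
Proof.
move=> sT tT aT dT oT; have [w hw eT] := abelian_iso_vt2 sT tT aT dT.
have hw' := unitary_adj hw.
have inT Y : Y \in vt2 -> mxconj (w^t* ) Y \in T.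
  by move=> Yv; rewrite -(conjvK T hw) eT; apply: mem_conjv.
have T0 Y : Y \in T -> diag0 Y.
  move=> YT; apply/VT6P; rewrite -orthv_vt8_vt2; apply/orthvP; split.
    by apply/VT8P; exact: tT.
  by move=> X XT; apply: oT.
have [v1 v2] := vh_vt2.
pose X := mxconj (w^t* ) (vh omega).
have uX : X \is unitarymx.
  by rewrite /X /mxconj adjK !mul_unitarymx // vh_unitary.
have XT : X \in T by exact: inT.
have X2T : X *m X \in T by rewrite -mxconjM //; exact: inT.
have X3 : X *m X *m X = 1%:M.
  by rewrite -!mxconjM // vh_cube mxconj_scalar.
have [Y [YT Y3 [a [d [e [ha hd he eY]]]]]] : exists Y, [/\ Y \in T, Y *m Y *m Y = 1%:M &
    exists a d e, [/\ unimod a, unimod d, unimod e & Y = cyc a d e]].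
  have [h|h] := hollow_unitary uX (T0 _ XT) (T0 _ X2T); first by exists X.
  exists (X^t* ); split=> //; first exact: sT.
  by rewrite -!adjM mulmxA X3 adj_scalar conjC1.
have ade : a * d * e = 1.
  have /matrixP/(_ i1 i1) : (a * d * e)%:M = 1%:M :> M by rewrite -cyc_cube -eY.
  by rewrite !mxE.
have u1 := unimod1 C; have had := unimodM ha hd.
(* These phases clear the first two weights of the cycle; as a d e = 1, the third one becomes 1
   too. *)
have hD : dg 1 a (a * d) \is unitarymx by exact: dg_unitary.
exists (dg 1 a (a * d)) => //.
have DY : mxconj (dg 1 a (a * d)) Y = uh C ^+ 2.
  by rewrite eY; apply: mx3P; rewrite mxconj_dgE uhat2E !mxE /= !simpe.
apply/esym/eqP; rewrite eqEdim; apply/andP; split.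
  have ch : uh C ^+ 2 \in conjv (dg 1 a (a * d)) T by rewrite -DY mem_conjv.
  have sub : (conjv (dg 1 a (a * d)) T <= conjv (dg 1 a (a * d)) (vt2 + T))%VS.
    by rewrite conjvS ?addvSr.
  rewrite vt4E //; apply/subvP => _ /add_lineP[_ /add_lineP[Z Z2 [k ->]] [l ->]].
  apply: memvD; last by rewrite memvZ // (subvP sub).
  apply: memvD; last first.
    rewrite memvZ // (subvP sub) // (_ : uh C = (uh C ^+ 2)^t* ).
      exact: sdj_conjv.
    by apply: mx3P; rewrite adjE uhat2E uhatE /= ?conjC1 ?conjC0.
  by rewrite conjv_addv conjv_dg_vt2 // (subvP (addvSl _ _)).
rewrite dim_conjv // dim_vt4 // (leq_trans (dimv_add_leqif _ _)) //.
by rewrite dT dim_vt2.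
Qed.

Lemma two_planes S T : sdj S -> trless S -> abelian S -> \dim S = 2%N ->
  sdj T -> trless T -> abelian T -> \dim T = 2%N ->
  (forall X Y, X \in S -> Y \in T -> hs X Y = 0) -> qg_iso (S + T) vt4.
Proof.
move=> sS tS aS dS sT tT aT dT oST; have [w hw eS] := abelian_iso_vt2 sS tS aS dS.
apply: (@qg_iso_trans _ _ _ (vt2 + conjv w T)%VS).
  by exists w; rewrite // conjv_addv eS.
apply: two_planes_std; first exact: sdj_conjv.
- exact: trless_conjv.
- by move=> X Y XT YT; rewrite -[X](mxconjVK _ hw) -[Y](mxconjVK _ hw) -!(mxconjM _ _ hw) aT // -conjvP.
- by rewrite dim_conjv.
move=> X Y; rewrite -eS => XS YT.
by rewrite -(hs_mxconj _ _ (unitary_adj hw)) oST // -conjvP.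
Qed.

Lemma split4 G S T : irred G -> ginv G S -> sdj S -> trless S -> \dim S = 4%N ->
  ginv G T -> sdj T -> (T <= S)%VS -> \dim T = 2%N -> qg_iso S vt4.
Proof.
move=> iG GS sS tS dS GT sT TS dT.
have Gc := ginv_orthv iG GS GT; have sc := sdj_orthv sS sT.
have dc : \dim (orthv S T) = 2%N by rewrite dim_orthv // dS dT.
have tr T' : (T' <= S)%VS -> trless T' by move=> /subvP h X /h /tS.
rewrite -(addv_orthv TS); apply: two_planes => //; try exact: (dim2_abelian iG).
- exact: tr.
- by apply: tr; exact: capvSl.
by move=> X Y XT /orthvP[_ ->].
Qed.

Lemma vt4_sub : (vt4 <= vt8)%VS.
Proof. by apply/subvP => X /(VT4P omega_root)[t _]; apply/VT8P. Qed.

(** For k = omega and k = omega^2 the first generator is, up to a phase, u^2 v^2 and u^2 v. The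
    eight nontrivial products of the shift u and the clock v fall into four commuting planes: [vt4]
    contains the powers of u and the powers of v, and these are the other two planes. *)
Definition twisted k : {vspace M} :=
  (<[cyc 1 (k ^+ 2) k]> + <[(cyc 1 (k ^+ 2) k)^t*]>)%VS.

Lemma vt4_compl : qg_iso (orthv vt8 vt4) vt4.
Proof.
have w3 := omega3 omega_root; have w2 := omega2 omega_root.
have hw := unimod_omega.
have prop k : k ^+ 2 + k + 1 = 0 -> k^* = k ^+ 2 -> k ^+ 3 = 1 ->
  [/\ sdj (twisted k), trless (twisted k), abelian (twisted k), \dim (twisted k) = 2%N
   & (twisted k <= orthv vt8 vt4)%VS].
  move=> k1 kc k3.
  have kc2 : (k ^+ 2)^* = k by rewrite -kc conjCK.
  split.
  - move=> _ /add_lineP[_ /vlineP[a ->] [b ->]]; rewrite adjD !adjZ adjK.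
    by rewrite addrC memv_add // memvZ ?memv_line.
  - move=> _ /add_lineP[_ /vlineP[a ->] [b ->]]; rewrite trE !(mxE, adjE) /= !simpe //.
  - have e : cyc 1 (k ^+ 2) k *m (cyc 1 (k ^+ 2) k)^t* = (cyc 1 (k ^+ 2) k)^t* *m cyc 1 (k ^+ 2) k.
      by apply: mx3P; rewrite !(mxE, sum3, adjE) /= !simpe //; rewrite ?[k^* * k]mulrC ?kc ?kc2 -?exprS -?exprSr ?k3.
    move=> _ _ /add_lineP[_ /vlineP[a ->] [b ->]] /add_lineP[_ /vlineP[c ->] [d ->]].
    rewrite !mulmxDl !mulmxDr -!scalemxAl -!scalemxAr e !scalerA.
    by rewrite [RHS]addrACA [c * a]mulrC [d * b]mulrC [d * a]mulrC [c * b]mulrC.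
  - rewrite dim_add_line ?dim_vline.
      case: eqP => // /matrixP/(_ i1 i2); rewrite !mxE /= !simpe => /eqP.
      by rewrite oner_eq0.
    apply/negP => /vlineP[c] /matrixP/(_ i2 i1); rewrite !(mxE, adjE) /= !simpe => /eqP.
    by rewrite oner_eq0.
  apply/subvP => _ /add_lineP[_ /vlineP[a ->] [b ->]]; apply/orthvP; split.
    by apply/VT8P; rewrite trE !(mxE, adjE) /= !simpe.
  move=> Y /(VT4P omega_root)[_ [e1 e2 e3 e4]].
  rewrite hs3 !(mxE, adjE) /= !simpe ?kc ?kc2 e1 e2 e3 e4 ?simpe.
  transitivity ((k ^+ 2 + k + 1) * ((Y i1 i3)^* * b + (Y i3 i1)^* * a)); first by ring.
  by rewrite k1 mul0r.
have [||| s1 t1 a1 d1 o1] := prop omega => //; first by rewrite w2; ring.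
have [||| s2 t2 a2 d2 o2] := prop (omega ^+ 2).
- by rewrite -exprM (exprD _ 3 1) w3 w2; ring.
- by rewrite rmorphXn /= omega_conj.
- by rewrite -exprM mulnC exprM w3 expr1n.
have o12 X Y : X \in twisted omega -> Y \in twisted (omega ^+ 2) -> hs X Y = 0.
  move=> /add_lineP[_ /vlineP[a ->] [b ->]] /add_lineP[_ /vlineP[c ->] [d ->]].
  have cM x y : (x * y)^* = x^* * y^* :> C by exact: rmorphM.
  have w4 : omega ^+ 2 ^+ 2 = omega by rewrite -exprM (exprD _ 3 1) w3 mul1r.
  have c2 : (omega ^+ 2)^* = omega by rewrite -omega_conj conjCK.
  rewrite hs3 !(mxE, adjE) /= !simpe !cM w4 !omega_conj !c2.
  ring: w2.
have -> : orthv vt8 vt4 = (twisted omega + twisted (omega ^+ 2))%VS.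
  apply/esym/eqP; rewrite eqEdim subv_add o1 o2 /=.
  rewrite dim_orthv ?vt4_sub // dim_vt8 dim_vt4 //.
  rewrite dimv_disjoint_sum ?d1 ?d2 //; apply/eqP; rewrite -subv0.
  apply/subvP => X /memv_capP[X1 X2]; rewrite memv0; apply/eqP/hs_eq0.
  exact: o12.
exact: two_planes.
Qed.

End TwoPlanes.

(** * Dimension 4 *)

Section Dim4.
Variable C : numClosedFieldType.
Local Notation M := 'M[C]_3.
Implicit Types (X Y Z u : M) (S T W : {vspace M}) (z w : C) (G : M -> Prop).

(* If X commutes with K, then X - h X h^* is fixed by K and negated by h, so it spans a G-invariant line. *)
Lemma index2_irred G K h : irred G ->
  (forall u, K u -> G u) -> (forall u, K u -> K (u^t* )) -> G h ->
  (forall u, K u -> K (h^t* *m u *m h)) -> K (h *m h) ->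
  (forall u, G u -> K u \/ K (h^t* *m u)) -> irred K.
Proof.
have two0 : (2 : C) != 0 by rewrite pnatr_eq0.
move=> iG KG Ka Gh Kh Khh GK; have [Gu Ga Gs] := iG; have hh := Gu h Gh.
split=> [u /KG /Gu //|//|].
(* Hermitian X come first because [invariant_line_eq0] wants a self-adjoint line; the general case
   follows by splitting X into two hermitian parts. *)
have herm X : X^t* = X -> (forall u, K u -> mxconj u X = X) -> exists c, X = c%:M.
  move=> hX KX; pose X' := mxconj h X.
  have KX' u : K u -> mxconj u X' = X'.
    move=> Ku; rewrite /X' -{2}(KX _ (Kh u Ku)) !mxconj_comp !mulmxA.
    by rewrite unitary_mulV // mul1mx.
  have hX' : mxconj h X' = X by rewrite /X' mxconj_comp KX.
  have [s hs] : exists s, X + X' = s%:M.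
    apply: Gs => u /GK[Ku|Ku]; first by rewrite linearD /= KX // KX'.
    have -> : u = h *m (h^t* *m u) by rewrite mulmxA unitary_mulV // mul1mx.
    by rewrite -mxconj_comp [mxconj (_ *m u) _]linearD /= KX // KX' // linearD /= hX' addrC.
  pose L := X - X'.
  have hL : mxconj h L = - L by rewrite linearB /= hX' opprB.
  have KL u : K u -> mxconj u L = L by move=> Ku; rewrite linearB /= KX // KX'.
  have L0 : L = 0.
    apply: (invariant_line_eq0 iG).
    - have := mxconj_tr L hh; rewrite hL raddfN /= => /eqP.
      by rewrite eq_sym -addr_eq0 -mulr2n mulrn_eq0 => /eqP.
    - move=> u /GK[Ku|Ku]; first by exists 1; rewrite scale1r KL.
      exists (-1); have -> : u = h *m (h^t* *m u) by rewrite mulmxA unitary_mulV // mul1mx.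
      by rewrite -mxconj_comp KL // hL scaleN1r.
    - by exists 1; rewrite scale1r adjB /X' mxconj_adj hX.
  exists (2^-1 * s); apply: (scalerI two0).
  rewrite scale_scalar_mx mulrA divff ?pnatr_eq0 // mul1r -hs.
  by move/eqP: L0; rewrite subr_eq0 => /eqP <-; rewrite -mulr2n scaler_nat.
move=> X KX.
have KXa u : K u -> mxconj u (X^t* ) = X^t* by move=> Ku; rewrite -mxconj_adj KX.
have [a ha] : exists a, X + X^t* = a%:M.
  by apply: herm => [|u Ku]; [rewrite adjD adjK addrC | rewrite linearD /= KX // KXa].
have [b hb] : exists b, 'i *: (X - X^t* ) = b%:M.
  apply: herm => [|u Ku]; last by rewrite linearZ linearB /= KX // KXa.
  by rewrite adjZ adjB adjK conjCi scaleNr -scalerN opprB.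
exists (2^-1 * (a - 'i * b)); apply: (scalerI two0).
rewrite scale_scalar_mx mulrA divff ?pnatr_eq0 // mul1r raddfB /= -ha -scale_scalar_mx -hb.
by rewrite scalerA -expr2 sqrCi scaleN1r opprK addrACA subrr addr0 -mulr2n scaler_nat.
Qed.

Definition j0 : 'I_4 := @Ordinal 4 0 isT.
Definition j1 : 'I_4 := @Ordinal 4 1 isT.
Definition j2 : 'I_4 := @Ordinal 4 2 isT.
Definition j3 : 'I_4 := @Ordinal 4 3 isT.

Lemma sum4 (V : nmodType) (F : 'I_4 -> V) : \sum_i F i = F j0 + F j1 + F j2 + F j3.
Proof.
rewrite !big_ord_recl big_ord0 addr0 !addrA.
by congr (F _ + F _ + F _ + F _); apply: val_inj.
Qed.

Lemma forall4 (P : 'I_4 -> Prop) : P j0 -> P j1 -> P j2 -> P j3 -> forall i, P i.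
Proof.
move=> p0 p1 p2 p3 [[|[|[|[|//]]]] hi].
- by rewrite (_ : Ordinal hi = j0) //; apply: val_inj.
- by rewrite (_ : Ordinal hi = j1) //; apply: val_inj.
- by rewrite (_ : Ordinal hi = j2) //; apply: val_inj.
- by rewrite (_ : Ordinal hi = j3) //; apply: val_inj.
Qed.

(* An alternating trilinear form in dimension 4 is contraction of the volume form with n. *)
Lemma alternating4 (f : 'I_4 -> 'I_4 -> 'I_4 -> C) :
  (forall i j k, f i j k = - f j i k) -> (forall i j k, f i j k = f j k i) ->
  exists n : 'I_4 -> C, [/\ forall j k, \sum_i n i * f i j k = 0,
    forall x : 'I_4 -> C, (forall j k, \sum_i x i * f i j k = 0) ->
      forall i j, x i * n j = x j * n i
    & (forall i, n i = 0) -> forall i j k, f i j k = 0].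
Proof.
move=> h1 h2.
have h3 i k : f i i k = 0.
  by have /eqP := h1 i i k; rewrite -addr_eq0 -mulr2n mulrn_eq0 => /eqP.
have h4 i k : f i k i = 0 by rewrite h2 h2.
have h5 i k : f k i i = 0 by rewrite h2.
set a := f j1 j2 j3; set b := f j0 j2 j3; set c := f j0 j1 j3; set d := f j0 j1 j2.
have ea : [/\ f j2 j3 j1 = a, f j3 j1 j2 = a, f j2 j1 j3 = - a, f j1 j3 j2 = - a & f j3 j2 j1 = - a].
  by rewrite /a; split; first [by rewrite h2 | by rewrite h2 h2 | by rewrite h1 | by rewrite h1 h2 | by rewrite h1 h2 h2].
have eb : [/\ f j2 j3 j0 = b, f j3 j0 j2 = b, f j2 j0 j3 = - b, f j0 j3 j2 = - b & f j3 j2 j0 = - b].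
  by rewrite /b; split; first [by rewrite h2 | by rewrite h2 h2 | by rewrite h1 | by rewrite h1 h2 | by rewrite h1 h2 h2].
have ec : [/\ f j1 j3 j0 = c, f j3 j0 j1 = c, f j1 j0 j3 = - c, f j0 j3 j1 = - c & f j3 j1 j0 = - c].
  by rewrite /c; split; first [by rewrite h2 | by rewrite h2 h2 | by rewrite h1 | by rewrite h1 h2 | by rewrite h1 h2 h2].
have ed : [/\ f j1 j2 j0 = d, f j2 j0 j1 = d, f j1 j0 j2 = - d, f j0 j2 j1 = - d & f j2 j1 j0 = - d].
  by rewrite /d; split; first [by rewrite h2 | by rewrite h2 h2 | by rewrite h1 | by rewrite h1 h2 | by rewrite h1 h2 h2].
case: ea => a1 a2 a3 a4 a5; case: eb => b1 b2 b3 b4 b5.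
case: ec => c1 c2 c3 c4 c5; case: ed => d1 d2 d3 d4 d5.
pose tbl := (h3, h4, h5, (a1, a2, a3, a4, a5), (b1, b2, b3, b4, b5), (c1, c2, c3, c4, c5), (d1, d2, d3, d4, d5)).
(* The Hodge dual of f: up to the sign (-1)^i, the coordinate i is the value of f on the three other
   indices. *)
exists (fun i => nth 0 [:: a; - b; c; - d] i); split.
- by do 2!apply: forall4; rewrite sum4 /= ?tbl -?/a -?/b -?/c -?/d; ring.
- move=> x hx.
  have e01 := hx j0 j1; have e02 := hx j0 j2; have e03 := hx j0 j3.
  have e12 := hx j1 j2; have e13 := hx j1 j3; have e23 := hx j2 j3.
  move: e01 e02 e03 e12 e13 e23; rewrite !sum4 !tbl -?/a -?/b -?/c -?/d !(mulr0, add0r, addr0) !mulrN.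
  move=> e01 e02 e03 e12 e13 e23.
  have fin (u v e : C) : e = 0 -> u - v = e \/ v - u = e -> u = v.
    by move=> -> [] /eqP; rewrite subr_eq0 => /eqP ->.
  do 2!apply: forall4; rewrite /= ?mulrN //;
    first [ by apply: (fin _ _ _ e01); first [left; ring | right; ring]
          | by apply: (fin _ _ _ e02); first [left; ring | right; ring]
          | by apply: (fin _ _ _ e03); first [left; ring | right; ring]
          | by apply: (fin _ _ _ e12); first [left; ring | right; ring]
          | by apply: (fin _ _ _ e13); first [left; ring | right; ring]
          | by apply: (fin _ _ _ e23); first [left; ring | right; ring] ].
- move=> hn; have := hn j3; have := hn j2; have := hn j1; have := hn j0.
  rewrite /= => a0 /eqP; rewrite oppr_eq0 => /eqP b0 c0 /eqP; rewrite oppr_eq0 => /eqP d0.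
  by do 3!apply: forall4; rewrite ?tbl -?/a -?/b -?/c -?/d ?a0 ?b0 ?c0 ?d0 ?oppr0.
Qed.

End Dim4.

(** * The alternating form, and the existence of a commutative plane *)

Section Dim4Planes.
Variable C : numClosedFieldType.
Local Notation M := 'M[C]_3.
Implicit Types (X Y Z u : M) (S T W : {vspace M}) (z w : C) (G : M -> Prop).

(** For self-adjoint S, the vanishing of this form on S says that [S, S] is orthogonal to S. *)
Definition vol X Y Z : C^o := \tr (comm X Y *m Z).

Fact vol_is_linear X Y : linear (vol X Y).
Proof. by move=> k Z Z'; rewrite /vol mulmxDr -scalemxAr mxtraceD mxtraceZ. Qed.
HB.instance Definition _ X Y := GRing.isLinear.Build C M C^o *:%R (vol X Y) (vol_is_linear X Y).

Lemma vol_swap X Y Z : vol X Y Z = - vol Y X Z.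
Proof. by rewrite /vol commC mulNmx raddfN. Qed.
Lemma vol_cycle X Y Z : vol X Y Z = vol Y Z X.
Proof.
rewrite /vol /comm !mulmxBl !raddfB /=; congr (_ - _).
  by rewrite -mulmxA mxtrace_mulC.
by rewrite [RHS]mxtrace_mulC mulmxA [LHS]mxtrace_mulC mulmxA mxtrace_mulC mulmxA.
Qed.
Lemma vol_mxconj u X Y Z : u \is unitarymx ->
  vol (mxconj u X) (mxconj u Y) (mxconj u Z) = vol X Y Z.
Proof. by move=> hu; rewrite /vol -mxconj_comm // -mxconjM // mxconj_tr. Qed.
Lemma vol_adj X Y Z : vol (X^t* ) (Y^t* ) (Z^t* ) = - (vol X Y Z)^*.
Proof.
by rewrite /vol -comm_adj -adjM tr_adj commC mulmxN raddfN rmorphN /= mxtrace_mulC.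
Qed.
Lemma vol_sum n (k : 'I_n -> C) (A : 'I_n -> M) Y Z :
  vol (\sum_i k i *: A i) Y Z = \sum_i k i * vol (A i) Y Z.
Proof.
rewrite vol_cycle linear_sum; apply: eq_bigr => i _.
by rewrite linearZ /= -vol_cycle.
Qed.

Lemma dim4_vol G S : irred G -> ginv G S -> sdj S -> trless S -> \dim S = 4%N ->
  forall X Y Z, X \in S -> Y \in S -> Z \in S -> vol X Y Z = 0.
Proof.
move=> iG GS sS tS d4; have [Gu Ga _] := iG.
have := onb_exists S; rewrite d4 => -[A hA]; have [AS _ Ag] := hA.
have [|| n [n1 n2 n3]] := @alternating4 C (fun i j k => vol (A i) (A j) (A k)).
- by move=> *; rewrite vol_swap.
- by move=> *; rewrite vol_cycle.
have radE X : (forall j k, vol X (A j) (A k) = 0) ->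
    forall Y Z, Y \in S -> Z \in S -> vol X Y Z = 0.
  move=> hX Y Z /Ag -> /Ag ->; rewrite vol_cycle vol_sum big1 // => j _.
  rewrite vol_cycle vol_sum big1 ?mulr0 // => k _.
  by rewrite vol_cycle hX mulr0.
pose N := \sum_i n i *: A i.
have NS : N \in S by apply: memv_suml => i _; rewrite memvZ.
have Nrad Y Z : Y \in S -> Z \in S -> vol N Y Z = 0.
  by apply: radE => j k; rewrite vol_sum n1.
(* The radical is visibly invariant and self-adjoint; to transfer this to N, it must be no larger
   than the line of N. *)
have radN X : N != 0 -> X \in S -> (forall Y Z, Y \in S -> Z \in S -> vol X Y Z = 0) ->
    exists c, X = c *: N.
  move=> N0 XS hX.
  have [j nj] : exists j, n j != 0.
    apply/existsP; apply: contraNT N0; rewrite negb_exists => /forallP h.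
    by rewrite /N big1 // => i _; move/(_ i): h; rewrite negbK => /eqP ->; rewrite scale0r.
  have hx : forall i k, hs (A i) X * n k = hs (A k) X * n i.
    apply: (n2 (fun i => hs (A i) X)) => i k; rewrite -vol_sum -Ag //; exact: hX.
  exists (hs (A j) X / n j); rewrite {1}(Ag _ XS) scaler_sumr; apply: eq_bigr => i _.
  by rewrite scalerA mulrAC -hx mulfK.
have N0 : N = 0.
  apply/eqP; case: eqP => // /eqP N0; rewrite -(negbTE N0); apply/eqP.
  apply: (invariant_line_eq0 iG); first exact: tS.
    move=> u hu; apply: radN => // [|Y Z YS ZS]; first exact: GS.
    have hu' := Gu u hu; rewrite -(mxconjVK Y hu') -(mxconjVK Z hu') vol_mxconj //.
    by apply: Nrad; apply: GS => //; apply: Ga.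
  apply: radN => // [|Y Z YS ZS]; first exact: sS.
  rewrite -(adjK Y) -(adjK Z) vol_adj Nrad ?conjC0 ?oppr0 //; exact: sS.
have n0 i : n i = 0.
  have [_ Ao _] := hA; have := congr1 (hs (A i)) N0; rewrite linear0 linear_sum.
  rewrite (bigD1 i) //= hsZr Ao eqxx mulr1 big1 ?addr0 // => j ji.
  by rewrite hsZr Ao eq_sym (negbTE ji) mulr0.
move=> X Y Z XS; apply: radE => j k; rewrite (Ag _ XS) vol_sum big1 // => i _.
by rewrite n3 // mulr0.
Qed.

Lemma comm_suml n (k : 'I_n -> C) (A : 'I_n -> M) Y :
  comm (\sum_i k i *: A i) Y = \sum_i k i *: comm (A i) Y.
Proof.
by rewrite (@lin_sum C M M (fun X => comm X Y)) // => a X Z; rewrite commDl commZl.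
Qed.
Lemma comm_sumr n (k : 'I_n -> C) (A : 'I_n -> M) X :
  comm X (\sum_i k i *: A i) = \sum_i k i *: comm X (A i).
Proof.
by rewrite (@lin_sum C M M (fun Y => comm X Y)) // => a Y Z; rewrite commDr commZr.
Qed.

Definition q0 : 'I_6 := @Ordinal 6 0 isT.
Definition q1 : 'I_6 := @Ordinal 6 1 isT.
Definition q2 : 'I_6 := @Ordinal 6 2 isT.
Definition q3 : 'I_6 := @Ordinal 6 3 isT.
Definition q4 : 'I_6 := @Ordinal 6 4 isT.
Definition q5 : 'I_6 := @Ordinal 6 5 isT.

Lemma sum6 (V : nmodType) (F : 'I_6 -> V) :
  \sum_i F i = F q0 + F q1 + F q2 + F q3 + F q4 + F q5.
Proof.
rewrite !big_ord_recl big_ord0 addr0 !addrA.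
by congr (F _ + F _ + F _ + F _ + F _ + F _); apply: val_inj.
Qed.

Definition abelian_plane S W := [/\ (W <= S)%VS, abelian W & \dim W = 2%N].

Lemma plane2 X Y : (forall a b, a *: X + b *: Y = 0 -> a = 0 /\ b = 0) ->
  \dim (<[X]> + <[Y]>) = 2%N.
Proof.
move=> h; rewrite dim_add_line ?dim_vline.
  case: eqP => // X0; have [|/eqP] := h 1 0; last by rewrite oner_eq0.
  by rewrite X0 scaler0 scale0r addr0.
apply/negP => /vlineP[k e]; have [|_ /eqP] := h (-k) 1; last by rewrite oner_eq0.
by rewrite e scaleNr scale1r addNr.
Qed.

Lemma planes_line2 S X Y : X \in S -> Y \in S -> comm X Y = 0 ->
  (forall a b, a *: X + b *: Y = 0 -> a = 0 /\ b = 0) ->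
  abelian_plane S (<[X]> + <[Y]>).
Proof.
move=> XS YS /comm_eq0 c /plane2 d; split=> //; first by rewrite subv_add -!memvE XS.
move=> _ _ /add_lineP[_ /vlineP[a1 ->] [b1 ->]] /add_lineP[_ /vlineP[a2 ->] [b2 ->]].
apply/comm_eq0; rewrite commDl !commDr !commZl !commZr !commxx.
by rewrite (commC Y X) ((comm_eq0 X Y).2 c) !(oppr0, scaler0, addr0).
Qed.

(* Two independent relations among the six commutators [A_a, A_b] span a pencil of
   alternating forms; one member has zero Pfaffian, i.e. is decomposable. *)
Lemma plane_exists S (A : 'I_4 -> M) (U : {vspace M}) : onb S A -> 
  (forall X Y, X \in S -> Y \in S -> comm X Y \in U) -> (\dim U <= 4)%N ->
  exists W, abelian_plane S W.
Proof.
move=> hA hU dU; have [AS Ao Ag] := hA.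
pose c (t : 'I_6) := nth 0 [:: comm (A j0) (A j1); comm (A j0) (A j2); comm (A j0) (A j3);
   comm (A j1) (A j2); comm (A j1) (A j3); comm (A j2) (A j3)] t.
pose phi (r : 'rV[C]_6) : M := \sum_t r 0 t *: c t.
have phil : linear phi.
  move=> k r s; rewrite /phi scaler_sumr -big_split; apply: eq_bigr => t _ /=.
  by rewrite !mxE scalerDl scalerA.
pose phiL : {linear 'rV[C]_6 -> M} := HB.pack phi (GRing.isLinear.Build _ _ _ _ phi phil).
have sI : (limg (linfun phiL) <= U)%VS.
  apply/subvP => _ /memv_imgP[r _ ->]; rewrite lfunE /=; apply: memv_suml => t _.
  apply: memvZ; case: t => [[|[|[|[|[|[|//]]]]]] ?]; exact: hU.
have dk : (2 <= \dim (lker (linfun phiL)))%N.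
  have := limg_ker_dim (linfun phiL) fullv; rewrite capfv dimvf /dim /= => e.
  by have := leq_trans (dimvS sI) dU; move: e; set p := \dim _; set q := \dim _; lia.
(* The Pfaffian of the antisymmetric matrix with entries 01, 02, 03, 12, 13, 23 listed by r; its
   zeros are the decomposable bivectors. *)
pose pf (r : 'rV[C]_6) := r 0 q0 * r 0 q5 - r 0 q1 * r 0 q4 + r 0 q2 * r 0 q3.
have [r [r0 pr pfr]] : exists r : 'rV[C]_6, [/\ r != 0, phi r = 0 & pf r = 0].
  pose K := lker (linfun phiL).
  have inK r : r \in K -> phi r = 0 by rewrite memv_ker lfunE /= => /eqP.
  have [k [l [kK lK ind]]] : exists k l, [/\ k \in K, l \in K &
      forall a b, a *: k + b *: l = 0 -> a = 0 /\ b = 0].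
    have lt0 : (0 < \dim K)%N by apply: leq_trans dk.
    exists (vbasis K)`_0, (vbasis K)`_1.
    split; rewrite ?vbasis_mem ?mem_nth ?size_tuple //.
    move=> a b e; have /freeP h := basis_free (vbasisP K).
    pose g (i : 'I_(\dim K)) := nth 0 [:: a; b] i.
    have : \sum_i g i *: (vbasis K)`_i = 0.
      rewrite (bigD1 (Ordinal lt0)) //= (bigD1 (Ordinal dk)) //= addrA e add0r big1 // => i.
      by rewrite -!val_eqE /g /=; case: (val i) => [|[|[|?]]] //= _; rewrite scale0r.
    by move/h => hg; have := hg (Ordinal lt0); have := hg (Ordinal dk); rewrite /g /=.
  have [pl|pl] := eqVneq (pf l) 0.
    exists l; split=> //; last exact: inK.
    apply/eqP => l0; have [|_ /eqP] := ind 0 1; last by rewrite oner_eq0.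
    by rewrite scale0r l0 scaler0 addr0.
  pose B := k 0 q0 * l 0 q5 + l 0 q0 * k 0 q5 - k 0 q1 * l 0 q4 - l 0 q1 * k 0 q4
    + k 0 q2 * l 0 q3 + l 0 q2 * k 0 q3.
  (* Root of the discriminant of pf(k + t l), quadratic in t with leading coefficient pf l and
     middle coefficient B. *)
  pose s := sqrtC (B ^+ 2 - 4 * pf l * pf k).
  have ss : s ^+ 2 = B ^+ 2 - 4 * pf l * pf k by rewrite sqrtCK.
  pose t := (s - B) / (2 * pf l).
  exists (k + t *: l); split.
  - apply/eqP => e; have [|/eqP] := ind 1 t; last by rewrite oner_eq0.
    by rewrite scale1r.
  - by apply: inK; rewrite memvD ?memvZ.
  have -> : pf (k + t *: l) = pf l * t ^+ 2 + B * t + pf k.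
    by rewrite /pf /B !mxE; ring.
  have -> : pf l * t ^+ 2 + B * t + pf k = (s ^+ 2 - B ^+ 2 + 4 * pf l * pf k) / (4 * pf l).
    by rewrite /t; field.
  by rewrite ss; field.
pose m (i j : 'I_4) := nth 0 (nth [::] [:: [:: 0; r 0 q0; r 0 q1; r 0 q2];
  [:: - r 0 q0; 0; r 0 q3; r 0 q4]; [:: - r 0 q1; - r 0 q3; 0; r 0 q5];
  [:: - r 0 q2; - r 0 q4; - r 0 q5; 0]] i) j.
have pl : r 0 q2 * r 0 q3 = r 0 q1 * r 0 q4 - r 0 q0 * r 0 q5.
  by apply/eqP; rewrite -subr_eq0 -pfr /pf; apply/eqP; ring.
(* The exterior product of the rows i and j of m is m_ij times m. For m_ij nonzero, the relation
   among the six commutators thus says that the matrices with these rows as coordinates commute. *)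
have plucker i j a b : m i a * m j b - m i b * m j a = m i j * m a b.
  move: i j a b; rewrite /m; move: (r 0 q0) (r 0 q1) (r 0 q2) (r 0 q3) (r 0 q4) (r 0 q5) pl.
  by move=> x0 x1 x2 x3 x4 x5 e; do 4!apply: forall4; rewrite /=; ring: e.
have mii i : m i i = 0 by move: i; apply: forall4.
have mC i j : m i j = - m j i.
  by move: i j; do 2!apply: forall4; rewrite /m /= ?oppr0 ?opprK.
have msum : \sum_i \sum_j m i j *: comm (A i) (A j) = 2 *: phi r.
  rewrite !sum4 /phi sum6 /m /= !scale0r !simpe /c /=.
  rewrite (commC (A j1) (A j0)) (commC (A j2) (A j0)) (commC (A j3) (A j0)).
  rewrite (commC (A j2) (A j1)) (commC (A j3) (A j1)) (commC (A j3) (A j2)).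
  move: (comm _ _) (comm _ _) (comm _ _) (comm _ _) (comm _ _) (comm _ _).
  by move=> *; apply/matrixP => x y; rewrite !mxE; ring.
have [i [j mij]] : exists i j, m i j != 0.
  have /rV0Pn[t] := r0; case: t => [[|[|[|[|[|[|//]]]]]] ht] rt.
  - by exists j0, j1; rewrite /m /= (_ : q0 = Ordinal ht) //; apply: val_inj.
  - by exists j0, j2; rewrite /m /= (_ : q1 = Ordinal ht) //; apply: val_inj.
  - by exists j0, j3; rewrite /m /= (_ : q2 = Ordinal ht) //; apply: val_inj.
  - by exists j1, j2; rewrite /m /= (_ : q3 = Ordinal ht) //; apply: val_inj.
  - by exists j1, j3; rewrite /m /= (_ : q4 = Ordinal ht) //; apply: val_inj.
  - by exists j2, j3; rewrite /m /= (_ : q5 = Ordinal ht) //; apply: val_inj.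
exists (<[\sum_a m i a *: A a]> + <[\sum_b m j b *: A b]>)%VS.
apply: planes_line2.
- by apply: memv_suml => a _; rewrite memvZ.
- by apply: memv_suml => a _; rewrite memvZ.
- set D := comm _ _.
  have eD : D = \sum_a \sum_b (m i a * m j b) *: comm (A a) (A b).
    rewrite /D comm_suml; apply: eq_bigr => a _; rewrite comm_sumr scaler_sumr.
    by apply: eq_bigr => b _; rewrite scalerA.
  have eD' : D = - \sum_a \sum_b (m i b * m j a) *: comm (A a) (A b).
    rewrite eD exchange_big /= -sumrN; apply: eq_bigr => a _; rewrite -sumrN.
    by apply: eq_bigr => b _; rewrite commC scalerN.
  have : D + D = m i j *: \sum_a \sum_b m a b *: comm (A a) (A b).
    rewrite {1}eD eD' -sumrB scaler_sumr; apply: eq_bigr => a _.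
    rewrite -sumrB scaler_sumr; apply: eq_bigr => b _.
    by rewrite -scalerBl plucker scalerA.
  rewrite msum pr !scaler0 -mulr2n -scaler_nat => /eqP.
  by rewrite scaler_eq0 pnatr_eq0 => /eqP.
move=> a b e; have cf k : a * m i k + b * m j k = 0.
  have := congr1 (hs (A k)) e; rewrite linear0 linearD /= !hsZr !linear_sum /=.
  have d n : \sum_i0 hs (A k) (m n i0 *: A i0) = m n k.
    rewrite (bigD1 k) //= hsZr Ao eqxx mulr1 big1 ?addr0 // => l lk.
    by rewrite hsZr Ao eq_sym (negbTE lk) mulr0.
  by rewrite !d.
have := cf j; have := cf i; rewrite !mii !mulr0 add0r addr0 (mC j i) mulrN.
move=> /eqP; rewrite oppr_eq0 mulf_eq0 (negbTE mij) orbF => /eqP ->.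
by move=> /eqP; rewrite mulf_eq0 (negbTE mij) orbF => /eqP ->.
Qed.

End Dim4Planes.

(** * Relative position of commutative planes in a space of dimension 4 *)

Section Dim4Classification.
Variable C : numClosedFieldType.
Local Notation M := 'M[C]_3.
Implicit Types (X Y Z u : M) (S T W : {vspace M}) (z w : C) (G : M -> Prop).

Lemma free4 (A B D E : M) : (4 <= \dim (<[A]> + <[B]> + <[D]> + <[E]>))%N ->
  forall a b d e, a *: A + b *: B + d *: D + e *: E = 0 ->
  [/\ a = 0, b = 0, d = 0 & e = 0].
Proof.
move=> h a b d e e0.
have fr : free [:: A; B; D; E].
  rewrite /free eqn_leq dim_span /= (leq_trans h) // dimvS // !subv_add.
  by rewrite -!memvE !memv_span // !inE eqxx ?orbT.
have /(@freeP _ _ _ (in_tuple [:: A; B; D; E])) := fr.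
move=> /(_ (fun i => nth 0 [:: a; b; d; e] i)); rewrite sum4 /= => /(_ e0) h0.
by split; [apply: (h0 j0)|apply: (h0 j1)|apply: (h0 j2)|apply: (h0 j3)].
Qed.

Lemma mem_line_addl X S : X \in (<[X]> + S)%VS.
Proof. by rewrite (subvP (addvSl _ _)) ?memv_line. Qed.
Lemma mem_line_addr X S : X \in (S + <[X]>)%VS.
Proof. by rewrite (subvP (addvSr _ _)) ?memv_line. Qed.

Lemma extend_line S T : (T <= S)%VS -> \dim S = (\dim T).+1 ->
  exists X, S = (T + <[X]>)%VS.
Proof.
move=> TS dS; have d : \dim (orthv S T) = 1%N by rewrite dim_orthv // dS subSnn.
pose X := vpick (orthv S T); have XS : X \in orthv S T by exact: memv_pick.
have X0 : X != 0 by rewrite vpick0 -dimv_eq0 d.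
exists X; apply/eqP; rewrite eq_sym eqEdim subv_add TS -memvE.
have /orthvP[-> oX] := XS; rewrite dim_add_line ?dS ?leqnn //.
by apply: contra X0 => /oX /hs_eq0 ->.
Qed.

Lemma plane_basis W : \dim W = 2%N -> exists X Y, W = (<[X]> + <[Y]>)%VS.
Proof.
move=> d; pose X := vpick W.
have X0 : X != 0 by rewrite vpick0 -dimv_eq0 d.
have [||Y ->] := @extend_line W <[X]>; first by rewrite -memvE memv_pick.
  by rewrite d dim_vline X0.
by exists X, Y.
Qed.

Lemma plane_indep X Y : \dim (<[X]> + <[Y]>) = 2%N ->
  forall a b, a *: X + b *: Y = 0 -> a = 0 /\ b = 0.
Proof.
move=> d.
have nl (P Q : M) : \dim (<[P]> + <[Q]>) = 2%N -> P \notin <[Q]>%VS.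
  move=> dd; apply/negP; rewrite memvE => /addv_idPr e; move: dd; rewrite e dim_vline.
  by case: (_ == _).
have aux (P Q : M) a b : \dim (<[P]> + <[Q]>) = 2%N -> a *: P + b *: Q = 0 -> a = 0.
  move=> dd e; apply/eqP; apply: contraT => a0.
  case/negP: (nl _ _ dd); apply/vlineP; exists (- (b / a)).
  apply: (scalerI a0); rewrite scalerA mulrN mulrCA divff // mulr1 scaleNr.
  by apply/eqP; rewrite -addr_eq0 e.
move=> a b e; split; first exact: (aux _ _ _ _ d e).
by rewrite addrC in e; rewrite addvC in d; exact: (aux _ _ _ _ d e).
Qed.

Lemma comm_expand (X Y Z T : M) p1 p2 p3 p4 r1 r2 r3 r4 :
  comm (p1 *: X + p2 *: Y + p3 *: Z + p4 *: T) (r1 *: X + r2 *: Y + r3 *: Z + r4 *: T) =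
  (p1 * r2 - p2 * r1) *: comm X Y + (p1 * r3 - p3 * r1) *: comm X Z +
  (p1 * r4 - p4 * r1) *: comm X T + (p2 * r3 - p3 * r2) *: comm Y Z +
  (p2 * r4 - p4 * r2) *: comm Y T + (p3 * r4 - p4 * r3) *: comm Z T.
Proof.
rewrite !commDl !commDr !commZl !commZr !commxx.
rewrite (commC Y X) (commC Z X) (commC T X) (commC Z Y) (commC T Y) (commC T Z).
move: (comm X Y) (comm X Z) (comm X T) (comm Y Z) (comm Y T) (comm Z T).
by move=> *; apply/matrixP => i j; rewrite !mxE; ring.
Qed.

Lemma coords4 (X Y Z T P : M) : P \in (<[X]> + <[Y]> + <[Z]> + <[T]>)%VS ->
  exists p1 p2 p3 p4, P = p1 *: X + p2 *: Y + p3 *: Z + p4 *: T.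
Proof.
case/add_lineP => _ /add_lineP[_ /add_lineP[_ /vlineP[p1 ->] [p2 ->]] [p3 ->]] [p4 ->].
by exists p1, p2, p3, p4.
Qed.

Lemma proportional3 (p2 p3 p4 r2 r3 r4 : C) : p2 * r3 - p3 * r2 = 0 ->
  p2 * r4 - p4 * r2 = 0 -> p3 * r4 - p4 * r3 = 0 ->
  exists a b, [/\ (a != 0) || (b != 0), a * p2 + b * r2 = 0, a * p3 + b * r3 = 0
    & a * p4 + b * r4 = 0].
Proof.
move=> /eqP; rewrite subr_eq0 => /eqP e1 /eqP; rewrite subr_eq0 => /eqP e2.
move=> /eqP; rewrite subr_eq0 => /eqP e3.
have [p20|p20] := eqVneq p2 0; last first.
  by exists r2, (- p2); rewrite oppr_eq0 p20 orbT; split=> //; rewrite ?(mulNr, e1, e2); ring.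
have [p30|p30] := eqVneq p3 0; last first.
  by exists r3, (- p3); rewrite oppr_eq0 p30 orbT; split=> //; rewrite ?mulNr -?e1 ?e3; ring.
have [p40|p40] := eqVneq p4 0; last first.
  by exists r4, (- p4); rewrite oppr_eq0 p40 orbT; split=> //; rewrite ?mulNr -?e2 -?e3; ring.
by exists 1, 0; rewrite oner_eq0 p20 p30 p40; split=> //; ring.
Qed.

(** Columns 3 and 4 of the 2 by 4 matrix are parallel to both columns 1 and 2. If the latter are
    independent, columns 3 and 4 vanish, and symmetrically; otherwise the rows are dependent. *)
Lemma cross_minors (p1 p2 p3 p4 r1 r2 r3 r4 : C) :
  p1 * r3 - p3 * r1 = 0 -> p1 * r4 - p4 * r1 = 0 ->
  p2 * r3 - p3 * r2 = 0 -> p2 * r4 - p4 * r2 = 0 ->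
  [\/ [/\ p1 = 0, p2 = 0, r1 = 0 & r2 = 0], [/\ p3 = 0, p4 = 0, r3 = 0 & r4 = 0] |
   exists a b, [/\ (a != 0) || (b != 0), a * p1 + b * r1 = 0, a * p2 + b * r2 = 0,
      a * p3 + b * r3 = 0 & a * p4 + b * r4 = 0]].
Proof.
have red (s1 s2 s3 s4 t1 t2 t3 t4 : C) : s1 != 0 ->
  s1 * t3 - s3 * t1 = 0 -> s1 * t4 - s4 * t1 = 0 ->
  s2 * t3 - s3 * t2 = 0 -> s2 * t4 - s4 * t2 = 0 ->
  [/\ s3 = 0, s4 = 0, t3 = 0 & t4 = 0] \/
  [/\ t1 * s2 + (- s1) * t2 = 0, t1 * s3 + (- s1) * t3 = 0 & t1 * s4 + (- s1) * t4 = 0].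
  move=> s10 e1 e2 e3 e4.
  have [h|h] := eqVneq (t1 * s2 - s1 * t2) 0.
    right; split; first by rewrite mulNr.
      by rewrite -[RHS]oppr0 -e1; ring.
    by rewrite -[RHS]oppr0 -e2; ring.
  left; have z3 : s3 = 0.
    apply: (mulIf h); rewrite mul0r.
    transitivity (s1 * (s2 * t3 - s3 * t2) * -1 * -1 - s2 * (s1 * t3 - s3 * t1)); first by ring.
    by rewrite e1 e3; ring.
  have z4 : s4 = 0.
    apply: (mulIf h); rewrite mul0r.
    transitivity (s1 * (s2 * t4 - s4 * t2) * -1 * -1 - s2 * (s1 * t4 - s4 * t1)); first by ring.
    by rewrite e2 e4; ring.
  split=> //; apply: (mulfI s10); rewrite mulr0.
    by move: e1; rewrite z3 mul0r subr0.
  by move: e2; rewrite z4 mul0r subr0.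
move=> e1 e2 e3 e4.
have [p10|p10] := eqVneq p1 0; last first.
  have [h|[h1 h2 h3]] := red _ _ _ _ _ _ _ _ p10 e1 e2 e3 e4; first by constructor 2.
  by constructor 3; exists r1, (- p1); rewrite oppr_eq0 p10 orbT; split=> //; ring.
have [p20|p20] := eqVneq p2 0; last first.
  have [h|[h1 h2 h3]] := red _ _ _ _ _ _ _ _ p20 e3 e4 e1 e2; first by constructor 2.
  by constructor 3; exists r2, (- p2); rewrite oppr_eq0 p20 orbT; split=> //; ring.
have [p30|p30] := eqVneq p3 0.
  have [p40|p40] := eqVneq p4 0.
    constructor 3; exists 1, 0; rewrite oner_eq0 p10 p20 p30 p40; split=> //; ring.
  constructor 1; split=> //; apply: (mulfI p40); rewrite mulr0.
    by apply/eqP; rewrite -oppr_eq0 -e2 p10 mul0r sub0r.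
  by apply/eqP; rewrite -oppr_eq0 -e4 p20 mul0r sub0r.
constructor 1; split=> //; apply: (mulfI p30); rewrite mulr0.
  by apply/eqP; rewrite -oppr_eq0 -e1 p10 mul0r sub0r.
by apply/eqP; rewrite -oppr_eq0 -e3 p20 mul0r sub0r.
Qed.

(** This says that [S, S] has dimension at least 4. When two of the six commutators of a basis
    vanish, the other four are then independent, which is how it is used through [free4]. *)
Definition fat_comm S :=
  forall T, (forall X Y, X \in S -> Y \in S -> comm X Y \in T) -> (4 <= \dim T)%N.

(* The commutator identifies W1 (x) W2 with [S, S], and w1 (x) w2' = w1' (x) w2 forces proportionality. *)
Lemma disjoint_planes S W1 W2 : fat_comm S -> \dim S = 4%N ->
  abelian_plane S W1 -> abelian_plane S W2 -> (W1 :&: W2)%VS = 0%VS ->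
  forall W, abelian_plane S W -> W = W1 \/ W = W2.
Proof.
move=> fS dS [s1 a1 d1] [s2 a2 d2] dj W [sW aW dW].
have [X [Y e1]] := plane_basis d1; have [Z [T e2]] := plane_basis d2.
have [P [Q eW]] := plane_basis dW.
have eS : S = (<[X]> + <[Y]> + <[Z]> + <[T]>)%VS.
  apply/esym/eqP; rewrite -addvA -e1 -e2 eqEdim subv_add s1 s2 /=.
  by rewrite dimv_disjoint_sum // d1 d2 dS.
have cXY : comm X Y = 0.
  by apply/comm_eq0/a1; rewrite e1 ?mem_line_addl ?mem_line_addr.
have cZT : comm Z T = 0.
  by apply/comm_eq0/a2; rewrite e2 ?mem_line_addl ?mem_line_addr.
have fr := @free4 (comm X Z) (comm X T) (comm Y Z) (comm Y T).
have {}fr := fr (fS _ _); have {}fr : forall a b d e, a *: comm X Z + b *: comm X T +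
    d *: comm Y Z + e *: comm Y T = 0 -> [/\ a = 0, b = 0, d = 0 & e = 0].
  apply: fr => A B; rewrite eS => /coords4[p1 [p2 [p3 [p4 ->]]]] /coords4[r1 [r2 [r3 [r4 ->]]]].
  rewrite comm_expand cXY cZT !scaler0 add0r addr0.
  by rewrite !memv_add ?memvZ ?memv_line.
have inS A : A \in W -> exists p1 p2 p3 p4, A = p1 *: X + p2 *: Y + p3 *: Z + p4 *: T.
  by move=> AW; apply: coords4; rewrite -eS (subvP sW).
have PW : P \in W by rewrite eW mem_line_addl.
have QW : Q \in W by rewrite eW mem_line_addr.
have [p1 [p2 [p3 [p4 eP]]]] := inS P PW; have [r1 [r2 [r3 [r4 eQ]]]] := inS Q QW.
have /comm_eq0 := aW P Q PW QW.
rewrite {1}eP {1}eQ comm_expand cXY cZT !scaler0 add0r addr0 => /fr[m1 m2 m3 m4].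
have ind := dW; rewrite eW in ind; move/plane_indep: ind => ind.
have close W' : W' = W1 \/ W' = W2 -> P \in W' -> Q \in W' -> W = W'.
  move=> hW' PW' QW'; apply/eqP; rewrite eqEdim dW.
  by rewrite {1}eW subv_add -!memvE PW' QW'; case: hW' => ->; rewrite ?d1 ?d2.
have [[z1 z2 z3 z4]|[z1 z2 z3 z4]|[a [b [ab f1 f2 f3 f4]]]] := cross_minors m1 m2 m3 m4.
- right; rewrite z1 z2 !scale0r !add0r in eP; rewrite z3 z4 !scale0r !add0r in eQ.
  by apply: close; [right|rewrite eP e2 memv_add ?memvZ ?memv_line|rewrite eQ e2 memv_add ?memvZ ?memv_line].
- left; rewrite z1 z2 !scale0r !addr0 in eP; rewrite z3 z4 !scale0r !addr0 in eQ.
  by apply: close; [left|rewrite eP e1 memv_add ?memvZ ?memv_line|rewrite eQ e1 memv_add ?memvZ ?memv_line].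
have [|a0 b0] := ind a b; last by move: ab; rewrite a0 b0 eqxx.
rewrite eP eQ !scalerDr !scalerA.
rewrite [LHS](_ : _ = (a * p1 + b * r1) *: X + (a * p2 + b * r2) *: Y +
   (a * p3 + b * r3) *: Z + (a * p4 + b * r4) *: T).
  by rewrite f1 f2 f3 f4 !scale0r !addr0.
by apply/matrixP => i j; rewrite !mxE; ring.
Qed.

(** In a basis X, Y, Z, T adapted to the two planes, [X, Y] = [X, Z] = 0 and the other four
    commutators are independent. So for a basis P, Q of W the minors avoiding the X-coordinate
    vanish: P and Q are dependent modulo X, and W contains X. *)
Lemma meeting_planes S W1 W2 X : fat_comm S -> \dim S = 4%N ->
  abelian_plane S W1 -> abelian_plane S W2 -> W1 != W2 -> X != 0 -> X \in W1 -> X \in W2 ->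
  forall W, abelian_plane S W -> X \in W.
Proof.
move=> fS dS [s1 a1 d1] [s2 a2 d2] n12 X0 X1 X2 W [sW aW dW].
have [||Y e1] := @extend_line W1 <[X]>; first by rewrite -memvE.
  by rewrite d1 dim_vline X0.
have [||Z e2] := @extend_line W2 <[X]>; first by rewrite -memvE.
  by rewrite d2 dim_vline X0.
have d3 : \dim (<[X]> + <[Y]> + <[Z]>) = 3%N.
  rewrite -e1 dim_add_line ?d1 //; apply: contra n12 => Z1.
  by rewrite eq_sym eqEdim d1 d2 leqnn andbT e2 subv_add -!memvE X1 Z1.
have [||T eS] := @extend_line S (<[X]> + <[Y]> + <[Z]>).
- have YS : Y \in S by rewrite (subvP s1) // e1 mem_line_addr.
  have ZS : Z \in S by rewrite (subvP s2) // e2 mem_line_addr.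
  by rewrite !subv_add -!memvE (subvP s1) // YS ZS.
- by rewrite dS d3.
have [P [Q eW]] := plane_basis dW.
have cXY : comm X Y = 0.
  by apply/comm_eq0/a1; rewrite // e1 mem_line_addr.
have cXZ : comm X Z = 0.
  by apply/comm_eq0/a2; rewrite // e2 mem_line_addr.
have fr := @free4 (comm X T) (comm Y Z) (comm Y T) (comm Z T).
have {}fr := fr (fS _ _); have {}fr : forall a b d e, a *: comm X T + b *: comm Y Z +
    d *: comm Y T + e *: comm Z T = 0 -> [/\ a = 0, b = 0, d = 0 & e = 0].
  apply: fr => A B; rewrite eS => /coords4[p1 [p2 [p3 [p4 ->]]]] /coords4[r1 [r2 [r3 [r4 ->]]]].
  rewrite comm_expand cXY cXZ !scaler0 !add0r.
  by rewrite !memv_add ?memvZ ?memv_line.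
have inS A : A \in W -> exists p1 p2 p3 p4, A = p1 *: X + p2 *: Y + p3 *: Z + p4 *: T.
  by move=> AW; apply: coords4; rewrite -eS (subvP sW).
have PW : P \in W by rewrite eW mem_line_addl.
have QW : Q \in W by rewrite eW mem_line_addr.
have [p1 [p2 [p3 [p4 eP]]]] := inS P PW; have [r1 [r2 [r3 [r4 eQ]]]] := inS Q QW.
have /comm_eq0 := aW P Q PW QW.
rewrite {1}eP {1}eQ comm_expand cXY cXZ !scaler0 !add0r => /fr[_ m1 m2 m3].
have ind := dW; rewrite eW in ind; move/plane_indep: ind => ind.
have [a [b [ab f2 f3 f4]]] := proportional3 m1 m2 m3.
have e : a *: P + b *: Q = (a * p1 + b * r1) *: X.
  rewrite eP eQ !scalerDr !scalerA.
  rewrite [LHS](_ : _ = (a * p1 + b * r1) *: X + (a * p2 + b * r2) *: Y +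
     (a * p3 + b * r3) *: Z + (a * p4 + b * r4) *: T).
    by rewrite f2 f3 f4 !scale0r !addr0.
  by apply/matrixP => i j; rewrite !mxE; ring.
have [s0|s0] := eqVneq (a * p1 + b * r1) 0.
  have [|a0 b0] := ind a b; first by rewrite e s0 scale0r.
  by move: ab; rewrite a0 b0 eqxx.
by rewrite -[X](scalerK s0) -e memvZ // memvD ?memvZ.
Qed.

End Dim4Classification.

(** * Invariant spaces of dimension 4 *)

Section Dim4Conclusion.
Variables (C : numClosedFieldType) (omega : C).
Hypothesis omega_root : 1 + omega + omega ^+ 2 = 0.
Hypothesis omega_conj : omega^* = omega ^+ 2.
Local Notation M := 'M[C]_3.
Implicit Types (X Y Z u : M) (S T W : {vspace M}) (G : M -> Prop).
Local Notation vt2 := (vt2 C).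
Local Notation vt8 := (vt8 C).
Local Notation vt4 := (vt4 omega).

Definition derived S : {vspace M} := <<[seq comm x y | x <- vbasis S, y <- vbasis S]>>%VS.

Lemma mem_derived S X Y : X \in S -> Y \in S -> comm X Y \in derived S.
Proof.
move=> /coord_vbasis -> /coord_vbasis ->; rewrite comm_suml.
apply: memv_suml => i _; rewrite memvZ // comm_sumr.
apply: memv_suml => j _; rewrite memvZ // memv_span //.
by apply: allpairs_f; apply: mem_nth; rewrite size_tuple.
Qed.

Lemma derived_min S T : (forall X Y, X \in S -> Y \in S -> comm X Y \in T) ->
  (derived S <= T)%VS.
Proof.
move=> h; apply/span_subvP => _ /allpairsP[[X Y] /= [XS YS ->]].
by apply: h; apply: vbasis_mem.
Qed.

(** The adjoint is only conjugate-linear, so this space is built as a span and not as the image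
    under a linear map. *)
Definition adjv S : {vspace M} := <<[seq X^t* | X <- vbasis S]>>%VS.

Lemma adj_mem_adjv S X : X \in S -> X^t* \in adjv S.
Proof.
move=> /coord_vbasis ->; rewrite adj_sum; apply: memv_suml => i _.
rewrite adjZ memvZ // memv_span //; apply/mapP; exists (vbasis S)`_i => //.
by apply: mem_nth; rewrite size_tuple.
Qed.

Lemma mem_adjv S X : (X \in adjv S) = (X^t* \in S).
Proof.
have aux T Y : Y \in adjv T -> Y^t* \in T.
  move=> YT; rewrite (@coord_span _ _ _ (in_tuple _) Y YT) adj_sum.
  apply: memv_suml => i _; rewrite adjZ memvZ //.
  have : (in_tuple [seq X^t* | X <- vbasis T])`_i \in [seq X^t* | X <- vbasis T].
    exact: mem_nth.
  by case/mapP => Z ZT ->; rewrite adjK vbasis_mem.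
by apply/idP/idP => [/aux //|/adj_mem_adjv]; rewrite adjK.
Qed.

Lemma dim_adjv S : \dim (adjv S) = \dim S.
Proof.
have le T : (\dim (adjv T) <= \dim T)%N.
  by rewrite (leq_trans (dim_span _)) // size_map size_tuple.
apply/eqP; rewrite eqn_leq le /= -{1}(_ : adjv (adjv S) = S) ?le //.
by apply/vspaceP => X; rewrite !mem_adjv adjK.
Qed.

Lemma planes_adjv S W : sdj S -> abelian_plane S W -> abelian_plane S (adjv W).
Proof.
move=> sS [sW aW dW]; split; last by rewrite dim_adjv.
  by apply/subvP => X; rewrite mem_adjv => /(subvP sW)/sS; rewrite adjK.
move=> X Y; rewrite !mem_adjv => XW YW.
by apply: (can_inj (@adjK C 3)); rewrite !adjM (aW _ _ XW YW).
Qed.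

Lemma planes_conjv G S W u : irred G -> ginv G S -> G u -> abelian_plane S W -> abelian_plane S (conjv u W).
Proof.
move=> iG GS hu [sW aW dW]; have [Gu _ _] := iG; have hu' := Gu u hu.
split; last by rewrite dim_conjv.
  by rewrite -(ginv_conjv iG GS hu) conjvS.
move=> X Y; rewrite !conjvP // => XW YW.
by rewrite -(mxconjVK X hu') -(mxconjVK Y hu') -!(mxconjM _ _ hu') aW.
Qed.

(** [plane_normal] supplies the self-adjointness of W that [split4] asks for: W is conjugate to the
    diagonal plane. *)
Lemma plane_split4 G S W : irred G -> ginv G S -> sdj S -> trless S -> \dim S = 4%N ->
  abelian_plane S W -> ginv G W -> qg_iso S vt4.
Proof.
move=> iG GS sS tS dS [sW aW dW] GW.
have tW : trless W by move=> X /(subvP sW)/tS.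
have [P hP eP] := plane_normal iG GW dW aW tW.
have sjW : sdj W.
  by rewrite -(conjvK W hP) eP; apply: sdj_conjv; [exact: unitary_adj|exact: sdj_vt2].
exact: (split4 omega_root omega_conj iG GS sS tS dS GW sjW sW dW).
Qed.

Lemma fat_dim4_iso G S : irred G -> (forall u v, G u -> G v -> G (u *m v)) ->
  ginv G S -> sdj S -> trless S -> \dim S = 4%N -> fat_comm S ->
  (\dim (derived S) <= 4)%N -> qg_iso S vt4.
Proof.
move=> iG GM GS sS tS dS fS dI; have [Gu Ga _] := iG.
have [W pW] : exists W, abelian_plane S W.
  have := onb_exists S; rewrite dS => -[A hA].
  by apply: plane_exists hA _ dI => X Y; exact: mem_derived.
have [sW aW dW] := pW.
have [inv|/existsNP[h /not_implyP[Gh /eqP nh]]] := EM (forall u, G u -> conjv u W = W).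
  apply: (plane_split4 iG GS sS tS dS pW) => u X hu XW.
  by rewrite -(inv u hu) mem_conjv.
pose W2 := conjv h W; have pW2 : abelian_plane S W2 := planes_conjv iG GS Gh pW.
(* If W and its translate meet in 0 there is no third plane, and the elements preserving W form a
   subgroup of index 2; otherwise all the planes share a line. *)
have [dj|ndj] := eqVneq (W :&: W2)%VS 0%VS.
  have only := disjoint_planes fS dS pW pW2 dj.
  pose K u := G u /\ conjv u W = W.
  have conjV u : G u -> conjv u W = W -> conjv (u^t* ) W = W.
    by move=> hu e; rewrite -{1}e conjvK // Gu.
  have W2_to_W u : G u -> conjv u W = W2 -> conjv (h^t* *m u) W = W.
    by move=> hu e; rewrite -conjv_comp e conjvK // Gu.
  have to_W2 u : G u -> conjv u W != W -> conjv u W = W2.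
    by move=> hu /eqP ne; case: (only _ (planes_conjv iG GS hu pW)).
  have fix_W2 u : G u -> conjv u W = W -> conjv u W2 = W2.
    move=> hu e; case: (only _ (planes_conjv iG GS hu pW2)) => // e2.
    by case/eqP: nh; rewrite -[LHS](conjvK _ (Gu u hu)) e2 conjV.
  have hW2 : conjv h W2 = W.
    case: (only _ (planes_conjv iG GS Gh pW2)) => // e2.
    by case/eqP: nh; rewrite -[RHS](conjvK _ (Gu h Gh)) -/W2 -{2}e2 conjvK // Gu.
  have iK : irred K.
    apply: (index2_irred iG (h := h)) => //.
    - by move=> u [].
    - by move=> u [hu e]; split; [exact: Ga|exact: conjV].
    - move=> u [hu e]; split; first by do 2!apply: (GM) => //; exact: Ga.
      by rewrite -!conjv_comp -/W2 fix_W2 // conjvK // Gu.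
    - by split; [exact: GM|rewrite -conjv_comp].
    - move=> u hu; have [e|ne] := eqVneq (conjv u W) W; first by left.
      right; split; first by apply: GM => //; exact: Ga.
      by apply: W2_to_W => //; exact: to_W2.
  apply: (plane_split4 iK _ sS tS dS pW) => u X [hu e] XW; first exact: GS.
  by rewrite -e mem_conjv.
(* G and the adjoint permute the commutative planes of S, so the line common to all of them is
   invariant and self-adjoint, hence zero. *)
pose X := vpick (W :&: W2)%VS.
have /memv_capP[XW XW2] : X \in (W :&: W2)%VS by exact: memv_pick.
have X0 : X != 0 by rewrite vpick0.
have nW : W != W2 by rewrite eq_sym.
have inall := meeting_planes fS dS pW pW2 nW X0 XW XW2.
have line Y : Y \in W -> Y \in W2 -> exists c, Y = c *: X.
  move=> YW YW2; apply/vlineP.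
  have -> : <[X]>%VS = (W :&: W2)%VS.
    apply/eqP; rewrite eqEdim -memvE memv_cap XW XW2 dim_vline X0 /=.
    have le : (\dim (W :&: W2) <= 2)%N by rewrite -[leqRHS]dW dimvS // capvSl.
    rewrite leqNgt; apply: contra nW => gt1.
    have e : \dim (W :&: W2) = 2%N by apply/eqP; rewrite eqn_leq le.
    have [_ _ dW2] := pW2.
    have e1 : (W :&: W2)%VS = W by apply/eqP; rewrite eqEdim capvSl dW e.
    have e2 : (W :&: W2)%VS = W2 by apply/eqP; rewrite eqEdim capvSr dW2 e.
    by rewrite -{1}e1 e2.
  by rewrite memv_cap YW.
case/eqP: X0; apply: (invariant_line_eq0 iG); first by apply: tS; exact: (subvP sW).
  move=> u hu; have hu' := Gu u hu; have Gua := Ga u hu.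
  have t V : abelian_plane S V -> mxconj u X \in V.
    move=> pV; have := inall _ (planes_conjv iG GS Gua pV).
    by rewrite conjvP ?unitary_adj // adjK.
  by apply: line; exact: t.
by apply: line; rewrite -[_ \in _]mem_adjv; apply: inall; exact: planes_adjv.
Qed.

(** The cases are the dimensions of I = [S, S]. 0: S would be commutative, hence of dimension at
    most 2. 1: I is an invariant line. 2: I splits the complement S' of S, which is then conjugate
    to [vt4], and so is S by [vt4_compl]. 3: the complement of I in S' is an invariant line. 4:
    [fat_dim4_iso]. *)
Lemma dim4_iso G S : irred G -> (forall u v, G u -> G v -> G (u *m v)) ->
  ginv G S -> sdj S -> trless S -> \dim S = 4%N -> qg_iso S vt4.
Proof.
move=> iG GM GS sS tS dS; have [Gu Ga _] := iG.
have S8 : (S <= vt8)%VS by exact/trless_sub.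
pose S' := orthv vt8 S; pose I := derived S.
have dS' : \dim S' = 4%N by rewrite dim_orthv // dim_vt8 dS.
have G8 : ginv G vt8 by move=> u X hu /VT8P t; apply/VT8P; rewrite mxconj_tr // Gu.
have GS' : ginv G S' by exact: ginv_orthv.
have sS' : sdj S' by apply: sdj_orthv => //; exact: sdj_vt8.
have tS' : trless S' by apply/trless_sub; exact: capvSl.
have IS' : (I <= S')%VS.
  apply: derived_min => X Y XS YS; apply/orthvP; split.
    by apply/VT8P; exact: comm_tr.
  move=> Z ZS; have := dim4_vol iG GS sS tS dS XS YS (sS Z ZS).
  by rewrite /vol /hs mxtrace_mulC.
have dI : (\dim I <= 4)%N by rewrite -dS' dimvS.
have tI : trless I by move=> X /(subvP IS')/tS'.
have GI : ginv G I.
  move=> u X hu; have : (I <= linfun (mxconj u) @^-1: I)%VS.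
    apply: derived_min => Y Z YS ZS; rewrite -memv_preim lfunE /= mxconj_comm ?Gu //.
    by apply: mem_derived; apply: GS.
  by move/subvP/(_ X) => h /h; rewrite -memv_preim lfunE.
have sI : sdj I.
  have : (I <= adjv I)%VS.
    apply: derived_min => Y Z YS ZS; rewrite mem_adjv comm_adj.
    by apply: mem_derived; apply: sS.
  by move/subvP => h X /h; rewrite mem_adjv.
case E : (\dim I) dI => [|[|[|[|[|//]]]]] _.
- have I0 : I = 0%VS by apply/eqP; rewrite -dimv_eq0 E.
  have aS : abelian S.
    move=> X Y XS YS; apply/comm_eq0/eqP; rewrite -memv0 -I0; exact: mem_derived.
  by have := abelian_dim sS tS aS; rewrite dS.
- by have := no_invariant_line iG GI sI tI; rewrite E.
- have := split4 omega_root omega_conj iG GS' sS' tS' dS' GI sI IS' E.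
  move/qg_iso_compl; rewrite orthvK // => /qg_iso_trans; apply.
  exact: vt4_compl.
- have d1 : \dim (orthv S' I) = 1%N by rewrite dim_orthv // dS' E.
  have := no_invariant_line iG (ginv_orthv iG GS' GI) (sdj_orthv sS' sI).
  rewrite d1 => /(_ _)/eqP; case=> // X /orthvP[XS' _]; exact: tS'.
apply: (fat_dim4_iso iG GM GS sS tS dS); last by rewrite -/I E.
by move=> T /derived_min /dimvS; rewrite -/I E.
Qed.

End Dim4Conclusion.

(** * Dimension 3 *)

Section Cubic.
Variable C : numClosedFieldType.
Local Notation M := 'M[C]_3.
Implicit Types (X Y Z u : M) (S T W : {vspace M}) (G : M -> Prop).

(** The symmetric trilinear form whose value at X, X, X is 2 tr(X^3). *)
Definition tri X Y Z : C^o := \tr (X *m (Y *m Z + Z *m Y)).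

Lemma triC X Y Z : tri X Y Z = tri X Z Y.
Proof. by rewrite /tri addrC. Qed.
Lemma tri_cycle X Y Z : tri X Y Z = tri Y Z X.
Proof.
rewrite /tri !mulmxDr !mxtraceD; congr (_ + _).
  by rewrite mxtrace_mulC -mulmxA.
by rewrite mulmxA mxtrace_mulC.
Qed.
Fact tri_is_linear X Y : linear (tri X Y).
Proof.
move=> k Z Z'; rewrite /tri !(mulmxDr, mulmxDl).
by rewrite -!(scalemxAr, scalemxAl) !mxtraceD !mxtraceZ addrACA scalerDr.
Qed.
HB.instance Definition _ X Y := GRing.isLinear.Build C M C^o *:%R (tri X Y) (tri_is_linear X Y).
Lemma triDl X X' Y Z : tri (X + X') Y Z = tri X Y Z + tri X' Y Z.
Proof. by rewrite ![tri _ Y Z]tri_cycle linearD. Qed.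
Lemma triZl k X Y Z : tri (k *: X) Y Z = k * tri X Y Z.
Proof. by rewrite ![tri _ Y Z]tri_cycle linearZ. Qed.
Lemma triDm X Y Y' Z : tri X (Y + Y') Z = tri X Y Z + tri X Y' Z.
Proof. by rewrite ![tri X _ Z]triC linearD. Qed.
Lemma triZm k X Y Z : tri X (k *: Y) Z = k * tri X Y Z.
Proof. by rewrite ![tri X _ Z]triC linearZ. Qed.
Lemma triDr X Y Z Z' : tri X Y (Z + Z') = tri X Y Z + tri X Y Z'.
Proof. exact: linearD. Qed.
Lemma triZr k X Y Z : tri X Y (k *: Z) = k * tri X Y Z.
Proof. exact: linearZ. Qed.
Lemma tri_adj X Y Z : tri (X^t* ) (Y^t* ) (Z^t* ) = (tri X Y Z)^*.
Proof.
rewrite /tri -tr_adj adjM adjD !adjM mxtrace_mulC; congr (\tr (_ *m _)).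
by rewrite addrC.
Qed.
Lemma tri_mxconj u X Y Z : u \is unitarymx ->
  tri (mxconj u X) (mxconj u Y) (mxconj u Z) = tri X Y Z.
Proof. by move=> hu; rewrite /tri -!mxconjM // -linearD -mxconjM // mxconj_tr. Qed.

Definition contr d (A : 'I_d -> M) X Y : C^o :=
  \sum_k \sum_l tri X (A k) (A l) * tri Y (A k) (A l).

Lemma contrC d (A : 'I_d -> M) X Y : contr A X Y = contr A Y X.
Proof. by apply: eq_bigr => k _; apply: eq_bigr => l _; rewrite mulrC. Qed.

Fact contr_is_linear d (A : 'I_d -> M) X : linear (contr A X).
Proof.
move=> k Y Z; rewrite /contr scaler_sumr -big_split; apply: eq_bigr => i _ /=.
rewrite scaler_sumr -big_split; apply: eq_bigr => j _ /=.
by rewrite triDl triZl mulrDr mulrCA.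
Qed.
HB.instance Definition _ d (A : 'I_d -> M) X :=
  GRing.isLinear.Build C M C^o *:%R (contr A X) (contr_is_linear A X).

Lemma contr_lin d (A : 'I_d -> M) X k Y Z :
  contr A X (k *: Y + Z) = k * contr A X Y + contr A X Z.
Proof. exact: contr_is_linear. Qed.

(** [casimir] is applied to each summation index in turn; hermitian bases identify these
    adjoint-free sums with the ones it treats. *)
Lemma contr_basis d S (A B : 'I_d -> M) X Y : hermbasis S A -> hermbasis S B ->
  contr A X Y = contr B X Y.
Proof.
move=> [oA hA] [oB hB].
transitivity (\sum_k \sum_l tri X (B k) (A l) * tri Y (B k) (A l)).
  have := @casimir C 3 C^o
    (fun P Q => \sum_l tri X P (A l) * tri Y Q (A l)) d S A B _ _ oA oB.
  under eq_bigr do rewrite hA; under [in RHS]eq_bigr do rewrite hB.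
  apply.
  - move=> Q k P P'; rewrite scaler_sumr -big_split; apply: eq_bigr => l _ /=.
    by rewrite triDm triZm mulrDl -mulrA.
  - move=> Q k P P'; rewrite scaler_sumr -big_split; apply: eq_bigr => l _ /=.
    by rewrite triDm triZm mulrDr mulrCA.
apply: eq_bigr => k _.
have := @casimir C 3 C^o
  (fun P Q => tri X (B k) P * tri Y (B k) Q) d S A B _ _ oA oB.
under eq_bigr do rewrite hA; under [in RHS]eq_bigr do rewrite hB.
apply.
- by move=> Q c P P' /=; rewrite triDr triZr mulrDl -mulrA.
- by move=> Q c P P' /=; rewrite triDr triZr mulrDr mulrCA.
Qed.

Lemma contr_mxconj d G S (A : 'I_d -> M) u X Y : irred G -> ginv G S -> G u ->
  hermbasis S A -> contr A (mxconj u X) (mxconj u Y) = contr A X Y.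
Proof.
move=> iG GS hu hA; have [Gu Ga _] := iG; have hu' := Gu u hu.
have hB := hermbasis_mxconj hu' hA; rewrite (ginv_conjv iG GS hu) in hB.
rewrite (contr_basis _ _ hA hB); apply: eq_bigr => k _; apply: eq_bigr => l _.
by rewrite !tri_mxconj.
Qed.

Lemma contr_adj d S (A : 'I_d -> M) X Y : hermbasis S A ->
  contr A (X^t* ) (Y^t* ) = (contr A X Y)^*.
Proof.
move=> [_ hA]; rewrite /contr rmorph_sum; apply: eq_bigr => k _ /=.
rewrite rmorph_sum; apply: eq_bigr => l _ /=.
by rewrite rmorphM /= -!tri_adj !hA.
Qed.

(* An eigenspace of the contracted form is an invariant subspace of S, hence all of S. *)
Lemma dim3_contr G S (A : 'I_3 -> M) : irred G -> ginv G S -> sdj S -> trless S ->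
  hermbasis S A -> exists c, forall X Y, X \in S -> Y \in S -> contr A X Y = c * \tr (X *m Y).
Proof.
move=> iG GS sS tS hA; have [[AS Ao Ag] hh] := hA; have [Gu Ga _] := iG.
have d3 := onb_dim hA.1.
have trC X Y : \tr (X *m Y) = hs (X^t* ) Y by rewrite /hs adjK.
have [|c /eigenvalueP [v vm v0]] := @eigenvalue_closed C 3 (\matrix_(i, j) contr A (A i) (A j)).
  by [].
pose L X : M := \sum_j (contr A (A j) X - c * \tr (A j *m X)) *: A j.
have Ll : linear L.
  move=> k X Y; rewrite /L scaler_sumr -big_split; apply: eq_bigr => j _ /=.
  rewrite contr_lin mulmxDr -scalemxAr mxtraceD mxtraceZ scalerA -scalerDl.
  by congr (_ *: _); ring.
pose LL : {linear M -> M} := HB.pack L (GRing.isLinear.Build _ _ _ _ L Ll).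
pose E := (S :&: lker (linfun LL))%VS.
have EP X : X \in E <-> X \in S /\ forall Y, Y \in S -> contr A X Y = c * \tr (X *m Y).
  rewrite memv_cap memv_ker lfunE /=; split=> [/andP[XS /eqP L0]|[XS h]]; last first.
    rewrite XS /= /L big1 // => j _.
    by rewrite contrC h ?AS // mxtrace_mulC subrr scale0r.
  split=> // Y YS; have e j : contr A (A j) X = c * \tr (A j *m X).
    apply/eqP; rewrite -subr_eq0; have := congr1 (hs (A j)) L0.
    rewrite linear0 linear_sum (bigD1 j) //= hsZr Ao eqxx mulr1 big1 ?addr0 => [-> //|l lj].
    by rewrite hsZr Ao eq_sym (negbTE lj) mulr0.
  rewrite (Ag _ YS) linear_sum mulmx_sumr raddf_sum /= mulr_sumr; apply: eq_bigr => j _.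
  by rewrite linearZ /= contrC e -scalemxAr mxtraceZ mulrCA mxtrace_mulC.
have ES : (E <= S)%VS by exact: capvSl.
have [X XE X0] : exists2 X, X \in E & X != 0.
  exists (\sum_i v 0 i *: A i); last first.
    apply: contra v0 => /eqP e; apply/eqP/rowP => i; rewrite mxE.
    have := congr1 (hs (A i)) e; rewrite linear0 linear_sum (bigD1 i) //=.
    rewrite hsZr Ao eqxx mulr1 big1 ?addr0 // => l li.
    by rewrite hsZr Ao eq_sym (negbTE li) mulr0.
  rewrite memv_cap memv_ker lfunE /= memv_suml => [|i _]; last by rewrite memvZ.
  apply/eqP; apply: big1 => j _.
  have /rowP/(_ j) := vm; rewrite !mxE => e.
  rewrite linear_sum mulmx_sumr raddf_sum /= [X in c * X](_ : _ = v 0 j); last first.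
    rewrite (bigD1 j) //= -scalemxAr mxtraceZ trC hh Ao eqxx mulr1 big1 ?addr0 // => l lj.
    by rewrite -scalemxAr mxtraceZ trC hh Ao eq_sym (negbTE lj) mulr0.
  rewrite -e (eq_bigr (fun i => v 0 i * (\matrix_(i, j) contr A (A i) (A j)) i j)) ?subrr ?scale0r //.
  by move=> i _; rewrite linearZ /= mxE contrC.
(* Testing an eigenvector against its own adjoint shows that the eigenvalue is real, which makes the
   eigenspace self-adjoint. *)
have cr : c^* = c.
  have [XS h] := (EP X).1 XE; have hX : hs X X != 0 by apply: contra X0 => /eqP/hs_eq0 ->.
  apply: (mulIf hX); have := h _ (sS _ XS); rewrite mxtrace_mulC -/(hs X X) => e.
  by have := contr_adj X (X^t* ) hA; rewrite adjK contrC e rmorphM /= -hsC => <-.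
have GE : ginv G E.
  move=> u Y hu /EP[YS h]; apply/EP; split; first exact: GS.
  move=> Z ZS; have hu' := Gu u hu; rewrite -(mxconjVK Z hu') (contr_mxconj _ _ iG GS hu hA).
  by rewrite h -?mxconjM ?mxconj_tr //; apply: GS => //; exact: Ga.
have sE : sdj E.
  move=> Y /EP[YS h]; apply/EP; split; first exact: sS.
  move=> Z ZS; rewrite -(adjK Z) (contr_adj _ _ hA) h; last exact: sS.
  by rewrite rmorphM /= cr -adjM tr_adj mxtrace_mulC.
have tE : trless E by move=> Y /(subvP ES)/tS.
have E0 : \dim E != 0%N.
  by rewrite dimv_eq0; apply: contra X0 => /eqP e; move: XE; rewrite e memv0.
have := dimvS ES; rewrite d3; case dE : (\dim E) E0 => [|[|[|[|//]]]] // _ _.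
- by have := no_invariant_line iG GE sE tE; rewrite dE.
- have := no_invariant_line iG (ginv_orthv iG GS GE) (sdj_orthv sS sE).
  rewrite dim_orthv // d3 dE => /(_ _)/eqP; case=> // Y /orthvP[YS _]; exact: tS.
have eE : E = S by apply/eqP; rewrite eqEdim ES dE d3.
by exists c => Y Z; rewrite -{1}eE => /EP[_]; apply.
Qed.

End Cubic.

(** * Real rotations and real roots inside a closed field *)

Section RealScalars.
Variable C : numClosedFieldType.
Implicit Types p q m t : C.

Lemma real_sqr_ge0 p : p^* = p -> 0 <= p ^+ 2.
Proof. by move=> hp; rewrite expr2 -{2}hp -normCK exprn_ge0. Qed.

Lemma real_sumsq_eq0 p q : p^* = p -> q^* = q -> p ^+ 2 + q ^+ 2 = 0 -> p = 0 /\ q = 0.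
Proof.
move=> hp hq /eqP; rewrite paddr_eq0 ?real_sqr_ge0 // !sqrf_eq0.
by case/andP => /eqP -> /eqP ->.
Qed.

Lemma sqrtC_real p : 0 <= p -> (sqrtC p)^* = sqrtC p.
Proof. by move=> hp; apply/CrealP; rewrite ger0_real // sqrtC_ge0. Qed.

(** (c, s) is a unit vector orthogonal to (p, q), or (1, 0) when both p and q vanish. *)
Lemma rot_lin p q : p^* = p -> q^* = q ->
  exists c s, [/\ c^* = c, s^* = s, c ^+ 2 + s ^+ 2 = 1 & c * p + s * q = 0].
Proof.
move=> hp hq; have r0 : 0 <= p ^+ 2 + q ^+ 2 by rewrite addr_ge0 ?real_sqr_ge0.
have [e|ne] := eqVneq (p ^+ 2 + q ^+ 2) 0.
  have [-> ->] := real_sumsq_eq0 hp hq e.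
  by exists 1, 0; rewrite conjC0 conjC1; split=> //; ring.
pose r := sqrtC (p ^+ 2 + q ^+ 2).
have rr : r ^+ 2 = p ^+ 2 + q ^+ 2 by rewrite sqrtCK.
have rn : r != 0 by rewrite sqrtC_eq0.
have hr : r^* = r by exact: sqrtC_real.
exists (q / r), (- p / r); split.
- by rewrite fmorph_div /= hq hr.
- by rewrite fmorph_div rmorphN /= hp hr.
- rewrite !expr_div_n sqrrN -mulrDl rr addrC divff //.
- by field.
Qed.

(** The real quadratic form m(x^2 - y^2) + 2qxy has trace 0, hence a real null direction. For m
    nonzero its slope t = s / c is a root of m(1 - t^2) + 2tq. *)
Lemma rot_quad m q : m^* = m -> q^* = q ->
  exists c s, [/\ c^* = c, s^* = s, c ^+ 2 + s ^+ 2 = 1 &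
    m * (c ^+ 2 - s ^+ 2) + 2 * c * s * q = 0].
Proof.
move=> hm hq; have [->|m0] := eqVneq m 0.
  by exists 1, 0; rewrite conjC0 conjC1; split=> //; ring.
have r0 : 0 <= q ^+ 2 + m ^+ 2 by rewrite addr_ge0 ?real_sqr_ge0.
pose r := sqrtC (q ^+ 2 + m ^+ 2).
have rr : r ^+ 2 = q ^+ 2 + m ^+ 2 by rewrite sqrtCK.
have hr : r^* = r by exact: sqrtC_real.
pose t := (q + r) / m.
have ht : t^* = t by rewrite fmorph_div rmorphD /= hq hr hm.
have tq : m * (1 - t ^+ 2) + 2 * t * q = 0.
  have -> : m * (1 - t ^+ 2) + 2 * t * q = (m ^+ 2 - r ^+ 2 + q ^+ 2) / m.
    by rewrite /t; field.
  by rewrite rr; field.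
have h1 : 0 < 1 + t ^+ 2 by rewrite ltr_pwDl ?ltr01 ?real_sqr_ge0.
pose k := sqrtC (1 + t ^+ 2).
have kk : k ^+ 2 = 1 + t ^+ 2 by rewrite sqrtCK.
have k0 : k != 0 by rewrite sqrtC_eq0 gt_eqF.
have hk : k^* = k by apply: sqrtC_real; exact: ltW.
exists k^-1, (t / k); split.
- by rewrite fmorphV /= hk.
- by rewrite fmorph_div /= ht hk.
- by rewrite exprVn expr_div_n -[X in X + _]mul1r -mulrDl kk divff ?gt_eqF.
- transitivity ((m * (1 - t ^+ 2) + 2 * t * q) / k ^+ 2); first by field.
  by rewrite tq mul0r.
Qed.

(* If a root x is not real, then neither is its conjugate, and Vieta's formula gives a real third root. *)
Lemma real_cubic_root (c0 c1 c2 c3 : C) : c0^* = c0 -> c1^* = c1 -> c2^* = c2 -> c3^* = c3 ->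
  c3 != 0 -> exists2 t, t^* = t & c0 + c1 * t + c2 * t ^+ 2 + c3 * t ^+ 3 = 0.
Proof.
move=> h0 h1 h2 h3 n3.
have [x hx] : exists x, c0 + c1 * x + c2 * x ^+ 2 + c3 * x ^+ 3 = 0.
  have [|x] := closed_rootP (Poly [:: c0; c1; c2; c3]) _.
    by rewrite (@PolyK _ 0).
  rewrite rootE horner_Poly /= => /eqP e; exists x; rewrite -[RHS]e; ring.
have [xr|xr] := eqVneq x^* x; first by exists x.
have hx' : c0 + c1 * x^* + c2 * x^* ^+ 2 + c3 * x^* ^+ 3 = 0.
  by have := congr1 (fun z => z^*) hx; rewrite /= !(rmorphD, rmorphM, rmorphXn) /= h0 h1 h2 h3 conjC0.
have d : c1 + c2 * (x + x^* ) + c3 * (x ^+ 2 + x * x^* + x^* ^+ 2) = 0.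
  apply: (@mulfI _ (x^* - x)); first by rewrite subr_eq0.
  rewrite mulr0 -[RHS](subrr 0) -{1}hx' -hx; ring.
exists (- c2 / c3 - x - x^* ).
  by rewrite !rmorphB fmorph_div rmorphN /= h2 h3 conjCK addrAC.
set y := x^* in d hx' *.
have {d}e1 : c1 = - (c2 * (x + y) + c3 * (x ^+ 2 + x * y + y ^+ 2)).
  by apply/eqP; rewrite -addr_eq0 addrA d.
have e0 : c0 = - (c1 * x + c2 * x ^+ 2 + c3 * x ^+ 3).
  by apply/eqP; rewrite -addr_eq0 !addrA hx.
by rewrite e0 e1; field.
Qed.

End RealScalars.

(** * Orthonormal triples of hermitian matrices *)

Section Frame.
Variable C : numClosedFieldType.
Local Notation M := 'M[C]_3.
Implicit Types (X Y Z u : M) (S T W : {vspace M}) (G : M -> Prop).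

Lemma orthonormal_onb d S (A : 'I_d -> M) : \dim S = d -> (forall i, A i \in S) ->
  (forall i j, hs (A i) (A j) = (i == j)%:R) -> onb S A.
Proof.
move=> dS AS Ao; pose U := (\sum_i <[A i]>)%VS.
have US : (U <= S)%VS by apply/subv_sumP => i _; rewrite -memvE.
have oU : onb U A.
  split=> // [i|X].
    by rewrite memvE /U (bigD1 i) //= addvSl.
  case/memv_sumP => k hk ->.
  have {hk} hk i : exists c, k i = c *: A i by apply/vlineP; exact: hk.
  apply: eq_bigr => i _; rewrite linear_sum (bigD1 i) //= big1 ?addr0 => [|j ji].
    by have [c ->] := hk i; rewrite hsZr Ao eqxx mulr1.
  by have [c ->] := hk j; rewrite hsZr Ao eq_sym (negbTE ji) mulr0.
have e : U = S by apply/eqP; rewrite eqEdim US dS (onb_dim oU) leqnn.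
by rewrite -e.
Qed.

Definition triple X Y Z (i : 'I_3) : M := nth 0 [:: X; Y; Z] i.

Lemma herm_triple S X Y Z : \dim S = 3%N -> [/\ X \in S, Y \in S & Z \in S] ->
  [/\ X^t* = X, Y^t* = Y & Z^t* = Z] ->
  [/\ \tr (X *m X) = 1, \tr (Y *m Y) = 1 & \tr (Z *m Z) = 1] ->
  [/\ \tr (X *m Y) = 0, \tr (Y *m Z) = 0 & \tr (X *m Z) = 0] ->
  hermbasis S (triple X Y Z).
Proof.
move=> dS [XS YS ZS] [hX hY hZ] [nX nY nZ] [oXY oYZ oXZ].
split; last by apply: forall3.
apply: orthonormal_onb => //; first exact: forall3.
do 2!apply: forall3; rewrite /hs /triple /= ?hX ?hY ?hZ //.
- by rewrite mxtrace_mulC.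
- by rewrite mxtrace_mulC.
- by rewrite mxtrace_mulC.
Qed.

(** Conjugation by G replaces the A_i by another hermitian basis, so it fixes the sum of squares. *)
Lemma hermbasis_sumsq G d S (A : 'I_d -> M) : irred G -> ginv G S -> hermbasis S A ->
  exists c, \sum_i A i *m A i = c%:M.
Proof.
move=> iG GS hA; have [Gu _ Gs] := iG; apply: Gs => u hu; have hu' := Gu u hu.
have [oB hB] := hermbasis_mxconj hu' hA; rewrite (ginv_conjv iG GS hu) in oB.
have := @casimir C 3 M (fun P Q => P *m Q) d S _ _ _ _ hA.1 oB.
under eq_bigr do rewrite hA.2; under [in RHS]eq_bigr do rewrite hB.
move=> e; rewrite [RHS]e.
- by rewrite linear_sum; apply: eq_bigr => i _; rewrite /= mxconjM.
- by move=> Y k X Z; rewrite mulmxDl scalemxAl.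
- by move=> Y k X Z; rewrite mulmxDr scalemxAr.
Qed.

End Frame.

(** * The normal form of the cubic form *)

Section FrameExists.
Variable C : numClosedFieldType.
Local Notation M := 'M[C]_3.
Implicit Types (X Y Z u : M) (S T W : {vspace M}) (G : M -> Prop).

Lemma tri_sort X Y Z :
  [/\ tri Y X Z = tri X Y Z, tri Z X Y = tri X Y Z & tri X Z Y = tri X Y Z] /\
  (tri Y Z X = tri X Y Z /\ tri Z Y X = tri X Y Z).
Proof.
have c := tri_cycle X Y Z; have c' := tri_cycle Z X Y.
split; [split|split]; first [by rewrite triC -c | by rewrite c' | by rewrite triC | by rewrite -c | by rewrite triC c'].
Qed.

Lemma tri_real X Y Z : X^t* = X -> Y^t* = Y -> Z^t* = Z -> (tri X Y Z)^* = tri X Y Z.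
Proof. by move=> hX hY hZ; rewrite -tri_adj hX hY hZ. Qed.

Lemma triXX X Y : tri X X Y = 2 * \tr (X *m X *m Y).
Proof.
rewrite /tri mulmxDr mxtraceD mulmxA [\tr (X *m (Y *m X))]mxtrace_mulC.
by rewrite -[Y *m X *m X]mulmxA [\tr (Y *m _)]mxtrace_mulC mulr_natl mulr2n.
Qed.

Lemma herm_tripleP S X Y Z : hermbasis S (triple X Y Z) ->
  [/\ [/\ X \in S, Y \in S & Z \in S], [/\ X^t* = X, Y^t* = Y & Z^t* = Z],
  [/\ \tr (X *m X) = 1, \tr (Y *m Y) = 1 & \tr (Z *m Z) = 1] &
  [/\ \tr (X *m Y) = 0, \tr (Y *m Z) = 0 & \tr (X *m Z) = 0]].
Proof.
case=> [[AS Ao _] hA].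
have hX : X^t* = X := hA i1; have hY : Y^t* = Y := hA i2; have hZ : Z^t* = Z := hA i3.
have e P Q : P^t* = P -> \tr (P *m Q) = hs P Q by move=> hP; rewrite /hs hP.
rewrite !e //; split=> //; split.
- exact: (AS i1).
- exact: (AS i2).
- exact: (AS i3).
- exact: (Ao i1 i1).
- exact: (Ao i2 i2).
- exact: (Ao i3 i3).
- exact: (Ao i1 i2).
- exact: (Ao i2 i3).
- exact: (Ao i1 i3).
Qed.

Lemma herm_rot S X Y Z c s : c^* = c -> s^* = s -> c ^+ 2 + s ^+ 2 = 1 ->
  hermbasis S (triple Z X Y) ->
  hermbasis S (triple Z (c *: X + s *: Y) (- s *: X + c *: Y)).
Proof.
move=> hc hs cs hB; have dS := onb_dim hB.1.
have [[ZS XS YS] [hZ hX hY] [nZ nX nY] [oZX oXY oZY]] := herm_tripleP hB.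
apply: herm_triple => //.
- by split=> //; rewrite memvD ?memvZ.
- by split=> //; rewrite adjD !adjZ ?rmorphN /= hX hY hc hs.
- split=> //; rewrite !mulmxDl !mulmxDr -!scalemxAl -!scalemxAr !scalerA !mxtraceD !mxtraceZ;
    rewrite nX nY [\tr (Y *m X)]mxtrace_mulC oXY -[RHS]cs; ring.
- split; rewrite ?mulmxDl !mulmxDr -?scalemxAl -!scalemxAr ?scalerA !mxtraceD !mxtraceZ;
    rewrite ?nX ?nY ?[\tr (Y *m X)]mxtrace_mulC ?oXY ?oZX ?oZY; ring.
Qed.

(** Along X + tY the cubic form is a real polynomial of degree 3 in t, which has a real root, unless
    its leading coefficient vanishes and Y itself is a zero. *)
Lemma null_vector S : sdj S -> \dim S = 3%N ->
  exists Z, [/\ Z \in S, Z^t* = Z, \tr (Z *m Z) = 1 & tri Z Z Z = 0].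
Proof.
move=> sS dS; have := hermbasis_exists sS; rewrite dS => -[A hA].
have eA : A = triple (A i1) (A i2) (A i3) by apply: funext; apply: forall3.
rewrite eA in hA; move: (A i1) (A i2) (A i3) hA => X Y Z {A eA} hA.
have [[XS YS ZS] [hX hY hZ] [nX nY nZ] [oXY oYZ oXZ]] := herm_tripleP hA.
have [y0|y0] := eqVneq (tri Y Y Y) 0; first by exists Y.
have r3 k : k^* = k -> (3 * k)^* = 3 * k :> C by move=> hk; rewrite rmorphM /= hk conjC_nat.
have [|||||t ht e] := @real_cubic_root C (tri X X X) (3 * tri X X Y) (3 * tri X Y Y) (tri Y Y Y) => //.
- exact: tri_real.
- by apply: r3; exact: tri_real.
- by apply: r3; exact: tri_real.
- exact: tri_real.
have h1 : 0 < 1 + t ^+ 2 by rewrite ltr_pwDl ?ltr01 ?real_sqr_ge0.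
pose k := (sqrtC (1 + t ^+ 2))^-1.
have kk : k ^+ 2 * (1 + t ^+ 2) = 1 by rewrite exprVn sqrtCK mulVf // gt_eqF.
have hk : k^* = k by rewrite fmorphV /= sqrtC_real // ltW.
exists (k *: (X + t *: Y)); split.
- by rewrite memvZ // memvD ?memvZ.
- by rewrite adjZ adjD adjZ hX hY ht hk.
- rewrite -scalemxAl -scalemxAr mulmxDl !mulmxDr -!scalemxAl -!scalemxAr.
  rewrite !scalerA !mxtraceZ !mxtraceD !mxtraceZ nX nY [\tr (Y *m X)]mxtrace_mulC oXY -[RHS]kk.
  ring.
rewrite triZl triZm triZr !(triDl, triDm, triDr, triZl, triZm, triZr).
have [[_ s1 s2] _] := tri_sort X X Y; have [[s3 _ _] [s4 _]] := tri_sort X Y Y.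
rewrite s1 s2 s3 s4; transitivity (k * (k * (k * (tri X X X + 3 * tri X X Y * t + 3 * tri X Y Y * t ^+ 2
  + tri Y Y Y * t ^+ 3)))); first by ring.
by rewrite e !mulr0.
Qed.

(* The hypotheses are the entries of [contr = l * trace form] in a basis z, x, y with T_zzz = T_zzy = 0. *)
Lemma harmonic_cubic_solve (m p q a b l : C) : a^* = a -> b^* = b ->
  m * b = 0 -> 2 * a * p + 3 * m * p + 2 * b * q = 0 ->
  m ^+ 2 = b ^+ 2 + (a + m) ^+ 2 -> a ^+ 2 + m ^+ 2 = (a + m) ^+ 2 ->
  [/\ a = 0, b = 0 & p = 0] \/ [/\ a = 0, b = 0 & m = 0].
Proof.
move=> ha hb e1 e2 e3 e4; have [m0|m0] := eqVneq m 0.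
  right; have [|-> ->] := real_sumsq_eq0 ha hb; last by [].
  by move: e3; rewrite m0 addr0 expr0n addrC => /esym.
left; have b0 : b = 0 by move/eqP: e1; rewrite mulf_eq0 (negbTE m0) => /eqP.
have a0 : a = 0.
  have : a ^+ 2 = 0 by move: e4; rewrite e3 b0 expr0n add0r -[RHS]add0r => /addIr.
  by move/eqP; rewrite sqrf_eq0 => /eqP.
split=> //; move/eqP: e2; rewrite a0 b0 !(mulr0, mul0r, add0r, addr0).
by rewrite !mulf_eq0 pnatr_eq0 (negbTE m0) => /eqP.
Qed.

(** All components with a repeated index vanish: the cubic form is a multiple of xyz in this
    basis. *)
Definition orthoptic X Y Z :=
  [/\ [/\ tri X X X = 0, tri X X Y = 0 & tri X X Z = 0],
      [/\ tri Y Y X = 0, tri Y Y Y = 0 & tri Y Y Z = 0] &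
      [/\ tri Z Z X = 0, tri Z Z Y = 0 & tri Z Z Z = 0]].

(* The cubic form is 3 l (m (e^2 - f^2) + 2 q e f): rotate e, f onto null directions of the second factor. *)
Lemma orthoptic_rot S L E F : hermbasis S (triple L E F) ->
  [/\ tri L L L = 0, tri L L E = 0 & tri L L F = 0] ->
  [/\ tri E E E = 0, tri E E F = 0, tri E F F = 0 & tri F F F = 0] ->
  tri L F F = - tri L E E ->
  exists X Y Z, hermbasis S (triple X Y Z) /\ orthoptic X Y Z.
Proof.
move=> hB [l1 l2 l3] [f1 f2 f3 f4] h.
have [_ [hL hE hF] _ _] := herm_tripleP hB.
have [|| c [s [hc hs cs e]]] := @rot_quad C (tri L E E) (tri L E F); try exact: tri_real.
exists L, (c *: E + s *: F), (- s *: E + c *: F); split; first exact: herm_rot.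
have [[_ a1 a2] [a3 _]] := tri_sort E E F; have [[a4 a5 _] [_ a6]] := tri_sort E F F.
have [[_ b1 b2] [b3 _]] := tri_sort L L E; have [[_ d1 d2] [d3 _]] := tri_sort L L F.
have [[g1 g2 g3] [g4 g5]] := tri_sort L E F.
have [[k1 k2 _] [k3 _]] := tri_sort L E E; have [[m1 m2 _] [m3 _]] := tri_sort L F F.
split; split; rewrite ?(triDl, triDm, triDr, triZl, triZm, triZr);
  rewrite ?(a1, a2, a3, a4, a5, a6, b1, b2, b3, d1, d2, d3, g1, g2, g3, g4, g5, k1, k2, k3, m1, m2, m3);
  rewrite ?(l1, l2, l3, f1, f2, f3, f4, h); try ring.
- by rewrite -[RHS]e; ring.
- by rewrite -[RHS]oppr0 -[in RHS]e; ring.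
Qed.

Lemma orthoptic_exists G S : irred G -> ginv G S -> sdj S -> trless S -> \dim S = 3%N ->
  exists X Y Z, hermbasis S (triple X Y Z) /\ orthoptic X Y Z.
Proof.
move=> iG GS sS tS dS; have [Z [ZS hZ nZ zzz]] := null_vector sS dS.
have Z0 : Z != 0 by apply/eqP => z; move: nZ; rewrite z mul0mx mxtrace0 => /esym/eqP; rewrite oner_eq0.
have sZ : sdj <[Z]> by move=> _ /vlineP[k ->]; rewrite adjZ hZ memvZ ?memv_line.
have := hermbasis_exists (sdj_orthv sS sZ).
rewrite dim_orthv_line // dS /= => -[A [[AS Ao _] hA]].
have hB : hermbasis S (triple Z (A ord0) (A ord_max)).
  have oZ i : \tr (Z *m A i) = 0.
    by have /orthvP[_ /(_ Z)] := AS i; rewrite memv_line /hs hZ => ->.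
  have AA i j : \tr (A i *m A j) = (i == j)%:R by rewrite -Ao /hs hA.
  have AS' i : A i \in S by have /orthvP[] := AS i.
  by apply: herm_triple; rewrite ?AA ?oZ.
have {AS Ao hA}[X [Y [{}hB zzy]]] : exists X Y, hermbasis S (triple Z X Y) /\ tri Z Z Y = 0.
  (* The rotation in the plane orthogonal to Z is chosen so that T_zz vanishes on its second
     vector. *)
  have [|| c [s [hc hs cs e]]] := @rot_lin C (tri Z Z (A ord_max)) (- tri Z Z (A ord0)).
  - exact: tri_real.
  - by rewrite rmorphN /= tri_real.
  exists (c *: A ord0 + s *: A ord_max), (- s *: A ord0 + c *: A ord_max); split.
    exact: herm_rot.
  by rewrite triDr !triZr -[RHS]e; ring.
have [[_ XS YS] [_ hX hY] [_ nX nY] [oZX oXY oZY]] := herm_tripleP hB.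
have [k hk] := hermbasis_sumsq iG GS hB.
(* Harmonicity: the sum of the squares is a scalar k, and k tr P = 0. *)
have harm P : P \in S -> tri Z Z P + tri X X P + tri Y Y P = 0.
  move=> PS; rewrite !triXX -!mulrDr -!mxtraceD -!mulmxDl.
  have -> : Z *m Z + X *m X + Y *m Y = k%:M by rewrite -hk sum3.
  by rewrite mul_scalar_mx mxtraceZ (tS _ PS) !mulr0.
have [l hl] := dim3_contr iG GS sS tS hB.
have [[_ a1 a2] [a3 _]] := tri_sort X X Y; have [[a4 a5 _] [_ a6]] := tri_sort X Y Y.
have [[_ b1 b2] [b3 _]] := tri_sort Z Z X; have [[_ d1 d2] [d3 _]] := tri_sort Z Z Y.
have [[g1 g2 g3] [g4 g5]] := tri_sort Z X Y.
have [[k1 k2 _] [k3 _]] := tri_sort Z X X; have [[m1 m2 _] [m3 _]] := tri_sort Z Y Y.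
pose tbl := (a1, a2, a3, a4, a5, a6, b1, b2, b3, d1, d2, d3, g1, g2, g3, g4, g5, k1, k2, k3, m1, m2, m3).
have eZ := harm Z ZS; have eX := harm X XS; have eY := harm Y YS.
have cXY := hl X Y XS YS; have cZX := hl Z X ZS XS; have cZY := hl Z Y ZS YS.
have cZZ := hl Z Z ZS ZS; have cXX := hl X X XS XS; have cYY := hl Y Y YS YS.
have opp x y : x + y = 0 -> y = - x :> C by move/eqP; rewrite addrC addr_eq0 => /eqP.
rewrite zzz add0r ?tbl in eZ; rewrite zzy add0r ?tbl in eY; rewrite ?tbl in eX.
have {}eZ := opp _ _ eZ; have {}eY := opp _ _ eY; have {}eX := opp _ _ eX.
rewrite /contr !sum3 /triple /= !tbl zzz zzy eZ eY eX ?nX ?nY ?nZ ?oZX ?oXY ?oZY in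
  cXY cZX cZY cZZ cXX cYY.
have ra : (tri X X X)^* = tri X X X by exact: tri_real.
have rb : (tri X X Y)^* = tri X X Y by exact: tri_real.
have half x : 2 * x = 0 -> x = 0 :> C by move/eqP; rewrite mulf_eq0 pnatr_eq0 => /eqP.
have eq0 x y : x - y = 0 -> x = y :> C by move/eqP; rewrite subr_eq0 => /eqP.
(* With m, p, q, a, b standing for these components, harmonicity gives the remaining ones: T_zyy =
   -p, T_xyy = -(a + m), T_yyy = -b. *)
case: (@harmonic_cubic_solve (tri Z Z X) (tri Z X X) (tri Z X Y) (tri X X X) (tri X X Y)) => //.
- by apply/eqP; rewrite -oppr_eq0; apply/eqP; rewrite -[RHS](mulr0 l) -cXY; ring.
- by rewrite -[RHS](mulr0 l) -cZX; ring.
- apply: eq0; apply: half; rewrite -[RHS](subrr (l * 1)) -{1}cZZ -cYY; ring.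
- apply: eq0; rewrite -[RHS](subrr (l * 1)) -{1}cXX -cYY; ring.
(* Here the cubic form has the linear factor x; in the other case it has the factor z. *)
- move=> [a0 b0 p0]; apply: (@orthoptic_rot S X Z Y).
  + by apply: herm_triple; rewrite ?[\tr (X *m Z)]mxtrace_mulC // [\tr (Y *m Z)]mxtrace_mulC.
  + by rewrite a0 b0 k3 p0.
  + by rewrite zzz zzy eZ eY b0 p0 oppr0.
  + by rewrite eX a0 addr0 b1.
move=> [a0 b0 m0]; apply: (@orthoptic_rot S Z X Y) => //.
by rewrite eX eY a0 b0 m0 addr0 oppr0.
Qed.

End FrameExists.

(** * From the normal form to off-diagonal generators *)

Section Dim3.
Variable C : numClosedFieldType.
Local Notation M := 'M[C]_3.
Implicit Types (X Y Z u : M) (S T W : {vspace M}) (G : M -> Prop).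

Lemma dotmx_ge0 n (w : 'rV[C]_n) : 0 <= (w *m w^t*) 0 0.
Proof. by rewrite mxE sumr_ge0 // => i _; rewrite !mxE -normCK exprn_ge0. Qed.

Lemma dotmx_eq0 n (w : 'rV[C]_n) : (w *m w^t*) 0 0 = 0 -> w = 0.
Proof.
rewrite mxE => /eqP; rewrite psumr_eq0 => [/allP h|i _]; last by rewrite !mxE -normCK exprn_ge0.
apply/rowP => i; rewrite mxE; have := h i (mem_index_enum i).
by rewrite !mxE -normCK expf_eq0 normr_eq0 => /eqP.
Qed.

(** A normalized nonzero row v of P spans a line in its range; the projection onto that line lies
    below P and has the same trace, so the Hilbert-Schmidt norm of the difference is 0. *)
Lemma projection_rank1 (P : M) : P^t* = P -> P *m P = P -> \tr P = 1 ->
  exists2 v : 'rV[C]_3, v *m P = v & v^t* *m v = P.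
Proof.
move=> hP PP tP.
have P0 : P != 0 by apply: contra_eq_neq tP => ->; rewrite mxtrace0 eq_sym oner_eq0.
have [i wi] : exists i, row i P != 0.
  apply/existsP; apply: contraNT P0; rewrite negb_exists => /forallP h.
  by apply/eqP/row_matrixP => i; move/(_ i): h; rewrite negbK row0 => /eqP.
pose w := row i P; have wP : w *m P = w by rewrite -row_mul PP.
have ww : 0 < (w *m w^t*) 0 0.
  by rewrite lt_def dotmx_ge0 andbT; apply: contra wi => /eqP/dotmx_eq0 w0; apply/eqP.
pose k := (sqrtC ((w *m w^t*) 0 0))^-1.
have hk : k^* = k by rewrite fmorphV /= sqrtC_real // ltW.
have kk : k * k * (w *m w^t*) 0 0 = 1.
  by rewrite -expr2 exprVn sqrtCK mulVf // gt_eqF.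
pose v := k *: w; have vP : v *m P = v by rewrite -scalemxAl wP.
have vv : v *m v^t* = 1%:M.
  rewrite /v linearZ map_mxZ /= hk -scalemxAl -scalemxAr scalerA [w *m _]mx11_scalar.
  by rewrite scale_scalar_mx kk.
have Pv : P *m v^t* = v^t*.
  by rewrite -{1}hP -map_mxM -trmx_mul vP.
exists v => //; apply/eqP; rewrite -subr_eq0; apply/eqP/hs_eq0.
set D := v^t* *m v - P.
have vvP : v^t* *m v *m (v^t* *m v) = v^t* *m v.
  by rewrite mulmxA -[_ *m v *m v^t*]mulmxA vv mulmx1.
have hD : D^t* = D by rewrite adjB hP trmx_mul map_mxM trmxCK.
rewrite /hs hD mulmxBl !mulmxBr vvP PP [P *m (_ *m _)]mulmxA Pv -[_ *m v *m P]mulmxA vP.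
rewrite subrr sub0r raddfN /= raddfB /= tP [\tr (v^t* *m v)]mxtrace_mulC vv.
by rewrite mxtrace1 subrr oppr0.
Qed.

(* The matrices 1 - 2 X^2, 1 - 2 Y^2, 1 - 2 Z^2 are rank-one projections with sum 1; a basis adapted
   to them makes each of X, Y, Z a single off-diagonal hermitian pair. *)
Lemma frame_offv S X Y Z : trless S -> hermbasis S (triple X Y Z) -> orthoptic X Y Z ->
  X *m X + Y *m Y + Z *m Z = 1%:M ->
  exists z1 z2 z3, [/\ unimod z1, unimod z2, unimod z3 & qg_iso S (offv z1 z2 z3)].
Proof.
move=> tS hB [[o1 o2 o3] [o4 o5 o6] [o7 o8 o9]] sq.
have [[XS YS ZS] [hX hY hZ] [nX nY nZ] _] := herm_tripleP hB.
have two0 : (2 : C) != 0 by rewrite pnatr_eq0.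
have sqtr (A B : M) : tri A A B = 0 -> \tr (A *m A *m B) = 0.
  by rewrite triXX => /eqP; rewrite mulf_eq0 pnatr_eq0 => /eqP.
have proj (A : M) : A^t* = A -> \tr A = 0 -> \tr (A *m A) = 1 -> tri A A A = 0 ->
    exists2 v : 'rV[C]_3, v *m A = 0 & v^t* *m v = 1%:M - 2 *: (A *m A).
  (* As tr A^2 = 1 and tr A^3 = 0, Cayley-Hamilton gives A^3 = A / 2. Hence 1 - 2 A^2 is a
     projection, of trace 3 - 2 = 1, annihilated by A. *)
  move=> hA tA nA aaa; have A3 : A *m A *m A = 2^-1 *: A.
    by rewrite cayley_hamilton3 // nA (sqtr _ _ aaa) mul0r raddf0 addr0 mul1r.
  have A4 : A *m A *m (A *m A) = 2^-1 *: (A *m A) by rewrite mulmxA A3 -scalemxAl.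
  have [|||v vP vv] := @projection_rank1 (1%:M - 2 *: (A *m A)).
  - by rewrite adjB adjZ adjM hA adj_scalar conjC1 conjC_nat.
  - rewrite mulmxBl !mulmxBr !mul1mx mulmx1 -scalemxAl -scalemxAr A4 !scalerA.
    by rewrite mulfK // subrr subr0.
  - rewrite raddfB /= mxtrace1 mxtraceZ nA mulr1; ring.
  exists v => //; rewrite -vP -mulmxA mulmxBl mul1mx -scalemxAl A3 scalerA divff //.
  by rewrite scale1r subrr mulmx0.
have [x xX xx] := proj X hX (tS _ XS) nX o1.
have [y yY yy] := proj Y hY (tS _ YS) nY o5.
have [z zZ zz] := proj Z hZ (tS _ ZS) nZ o9.
(* The three projections add up to 3 - 2 = 1, so the matrix with rows x, y, z is unitary. *)
pose V : M := \matrix_i nth 0 [:: x; y; z] i.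
have rV i : row i V = nth 0 [:: x; y; z] i by rewrite rowK.
have VV : V^t* *m V = 1%:M.
  transitivity (x^t* *m x + y^t* *m y + z^t* *m z).
    by apply/matrixP => i j; rewrite !mxE sum3 !mxE !big_ord1 !mxE.
  rewrite xx yy zz; move: (X *m X) (Y *m Y) (Z *m Z) sq => P Q N sq.
  have -> : N = 1%:M - P - Q by rewrite -sq; apply/matrixP => i j; rewrite !mxE; ring.
  by apply/matrixP => i j; rewrite !mxE; ring.
have hV : V \is unitarymx by apply/unitarymxP; exact: mulmx1C.
have entry (A : M) i j : mxconj V A i j = (row i V *m A *m (row j V)^t*) 0 0.
  by rewrite /mxconj !mxE; apply: eq_bigr => k _; rewrite !mxE; congr (_ * _); apply: eq_bigr => l _; rewrite !mxE.
have row0 (A : M) i : row i V *m A = 0 -> forall j, mxconj V A i j = 0.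
  by move=> e j; rewrite entry e mul0mx mxE.
have conjE (A : M) i j : A^t* = A -> mxconj V A i j = (mxconj V A j i)^*.
  by move=> hA; rewrite -adjE mxconj_adj hA.
(* The diagonal entry is tr A - 2 tr(B^2 A), and the second trace is a component with a repeated
   index. *)
have diag (A B : M) i : \tr A = 0 -> (row i V)^t* *m row i V = 1%:M - 2 *: (B *m B) ->
    tri B B A = 0 -> mxconj V A i i = 0.
  move=> tA e /sqtr bba.
  have -> : mxconj V A i i = \tr ((row i V)^t* *m row i V *m A).
    by rewrite entry -[in RHS]mulmxA [RHS]mxtrace_mulC /mxtrace big_ord1.
  by rewrite e mulmxBl mul1mx raddfB /= -scalemxAl mxtraceZ tA bba mulr0 subrr.
have tX := tS _ XS; have tY := tS _ YS; have tZ := tS _ ZS.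
have r1 : row i1 V = x := rV i1; have r2 : row i2 V = y := rV i2.
have r3 : row i3 V = z := rV i3.
pose X' := mxconj V X; pose Y' := mxconj V Y; pose Z' := mxconj V Z.
have x1 j : X' i1 j = 0 by apply: row0; rewrite r1.
have y2 j : Y' i2 j = 0 by apply: row0; rewrite r2.
have z3 j : Z' i3 j = 0 by apply: row0; rewrite r3.
have x1' j : X' j i1 = 0 by rewrite /X' conjE // -/X' x1 conjC0.
have y2' j : Y' j i2 = 0 by rewrite /Y' conjE // -/Y' y2 conjC0.
have z3' j : Z' j i3 = 0 by rewrite /Z' conjE // -/Z' z3 conjC0.
have x22 : X' i2 i2 = 0 by apply: (diag _ Y) => //; rewrite r2.
have x33 : X' i3 i3 = 0 by apply: (diag _ Z) => //; rewrite r3.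
have y11 : Y' i1 i1 = 0 by apply: (diag _ X) => //; rewrite r1.
have y33 : Y' i3 i3 = 0 by apply: (diag _ Z) => //; rewrite r3.
have z11 : Z' i1 i1 = 0 by apply: (diag _ X) => //; rewrite r1.
have z22 : Z' i2 i2 = 0 by apply: (diag _ Y) => //; rewrite r2.
(* A hermitian pair with entry w has squared norm 2 |w|^2 = 1, so w times the square root of 2 is a
   phase. *)
pose k : C := sqrtC 2.
have hk : k^* = k by rewrite sqrtC_real.
have kk : k * k = 2 by rewrite -expr2 sqrtCK.
have nrm (A : M) : A^t* = A -> \tr (A *m A) = 1 -> hs (mxconj V A) (mxconj V A) = 1.
  by move=> hA; rewrite hs_mxconj // /hs hA.
have uz w : w * w^* + w^* * w = 1 -> unimod (k * w).
  by move=> e; rewrite /unimod rmorphM /= hk mulrACA kk -[RHS]e; ring.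
have xh : X' i3 i2 = (X' i2 i3)^* by rewrite /X' conjE.
have yh : Y' i1 i3 = (Y' i3 i1)^* by rewrite /Y' conjE.
have zh : Z' i2 i1 = (Z' i1 i2)^* by rewrite /Z' conjE.
have ux : unimod (k * X' i2 i3).
  apply: uz; have := nrm X hX nX; rewrite -/X' hs3 !x1 !x1' x22 x33 !simpe.
  by rewrite xh conjCK => e; rewrite -[RHS]e; ring.
have uy : unimod (k * Y' i3 i1).
  apply: uz; have := nrm Y hY nY; rewrite -/Y' hs3 !y2 !y2' y11 y33 !simpe.
  by rewrite yh conjCK => e; rewrite -[RHS]e; ring.
have uzz : unimod (k * Z' i1 i2).
  apply: uz; have := nrm Z hZ nZ; rewrite -/Z' hs3 !z3 !z3' z11 z22 !simpe.
  by rewrite zh conjCK => e; rewrite -[RHS]e; ring.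
exists (k * X' i2 i3), (k * Y' i3 i1), (k * Z' i1 i2); split=> //.
exists V => //; apply: conjv_eq => // [|A AS].
  by rewrite dim_offv // (onb_dim hB.1).
have [[_ _ /(_ A AS) ->] _] := hB.
rewrite sum3 /triple /= !linearD !linearZ /= -/X' -/Y' -/Z'.
have kc w : (k * w)^* = k * w^* by rewrite rmorphM /= hk.
rewrite !memvD ?memvZ //; apply/offvP => //; rewrite /diag0 /offrel !kc.
- by rewrite !x1 !x1' x22 x33 !simpe xh; split=> //; split=> //; ring.
- by rewrite !y2 !y2' y11 y33 !simpe yh; split=> //; split=> //; ring.
- by rewrite !z3 !z3' z11 z22 !simpe zh; split=> //; split=> //; ring.
Qed.

Lemma dim3_iso G S : irred G -> ginv G S -> sdj S -> trless S -> \dim S = 3%N ->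
  exists z1 z2 z3, [/\ unimod z1, unimod z2, unimod z3 & qg_iso S (offv z1 z2 z3)].
Proof.
move=> iG GS sS tS dS; have [X [Y [Z [hB o]]]] := orthoptic_exists iG GS sS tS dS.
apply: (frame_offv tS hB o).
have [c hc] := hermbasis_sumsq iG GS hB; move: hc; rewrite sum3 /triple /= => hc.
have [_ _ [nX nY nZ] _] := herm_tripleP hB.
have := congr1 (fun A : M => \tr A) hc; rewrite !mxtraceD nX nY nZ mxtrace_scalar => e.
rewrite hc; congr (_%:M); apply: (@mulIf _ (3 : C)); first by rewrite pnatr_eq0.
by rewrite mulr_natr -e; ring.
Qed.

End Dim3.

(** * Transitivity of the listed spaces *)

Section Transitivity.
Variable C : numClosedFieldType.
Local Notation M := 'M[C]_3.
Implicit Types (X Y Z u : M) (S T W : {vspace M}) (z w : C).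
Local Notation vt2 := (vt2 C).
Local Notation vt6 := (vt6 C).
Local Notation vt8 := (vt8 C).

(** The pointwise form of [vertex_transitive], so that matrices can be placed in the span one at a
    time. *)
Definition in_Stab_span S X := exists2 r : seq M, {subset r <= Stab S} & X \in <<r>>%VS.

Lemma in_Stab_spanD S X Y : in_Stab_span S X -> in_Stab_span S Y -> in_Stab_span S (X + Y).
Proof.
case=> r hr Xr [s hs Ys]; exists (r ++ s).
  by move=> u; rewrite mem_cat => /orP[/hr|/hs].
by rewrite span_cat memv_add.
Qed.
Lemma in_Stab_spanZ S k X : in_Stab_span S X -> in_Stab_span S (k *: X).
Proof. by case=> r hr Xr; exists r; rewrite ?memvZ. Qed.
Lemma in_Stab_span_gen S u : u \in Stab S -> in_Stab_span S u.
Proof.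
move=> hu; exists [:: u]; last by rewrite memv_span ?mem_head.
by move=> v; rewrite inE => /eqP ->.
Qed.
Lemma StabM S u v : u \in Stab S -> v \in Stab S -> u *m v \in Stab S.
Proof.
rewrite !inE => /andP[hu /eqP eu] /andP[hv /eqP ev].
by rewrite mul_unitarymx //= -conjv_comp ev eu.
Qed.
Lemma Stab1 S : 1%:M \in Stab S.
Proof. by rewrite inE unitary1 conjv1 eqxx. Qed.
Lemma in_Stab_spanM S X u : in_Stab_span S X -> u \in Stab S -> in_Stab_span S (X *m u).
Proof.
case=> r hr Xr hu; exists [seq v *m u | v <- r].
  by move=> _ /mapP[v /hr hv ->]; exact: StabM.
rewrite (@coord_span _ _ _ (in_tuple r) X Xr) mulmx_suml; apply: memv_suml => i _.
rewrite -scalemxAl memvZ // memv_span //; apply/mapP; exists r`_i => //.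
exact: mem_nth.
Qed.

Lemma Stab_sum3 S X : (forall i j, in_Stab_span S (delta_mx i j)) -> in_Stab_span S X.
Proof.
move=> h; rewrite (matrix_sum_delta X) !sum3.
by do !apply: in_Stab_spanD; apply: in_Stab_spanZ.
Qed.

(* Right multiplication by a weighted 3-cycle moves e_ii to the other matrix units of row i. *)
Lemma transitive_crit S a b c : unimod a -> unimod b -> unimod c ->
  dg a b c *m uh C \in Stab S -> (forall i, in_Stab_span S (delta_mx i i)) ->
  vertex_transitive S.
Proof.
move=> ha hb hc hP hD; set P := dg a b c *m uh C in hP.
have PE i j : P i j = nth 0 [:: a; b; c] i * uh C i j.
  by rewrite mxE sum3 !mxE; move: i j; do 2!apply: forall3; rewrite /= !simpe.
clearbody P.
have step (i j k : 'I_3) z : unimod z -> delta_mx i j *m P = z *: delta_mx i k ->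
    in_Stab_span S (delta_mx i j) -> in_Stab_span S (delta_mx i k).
  move=> hz e h; rewrite -[delta_mx i k](scalerK (unimod_neq0 hz)) -e.
  by apply: in_Stab_spanZ; exact: in_Stab_spanM.
have dP (i j k : 'I_3) z : (forall l, P j l = z * (l == k)%:R) -> delta_mx i j *m P = z *: delta_mx i k.
  move=> h; apply/matrixP => x y; rewrite !mxE (bigD1 j) //= big1 => [|l lj].
    by rewrite !mxE h eqxx andbT addr0 mulrCA -natrM mulnb.
  by rewrite mxE (negbTE lj) andbF mul0r.
have d1 (i : 'I_3) : delta_mx i i1 *m P = a *: delta_mx i i3.
  by apply: dP; apply: forall3; rewrite PE uhatE.
have d2 (i : 'I_3) : delta_mx i i2 *m P = b *: delta_mx i i1.
  by apply: dP; apply: forall3; rewrite PE uhatE.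
have d3 (i : 'I_3) : delta_mx i i3 *m P = c *: delta_mx i i2.
  by apply: dP; apply: forall3; rewrite PE uhatE.
move=> X; apply: Stab_sum3; do 2!apply: forall3; try exact: hD.
- by apply: (step _ _ _ _ hc (d3 _)); apply: (step _ _ _ _ ha (d1 _)).
- exact: (step _ _ _ _ ha (d1 _)).
- exact: (step _ _ _ _ hb (d2 _)).
- by apply: (step _ _ _ _ ha (d1 _)); apply: (step _ _ _ _ hb (d2 _)).
- by apply: (step _ _ _ _ hb (d2 _)); apply: (step _ _ _ _ hc (d3 _)).
- exact: (step _ _ _ _ hc (d3 _)).
Qed.

Lemma unimodN1 : unimod (-1 : C).
Proof. by apply: unimodN; exact: unimod1. Qed.

(** e_ii is half the sum of the identity and the diagonal sign matrix that is 1 only at position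
    i. *)
Lemma transitive_signs S a b c : unimod a -> unimod b -> unimod c ->
  dg a b c *m uh C \in Stab S ->
  (forall e1 e2 e3 : C, e1 ^+ 2 = 1 -> e2 ^+ 2 = 1 -> e3 ^+ 2 = 1 -> dg e1 e2 e3 \in Stab S) ->
  vertex_transitive S.
Proof.
move=> ha hb hc hP hs; apply: (transitive_crit ha hb hc hP).
have s1 : (1 : C) ^+ 2 = 1 by rewrite expr1n.
have sN : (-1 : C) ^+ 2 = 1 by rewrite sqrrN expr1n.
have half X u : u \in Stab S -> X = 2^-1 *: (1%:M + u) -> in_Stab_span S X.
  move=> hu ->; apply: in_Stab_spanZ; apply: in_Stab_spanD; apply: in_Stab_span_gen => //.
  exact: Stab1.
apply: forall3.
- apply: (half _ (dg 1 (-1) (-1))); first exact: hs.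
  by apply: mx3P; rewrite !mxE /= !simpe //; field.
- apply: (half _ (dg (-1) 1 (-1))); first exact: hs.
  by apply: mx3P; rewrite !mxE /= !simpe //; field.
- apply: (half _ (dg (-1) (-1) 1)); first exact: hs.
  by apply: mx3P; rewrite !mxE /= !simpe //; field.
Qed.

Lemma unimod_sign (e : C) : e ^+ 2 = 1 -> unimod e.
Proof.
by move/eqP; rewrite sqrf_eq1 => /orP[]/eqP ->; [exact: unimod1|exact: unimodN1].
Qed.

Lemma sign_conj (e : C) : e ^+ 2 = 1 -> e^* = e.
Proof.
by move/eqP; rewrite sqrf_eq1 => /orP[]/eqP ->; rewrite ?rmorphN /= conjC1.
Qed.

Lemma conjv_sign_offv (e1 e2 e3 z : C) : e1 ^+ 2 = 1 -> e2 ^+ 2 = 1 -> e3 ^+ 2 = 1 ->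
  unimod z -> conjv (dg e1 e2 e3) (offv 1 1 z) = offv 1 1 z.
Proof.
move=> s1 s2 s3 hz; have u1 := unimod1 C.
rewrite conjv_dg_offv //; try exact: unimod_sign.
rewrite !sign_conj // (mulrAC e1) [_ * z]mulrC.
rewrite -[X in offv X](mul1r) -?mulrA.
have m e e' : e ^+ 2 = 1 -> e' ^+ 2 = 1 -> (e * e') ^+ 2 = 1 :> C.
  by move=> h h'; rewrite exprMn h h' mulr1.
have -> : offv (1 * (e2 * (1 * e3))) (e3 * (1 * e1)) (z * (e1 * e2)) =
          offv ((e2 * e3) * 1) ((e3 * e1) * 1) ((e1 * e2) * z).
  by congr offv; ring.
by rewrite offvN // m.
Qed.

(** The shift u moves the phases (1, 1, z) to (z, 1, 1), and the diagonal matrix with entries 1,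
    z^*, 1 moves them back. *)
Lemma transitive_offv z : unimod z ->
  vertex_transitive (offv 1 1 z) /\ vertex_transitive (vt2 + offv 1 1 z).
Proof.
move=> hz; have u1 := unimod1 C; have hz' := unimod_conj hz.
have hD : dg 1 z^* 1 \is unitarymx by exact: dg_unitary.
have uP := uh_unitary C.
have e : conjv (dg 1 z^* 1 *m uh C) (offv 1 1 z) = offv 1 1 z.
  rewrite -conjv_comp conjv_uh_offv // conjv_dg_offv // !conjC1 conjCK !mulr1 !mul1r.
  by rewrite unimodC.
have e2 : conjv (dg 1 z^* 1 *m uh C) vt2 = vt2.
  by rewrite -conjv_comp conjv_uh_vt2 conjv_dg_vt2.
split; apply: (transitive_signs u1 hz' u1).
- by rewrite inE mul_unitarymx //= e.
- move=> ? ? ? s1 s2 s3; have [[t1 t2] t3] := (unimod_sign s1, unimod_sign s2, unimod_sign s3).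
  by rewrite inE dg_unitary // conjv_sign_offv ?eqxx.
- by rewrite inE mul_unitarymx //= conjv_addv e e2.
move=> ? ? ? s1 s2 s3; have [[t1 t2] t3] := (unimod_sign s1, unimod_sign s2, unimod_sign s3).
by rewrite inE dg_unitary // conjv_addv conjv_sign_offv // conjv_dg_vt2 ?eqxx.
Qed.

Lemma conjv_0 u : conjv u (0%VS : {vspace M}) = 0%VS.
Proof. exact: limg0. Qed.

(** Meant for spaces determined by the diagonal plane alone: the shift u and the sign matrices
    normalize that plane. *)
Lemma transitive_diagonal S :
  (forall u, u \is unitarymx -> conjv u vt2 = vt2 -> conjv u S = S) -> vertex_transitive S.
Proof.
move=> h; have u1 := unimod1 C.
have hD : dg 1 1 1 \is unitarymx := dg_unitary u1 u1 u1; have uP := uh_unitary C.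
apply: (transitive_signs u1 u1 u1).
  rewrite inE mul_unitarymx //= h ?mul_unitarymx //.
  by rewrite -conjv_comp conjv_uh_vt2 conjv_dg_vt2.
move=> ? ? ? s1 s2 s3; have [[t1 t2] t3] := (unimod_sign s1, unimod_sign s2, unimod_sign s3).
by rewrite inE dg_unitary //= h ?dg_unitary ?conjv_dg_vt2.
Qed.

Lemma transitive_vt6 : vertex_transitive vt6.
Proof.
by apply: transitive_diagonal => u hu e; rewrite -orthv_vt8_vt2 conjv_orthv // e conjv_vt8.
Qed.

Lemma transitive_vt4 (omega : C) : 1 + omega + omega ^+ 2 = 0 -> omega^* = omega ^+ 2 ->
  vertex_transitive (vt4 omega).
Proof.
move=> w0 wc; have u1 := unimod1 C; have w3 := omega3 w0.
have uw := unimod_omega w0 wc.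
have hv := vh_unitary w0 wc.
have sv : vh omega \in Stab (vt4 omega).
  rewrite inE hv; apply/eqP; apply: conjv_eq => // X /(VT4P w0)[t [e1 e2 e3 e4]].
  apply/(VT4P w0); rewrite mxconj_tr //; split=> //.
  rewrite /vh !mxconj_dgE /= e1 e2 e3 e4.
  have c2 : (omega ^+ 2)^* = omega by rewrite -wc conjCK.
  rewrite wc c2 conjC1 !mul1r !mulr1; split; first by rewrite mulrC.
  - by rewrite mulrAC -exprD (exprD _ 3 1) w3 mul1r mulrC.
  - by rewrite mulrC.
  - by rewrite mulrAC -expr2 mulrC.
have su : dg 1 1 1 *m uh C \in Stab (vt4 omega).
  have -> : dg 1 1 1 *m uh C = uh C.
    by apply: mx3P; rewrite !mxE sum3 !mxE /= !simpe.
  have uP := uh_unitary C.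
  rewrite inE uP; apply/eqP; apply: conjv_eq => // X /(VT4P w0)[t [e1 e2 e3 e4]].
  apply/(VT4P w0); rewrite mxconj_tr //; split=> //.
  by rewrite !mxconj_uhE /= e1 e2 e3 e4.
apply: (transitive_crit u1 u1 u1 su).
have comb X k l : X = 3^-1 *: (1%:M + (k *: vh omega + l *: (vh omega *m vh omega))) ->
    in_Stab_span (vt4 omega) X.
  move=> ->; apply: in_Stab_spanZ; apply: in_Stab_spanD.
    by apply: in_Stab_span_gen; exact: Stab1.
  by apply: in_Stab_spanD; apply: in_Stab_spanZ; apply: in_Stab_span_gen; rewrite ?StabM.
have w2 := omega2 w0.
have v2 : vh omega *m vh omega = dg 1 (omega ^+ 2) omega by rewrite -vhat2E.
(* Fourier inversion: e_ii is the spectral projection of v for its eigenvalue at position i. *)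
apply: forall3.
- by apply: (comb _ 1 1); rewrite v2; apply: mx3P; rewrite !mxE /= !simpe //; field: w2.
- by apply: (comb _ (omega ^+ 2) omega); rewrite v2; apply: mx3P; rewrite !mxE /= !simpe //; field: w2.
- by apply: (comb _ omega (omega ^+ 2)); rewrite v2; apply: mx3P; rewrite !mxE /= !simpe //; field: w2.
Qed.

End Transitivity.

(** * Separating the one-parameter families *)

Section Invariant.
Variable C : numClosedFieldType.
Local Notation M := 'M[C]_3.
Implicit Types (X Y Z u : M) (S T W : {vspace M}) (z w : C).
Local Notation vt2 := (vt2 C).

(** A diagonal unitary gathers the product of the phases in the last one. It fixes the diagonal
    plane, so the same matrix serves dimensions 3 and 5. *)
Lemma gauge_offv z1 z2 z3 : unimod z1 -> unimod z2 -> unimod z3 ->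
  exists w u, [/\ unimod w, u \is unitarymx, conjv u vt2 = vt2
    & conjv u (offv z1 z2 z3) = offv 1 1 w].
Proof.
move=> h1 h2 h3; have u1 := unimod1 C; have h1' := unimod_conj h1.
exists (z2 * z3 * z1), (dg z2 z1^* 1); split.
- by do 2!apply: unimodM => //.
- exact: dg_unitary.
- exact: conjv_dg_vt2.
- by rewrite conjv_dg_offv // conjC1 !mulr1 mul1r unimodC // h2 conjCK.
Qed.

(** The sum of the T_ijk^2, which by [contr_total_iso] separates the members of the family in
    dimension 3. *)
Definition contr_total d (A : 'I_d -> M) : C := \sum_i contr A (A i) (A i).

Lemma contr_total_iso d S T (A B : 'I_d -> M) u : u \is unitarymx -> conjv u S = T ->
  hermbasis S A -> hermbasis T B -> contr_total A = contr_total B.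
Proof.
move=> hu e hA hB; have hA' := hermbasis_mxconj hu hA; rewrite e in hA'.
pose A' i := mxconj u (A i).
transitivity (\sum_i contr A' (A' i) (A' i)).
  apply: eq_bigr => i _; apply: eq_bigr => k _; apply: eq_bigr => l _.
  by rewrite /A' !tri_mxconj.
transitivity (\sum_i contr B (A' i) (A' i)).
  by apply: eq_bigr => i _; rewrite (contr_basis _ _ hA' hB).
have := @casimir C 3 C^o (contr B) d T A' B _ _ hA'.1 hB.1.
under eq_bigr do rewrite hA'.2; under [in RHS]eq_bigr do rewrite hB.2.
apply.
- by move=> Y k X Z; rewrite !(contrC _ _ Y) contr_lin.
- by move=> X k Y Z; rewrite contr_lin.
Qed.

Lemma tr_offdiag0_diag0 X Y : offdiag0 X -> diag0 Y -> \tr (X *m Y) = 0.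
Proof.
move=> [[e1 e2 e3] [e4 e5 e6]] [d1 d2 d3].
by rewrite trE !mxE !sum3 e1 e2 e3 e4 e5 e6 d1 d2 d3 !simpe.
Qed.

(** Only the six permutations of T_123 contribute. The three normalizing factors, squared, give 1/8,
    whence 6/8 = 3/4. *)
Lemma contr_total_offb z1 z2 z3 : contr_total (offb z1 z2 z3) =
  3 / 4 * (z1 * z2 * z3 + (z1 * z2 * z3)^* ) ^+ 2.
Proof.
pose k : C := (sqrtC 2)^-1; have kk : k ^+ 2 = 2^-1 by rewrite exprVn sqrtCK.
pose X := offm i2 i3 z1; pose Y := offm i3 i1 z2; pose Z := offm i1 i2 z3.
have e1 : offb z1 z2 z3 i1 = k *: X by [].
have e2 : offb z1 z2 z3 i2 = k *: Y by [].
have e3 : offb z1 z2 z3 i3 = k *: Z by [].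
have [X' eX] : {X' | X' = X} by exists X.
have [Y' eY] : {Y' | Y' = Y} by exists Y.
have [Z' eZ] : {Z' | Z' = Z} by exists Z.
have XYZ : tri X' Y' Z' = z1 * z2 * z3 + (z1 * z2 * z3)^*.
  rewrite !rmorphM /= eX eY eZ /tri /mxtrace sum3 !mxE !sum3 !mxE !sum3 !mxE /= !simpe; ring.
have [[o1 o2 o3] [o4 o5 o6] [o7 o8 o9]] : orthoptic X' Y' Z'.
  have nul (A B : M) : offdiag0 (A *m A) -> diag0 B -> tri A A B = 0.
    by move=> hA hB; rewrite triXX tr_offdiag0_diag0 // mulr0.
  have dX : diag0 X' by rewrite eX /diag0 !mxE /= !simpe.
  have dY : diag0 Y' by rewrite eY /diag0 !mxE /= !simpe.
  have dZ : diag0 Z' by rewrite eZ /diag0 !mxE /= !simpe.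
  have sX : offdiag0 (X' *m X') by rewrite eX /offdiag0 !mxE !sum3 !mxE /= !simpe.
  have sY : offdiag0 (Y' *m Y') by rewrite eY /offdiag0 !mxE !sum3 !mxE /= !simpe.
  have sZ : offdiag0 (Z' *m Z') by rewrite eZ /offdiag0 !mxE !sum3 !mxE /= !simpe.
  by split; split; apply: nul.
have [[a1 a2 a3] [a4 a5]] := tri_sort X' Y' Z'.
have [[b1 b2 b3] [b4 b5]] := tri_sort X' X' Y'; have [[c1 c2 c3] [c4 c5]] := tri_sort X' X' Z'.
have [[d1 d2 d3] [d4 d5]] := tri_sort Y' Y' X'; have [[f1 f2 f3] [f4 f5]] := tri_sort Y' Y' Z'.
have [[g1 g2 g3] [g4 g5]] := tri_sort Z' Z' X'; have [[h1 h2 h3] [h4 h5]] := tri_sort Z' Z' Y'.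
rewrite /contr_total /contr !sum3 e1 e2 e3 -eX -eY -eZ !(triZl, triZm, triZr).
rewrite ?(a1, a2, a3, a4, a5, b1, b2, b3, b4, b5, c1, c2, c3, c4, c5, d1, d2, d3, d4, d5).
rewrite ?(f1, f2, f3, f4, f5, g1, g2, g3, g4, g5, h1, h2, h3, h4, h5).
rewrite ?(o1, o2, o3, o4, o5, o6, o7, o8, o9) XYZ.
set t := _ + _^*; transitivity (6 * (k ^+ 2 * k ^+ 2 * k ^+ 2) * t ^+ 2); first by ring.
by rewrite kk; field.
Qed.

End Invariant.

(** * The listed spaces over R[i] *)

Lemma addv_assoc4 (K : fieldType) (V : vectType K) (U1 U2 U3 U4 : {vspace V}) :
  (U1 + U2 + U3 + U4 = U1 + (U2 + U3 + U4))%VS.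
Proof. by rewrite !addvA. Qed.

Lemma addv_assoc6 (K : fieldType) (V : vectType K) (U1 U2 U3 U4 U5 U6 : {vspace V}) :
  (U1 + U2 + U3 + U4 + U5 + U6 = (U1 + U2 + U3) + (U4 + U5 + U6))%VS.
Proof. by rewrite !addvA. Qed.

Section Bridge.
Variable R : realType.
Local Notation C := R[i].
Local Notation M := 'M[C]_3.
Implicit Types (S T : {vspace M}) (z w : C) (t : R).

Lemma expi_conj t : (expi t)^* = expi (- t).
Proof. by rewrite /expi cosN sinN. Qed.
Lemma unimod_expi t : unimod (expi t).
Proof.
rewrite /unimod expi_conj /expi cosN sinN.
apply/eqP; rewrite eq_complex /=; apply/andP; split; apply/eqP; last by ring.
by rewrite mulrN opprK -!expr2 cos2Dsin2.
Qed.
Lemma expi0 : expi (0 : R) = 1.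
Proof. by rewrite /expi cos0 sin0. Qed.
Lemma expi_pihalf : expi (pi / 2 : R) = 'i.
Proof. by rewrite /expi cos_pihalf sin_pihalf. Qed.

Lemma rhatE i j t : rhat i j t = offm i j (expi (- t)).
Proof. by rewrite /rhat /offm expi_conj opprK. Qed.
Lemma xhatE i j : xhat R i j = offm i j 1.
Proof. by rewrite /xhat rhatE oppr0 expi0. Qed.
Lemma yhatE i j : yhat R i j = offm i j (- 'i).
Proof. by rewrite /yhat rhatE -expi_conj expi_pihalf conjCi. Qed.

Lemma VT2E : VT2 R = vt2 C. Proof. by []. Qed.
Lemma VT3E t : VT3 t = offv 1 1 (expi (- t)).
Proof. by rewrite /VT3 !xhatE rhatE. Qed.
Lemma VT4E : VT4 R = vt4 (omega R). Proof. by []. Qed.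
Lemma VT5E t : VT5 t = (vt2 C + offv 1 1 (expi (- t)))%VS.
Proof. by rewrite /VT5 !xhatE rhatE; exact: addv_assoc4. Qed.
Lemma VT6E : VT6 R = vt6 C.
Proof. by rewrite /VT6 !xhatE !yhatE; exact: addv_assoc6. Qed.
Lemma VT8E : VT8 R = vt8 C.
Proof. by rewrite /VT8 VT2E VT6E. Qed.

Lemma omega_root : 1 + omega R + omega R ^+ 2 = 0.
Proof.
have s3 : Num.sqrt 3 ^+ 2 = 3 :> R by rewrite sqr_sqrtr.
apply/eqP; rewrite eq_complex /omega expr2 /=; apply/andP; split; apply/eqP.
  by move: s3; rewrite expr2; set s := Num.sqrt _ => s3; field: s3.
by field.
Qed.
Lemma omega_conj : (omega R)^* = omega R ^+ 2.
Proof. 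
rewrite (omega2 omega_root) /omega.
by apply/eqP; rewrite eq_complex /=; apply/andP; split; apply/eqP; field.
Qed.

End Bridge.

(** * Invariants and normal forms of the phases *)

Section OffInvariants.
Variable C : numClosedFieldType.
Implicit Types z w : C.

Lemma offv_opp z : unimod z -> offv 1 1 (- z) = offv 1 1 z.
Proof.
move=> hz; have u1 := unimod1 C; rewrite -[LHS](_ : offv (1 * 1) (1 * 1) (-1 * z) = _).
  by rewrite offvN ?expr1n // sqrrN expr1n.
by rewrite !mul1r mulN1r.
Qed.

Lemma offv_iso_invariant z w : unimod z -> unimod w ->
  qg_iso (offv 1 1 z) (offv 1 1 w) -> (z + z^* ) ^+ 2 = (w + w^* ) ^+ 2.
Proof.
move=> hz hw [u hu e]; have u1 := unimod1 C.
have := contr_total_iso hu e (offb_hermbasis u1 u1 hz) (offb_hermbasis u1 u1 hw).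
rewrite !contr_total_offb !mul1r; apply: mulfI.
by rewrite mulf_neq0 ?invr_neq0 ?pnatr_eq0.
Qed.

(** In the complement the product of the phases is i^3 z = -iz, so the invariant of dimension 3
    becomes 3/4 (4 - (z + z^* )^2) there. *)
Lemma vt2_offv_iso_invariant z w : unimod z -> unimod w ->
  qg_iso (vt2 C + offv 1 1 z) (vt2 C + offv 1 1 w) -> (z + z^* ) ^+ 2 = (w + w^* ) ^+ 2.
Proof.
move=> hz hw /qg_iso_compl; have u1 := unimod1 C; have ui := unimodi C.
rewrite !orthv_vt8_vt2_offv // => -[u hu e].
have b (x : C) : unimod x -> hermbasis (offv ('i * 1) ('i * 1) ('i * x)) (offb ('i * 1) ('i * 1) ('i * x)).
  by move=> hx; apply: offb_hermbasis; apply: unimodM.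
have := contr_total_iso hu e (b z hz) (b w hw); rewrite !contr_total_offb => h.
have {}h : 3 / 4 * (4 - (z + z^* ) ^+ 2) = 3 / 4 * (4 - (w + w^* ) ^+ 2).
  have t (x : C) : unimod x -> 4 - (x + x^* ) ^+ 2 =
      ('i * 1 * ('i * 1) * ('i * x) + ('i * 1 * ('i * 1) * ('i * x))^* ) ^+ 2.
    move=> hx; have -> : ('i * 1 * ('i * 1) * ('i * x))^* = (- 'i) ^+ 3 * x^*.
      by rewrite !rmorphM /= conjCi conjC1 !mulr1 !mulrA !exprS expr0 mulr1 !mulrA.
    transitivity ('i ^+ 2 * 'i ^+ 2 * 'i ^+ 2 * (x - x^* ) ^+ 2); last by ring.
    have -> : (4 : C) = 4 * (x * x^* ) by rewrite hx mulr1.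
    by rewrite sqrCi; ring.
  by rewrite !t.
have n0 : 3 / 4 != 0 :> C by rewrite mulf_neq0 ?invr_neq0 ?pnatr_eq0.
by move/(mulfI n0)/(addrI _)/oppr_inj: h.
Qed.

(** The orbit of a phase under sign change, which does not alter the lines, and conjugation,
    realized by [swap]. Each orbit meets the quarter circle of the e^{-i theta} with theta in
    [0, pi/2]. *)
Definition phase_class w x := [\/ w = x, w = - x, w^* = x | w^* = - x].

Lemma offv_gauge z1 z2 z3 : unimod z1 -> unimod z2 -> unimod z3 ->
  exists2 w, unimod w & forall x, phase_class w x ->
    exists u, [/\ u \is unitarymx, conjv u (vt2 C) = vt2 C & conjv u (offv z1 z2 z3) = offv 1 1 x].
Proof.
move=> h1 h2 h3; have [w [u [hw hu e2 eo]]] := gauge_offv h1 h2 h3.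
have hs := swap_unitary C; have hw' := unimod_conj hw; exists w => // x.
have sw : exists u', [/\ u' \is unitarymx, conjv u' (vt2 C) = vt2 C &
    conjv u' (offv z1 z2 z3) = offv 1 1 w^*].
  exists (swap C *m u); split; first exact: mul_unitarymx.
    by rewrite -conjv_comp e2 conjv_swap_vt2.
  by rewrite -conjv_comp eo conjv_swap_offv.
have opp y : unimod y -> y = - x -> offv 1 1 y = offv 1 1 x.
  by move=> hy e; rewrite -(opprK x) -e offv_opp.
case=> wx.
- by exists u; rewrite -wx.
- by exists u; split; rewrite // eo (opp w).
- by rewrite -wx.
- by rewrite -(opp _ hw' wx).
Qed.

Section Transitive.
Variable omega : C.
Hypothesis omega_root : 1 + omega + omega ^+ 2 = 0.
Hypothesis omega_conj : omega^* = omega ^+ 2.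
Local Notation M := 'M[C]_3.
Implicit Types S T : {vspace M}.

(** Over an abstract closed field no angle is at hand, so the parameter is kept as a phase valid for
    its whole [phase_class]; the angle is chosen over R[i]. *)
Variant classified S : Prop :=
| Classified0 of qg_iso S 0%VS
| Classified2 of qg_iso S (vt2 C)
| Classified3 of exists2 w, unimod w & forall x, phase_class w x -> qg_iso S (offv 1 1 x)
| Classified4 of qg_iso S (vt4 omega)
| Classified5 of exists2 w, unimod w & forall x, phase_class w x ->
    qg_iso S (vt2 C + offv 1 1 x)
| Classified6 of qg_iso S (vt6 C)
| Classified8 of qg_iso S (vt8 C).

Lemma transitive_iso S : is_quantum_graph S -> vertex_transitive S -> classified S.
Proof.
move=> /quantum_graphE [//|tS sS] vS; have u1 := unimod1 C; have ui := unimodi C.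
pose G u := u \in Stab S; have iG : irred G := vertex_transitive_irred vS.
have GS : ginv G S := @Stab_ginv _ _ S.
have S8 : (S <= vt8 C)%VS by exact/trless_sub.
pose S' := orthv (vt8 C) S; have SK : orthv (vt8 C) S' = S by exact: orthvK.
have dS' : \dim S' = (8 - \dim S)%N by rewrite dim_orthv // dim_vt8.
have G8 : ginv G (vt8 C).
  by move=> u X /andP[hu _] /VT8P t; apply/VT8P; rewrite mxconj_tr.
have GS' : ginv G S' by exact: ginv_orthv.
have sS' : sdj S' by apply: sdj_orthv => //; exact: sdj_vt8.
have tS' : trless S' by apply/trless_sub; exact: capvSl.
have d8 : (\dim S <= 8)%N by rewrite -(dim_vt8 C) dimvS.
have vt2_iso T : ginv G T -> sdj T -> trless T -> \dim T = 2%N -> qg_iso T (vt2 C).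
  by move=> GT sT tT dT; apply: abelian_iso_vt2 => //; exact: (dim2_abelian iG).
case dS : (\dim S) d8 dS' => [|[|[|[|[|[|[|[|[|//]]]]]]]]] _ dS'.
- apply: Classified0; rewrite (_ : S = 0%VS); first exact: qg_iso_refl.
  by apply/eqP; rewrite -dimv_eq0 dS.
- by have := no_invariant_line iG GS sS tS; rewrite dS.
- by apply: Classified2; exact: vt2_iso.
- have [z1 [z2 [z3 [h1 h2 h3 iso]]]] := dim3_iso iG GS sS tS dS.
  have [w hw h] := offv_gauge h1 h2 h3; apply: Classified3; exists w => // x /h[u [hu _ e]].
  by apply: qg_iso_trans iso _; exists u.
- apply: Classified4; apply: (dim4_iso omega_root omega_conj iG) => //.
  by move=> u v; exact: StabM.
- have [z1 [z2 [z3 [h1 h2 h3 iso]]]] := dim3_iso iG GS' sS' tS' dS'.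
  have [||| w hw h] := @offv_gauge ('i * z1) ('i * z2) ('i * z3); try exact: unimodM.
  apply: Classified5; exists w => // x /h[u [hu e2 e]].
  have := qg_iso_compl iso; rewrite SK orthv_vt8_offv // => iso'.
  by apply: qg_iso_trans iso' _; exists u; rewrite // conjv_addv e2 e.
- apply: Classified6; have := qg_iso_compl (vt2_iso _ GS' sS' tS' dS').
  by rewrite SK orthv_vt8_vt2.
- by have := no_invariant_line iG GS' sS' tS'; rewrite dS'.
- apply: Classified8; rewrite (_ : S = vt8 C); first exact: qg_iso_refl.
  by apply/eqP; rewrite eqEdim S8 dS dim_vt8.
Qed.

End Transitive.
End OffInvariants.

(** * Angles, and the list over R[i] *)

Section Classification.
Variable R : realType.
Local Notation C := R[i].
Local Notation M := 'M[C]_3.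
Implicit Types (S T : {vspace M}) (z w : C) (t : R) (l : VTlabel R).

(** For w = a + ib take theta = acos |a|. Then e^{-i theta} = |a| - i|b|, and the signs of a and b
    select one of the four relations. *)
Lemma unimod_angle w : unimod w -> exists2 t, 0 <= t <= pi / 2 &
  phase_class w (expi (- t)).
Proof.
case: w => a b; rewrite /unimod => hw.
have ab : a ^+ 2 + b ^+ 2 = 1.
  by move/(congr1 (@complex.Re R)): hw; rewrite /= mulrN opprK -!expr2.
have na : `|a| ^+ 2 = a ^+ 2 by rewrite real_normK ?num_real.
have a1 : `|a| <= 1.
  by rewrite -(expr_le1 (n := 2)) // na -ab lerDl sqr_ge0.
have a1' : -1 <= `|a| <= 1 by rewrite a1 (le_trans _ (normr_ge0 a)) // oppr_le0 ler01.
have ct : cos (acos `|a|) = `|a| by apply: acosK; rewrite in_itv.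
have st : sin (acos `|a|) = `|b|.
  by rewrite sin_acos // na -ab addrC addKr sqrtr_sqr.
exists (acos `|a|).
  rewrite acos_ge0 //= leNgt; apply/negP => lt.
  have pi0 : 0 <= pi :> R := pi_ge0 R.
  have := ltr_cos (x := pi / 2) (y := acos `|a|).
  rewrite !in_itv /= acos_ge0 // acos_lepi // lt ct cos_pihalf.
  have -> : (0 <= (pi / 2 : R)) && ((pi / 2 : R) <= pi) by apply/andP; split; lra.
  by move=> /(_ isT isT); rewrite normr_lt0.
rewrite /expi cosN sinN ct st.
have [a0|a0] := lerP 0 a; have [b0|b0] := lerP 0 b.
- constructor 3; rewrite ?ger0_norm //.
- by constructor 1; rewrite (ger0_norm a0) (ltr0_norm b0) opprK.
- by constructor 2; rewrite (ltr0_norm a0) (ger0_norm b0); apply/eqP; rewrite eq_complex /= !opprK !eqxx.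
- constructor 4; rewrite (ltr0_norm a0) (ltr0_norm b0); apply/eqP; rewrite eq_complex /= !opprK !eqxx //.
Qed.

(** The invariant is 4 cos^2 theta, and cos is nonnegative and injective on [0, pi/2]. *)
Lemma expi_inj t1 t2 : 0 <= t1 <= pi / 2 -> 0 <= t2 <= pi / 2 ->
  (expi (- t1) + (expi (- t1))^* ) ^+ 2 = (expi (- t2) + (expi (- t2))^* ) ^+ 2 -> t1 = t2.
Proof.
move=> h1 h2; rewrite !expi_conj !opprK /expi !cosN !expr2 => /(congr1 (@complex.Re R)) /=.
have c0 t : 0 <= t <= pi / 2 -> 0 <= cos t.
  move=> /andP[t0 tp]; apply: cos_ge0_pihalf; rewrite tp andbT (le_trans _ t0) //.
  by rewrite oppr_le0 divr_ge0 // pi_ge0.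
have e t : (cos t + cos t) * (cos t + cos t) - (sin (- t) + sin t) * (sin (- t) + sin t) =
   4 * cos t ^+ 2 by rewrite sinN; ring.
rewrite !e => /mulfI ce.
have {}ce : cos t1 = cos t2.
  apply/eqP; rewrite -(eqrXn2 (n := 2)) ?c0 //; apply/eqP; apply: ce.
  by rewrite pnatr_eq0.
have pi0 : 0 <= pi :> R := pi_ge0 R.
apply: cos_inj => //; rewrite in_itv /=.
  by case/andP: h1 => -> h1; apply: (le_trans h1); lra.
by case/andP: h2 => -> h2; apply: (le_trans h2); lra.
Qed.

Definition VT_dim l : nat :=
  match l with L0 => 0 | L2 => 2 | L3 _ => 3 | L4 => 4 | L5 _ => 5 | L6 => 6 | L8 => 8 end.

Lemma dim_VT l : \dim (VT l) = VT_dim l.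
Proof.
have u1 := unimod1 C; case: l => [||t||t||] /=.
- exact: dimv0.
- by rewrite VT2E dim_vt2.
- by rewrite VT3E dim_offv //; exact: unimod_expi.
- by rewrite VT4E; apply: dim_vt4; exact: omega_root.
- by rewrite VT5E dim_vt2_offv //; exact: unimod_expi.
- by rewrite VT6E dim_vt6.
- by rewrite VT8E dim_vt8.
Qed.

Lemma VT_quantum_graph l : is_quantum_graph (VT l).
Proof.
have u1 := unimod1 C; apply/quantum_graphE => //.
have tr S : (S <= vt8 C)%VS -> trless S by move/trless_sub.
case: l => [||t||t||] /=.
- by split=> X; rewrite memv0 => /eqP ->; rewrite ?mxtrace0 ?adj0 ?mem0v.
- by rewrite VT2E; split; [apply: tr; exact: vt2_sub|exact: sdj_vt2].
- have ht := unimod_expi (- t).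
  by rewrite VT3E; split; [apply: tr; exact: offv_sub|exact: sdj_offv].
- have w0 := omega_root R.
  by rewrite VT4E; split; [apply: tr; exact: vt4_sub|exact: sdj_vt4].
- have ht := unimod_expi (- t).
  rewrite VT5E; split; first by apply: tr; exact: vt2_offv_sub.
  by apply: sdj_addv; [exact: sdj_vt2|exact: sdj_offv].
- by rewrite VT6E; split; [apply: tr; exact: vt6_sub|exact: sdj_vt6].
- by rewrite VT8E; split; [exact: tr|exact: sdj_vt8].
Qed.

Lemma VT_transitive l : vertex_transitive (VT l).
Proof.
case: l => [||t||t||] /=.
- by apply: transitive_diagonal => u hu _; exact: conjv_0.
- by rewrite VT2E; exact: transitive_diagonal.
- by rewrite VT3E; case: (transitive_offv (unimod_expi (- t))).
- by rewrite VT4E; apply: transitive_vt4; [exact: omega_root|exact: omega_conj].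
- by rewrite VT5E; case: (transitive_offv (unimod_expi (- t))).
- by rewrite VT6E; exact: transitive_vt6.
- by rewrite VT8E; apply: transitive_diagonal => u hu _; exact: conjv_vt8.
Qed.

Lemma VT3_iso_inj t1 t2 : 0 <= t1 <= pi / 2 -> 0 <= t2 <= pi / 2 ->
  qg_iso (VT3 t1) (VT3 t2) -> t1 = t2.
Proof.
move=> h1 h2; rewrite !VT3E => /offv_iso_invariant e; apply: expi_inj => //.
by apply: e; exact: unimod_expi.
Qed.

Lemma VT5_iso_inj t1 t2 : 0 <= t1 <= pi / 2 -> 0 <= t2 <= pi / 2 ->
  qg_iso (VT5 t1) (VT5 t2) -> t1 = t2.
Proof.
move=> h1 h2; rewrite !VT5E => /vt2_offv_iso_invariant e; apply: expi_inj => //.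
by apply: e; exact: unimod_expi.
Qed.

Lemma qg_iso_dim S T : qg_iso S T -> \dim S = \dim T.
Proof. by case=> u hu <-; rewrite dim_conjv. Qed.

(** The dimension separates all labels except two members of the same one-parameter family. *)
Lemma VT_iso_inj l1 l2 : in_list l1 -> in_list l2 -> qg_iso (VT l1) (VT l2) -> l1 = l2.
Proof.
move=> h1 h2 iso; have := qg_iso_dim iso; rewrite !dim_VT.
case: l1 l2 h1 h2 iso => [||t1||t1||] [||t2||t2||] //= h1 h2 iso _.
  by rewrite (VT3_iso_inj h1 h2 iso).
by rewrite (VT5_iso_inj h1 h2 iso).
Qed.

Lemma classification S : is_quantum_graph S -> vertex_transitive S ->
  exists2 l, in_list l & qg_iso S (VT l).
Proof.
move=> qS vS; case: (transitive_iso (omega_root R) (omega_conj R) qS vS) => iso.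
- by exists L0.
- by exists L2; [|rewrite /VT VT2E; exact: iso].
- have [w hw h] := iso; have [t ht /h iso'] := unimod_angle hw.
  by exists (L3 t); [exact: ht|rewrite /VT VT3E; exact: iso'].
- by exists L4; [|rewrite /VT VT4E; exact: iso].
- have [w hw h] := iso; have [t ht /h iso'] := unimod_angle hw.
  by exists (L5 t); [exact: ht|rewrite /VT VT5E; exact: iso'].
- by exists L6; [|rewrite /VT VT6E; exact: iso].
- by exists L8; [|rewrite /VT VT8E; exact: iso].
Qed.

End Classification.

Theorem corollary5p14 (R : realType) :
  (forall l : VTlabel R, in_list l ->
     is_quantum_graph (VT l) /\ vertex_transitive (VT l)) /\
  ((forall l1 l2 : VTlabel R, in_list l1 -> in_list l2 ->
      l1 <> l2 -> ~ qg_iso (VT l1) (VT l2)) /\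
   (forall theta1 theta2 : R,
      0 <= theta1 <= pi / 2 -> 0 <= theta2 <= pi / 2 -> theta1 <> theta2 ->
      ~ qg_iso (VT3 theta1) (VT3 theta2) /\
      ~ qg_iso (VT5 theta1) (VT5 theta2))) /\
  (forall S : {vspace 'M[R[i]]_3},
     is_quantum_graph S -> vertex_transitive S ->
     exists2 l : VTlabel R, in_list l & qg_iso S (VT l)).
Proof.
split; first by move=> l _; split; [exact: VT_quantum_graph|exact: VT_transitive].
split; last exact: classification.
split=> [l1 l2 h1 h2 ne iso|t1 t2 h1 h2 ne]; first exact: ne (VT_iso_inj h1 h2 iso).
split=> iso; first exact: ne (VT3_iso_inj h1 h2 iso).
exact: ne (VT5_iso_inj h1 h2 iso).
Qed.
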